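(* Let $\omega=(\sqrt5-1)/2$, $\lambda\ge 8$, and let $H$ be the Fibonacci Hamiltonian on $\ell^2(\mathbb{Z})$, $[H\psi](n)=\psi(n+1)+\psi(n-1)+V(n)\psi(n)$ with $V(n)=\lambda\,\chi_{[1-\omega,1)}(n\omega \bmod 1)$. Let $$\xi(\lambda)=\frac{\lambda-4+\sqrt{(\lambda-4)^2-12}}{2},\qquad \alpha(\lambda)=\frac{2\log\frac{\sqrt5+1}{2}}{\log\xi(\lambda)}.$$ Then $\alpha_u^+\le\alpha(\lambda)$, and hence $\beta^+_{\delta_1}(p)\le\alpha(\lambda)$ for every $p>0$.
   Context: $\chi_{[1-\omega,1)}$ is the indicator function of the interval $[1-\omega,1)$. Let $\delta_n$ be the standard basis vectors of $\ell^2(\mathbb{Z})$. For $T>0$ set $a(n,T)=\frac{2}{T}\int_0^\infty e^{-2t/T}|\langle e^{-itH}\delta_1,\delta_n\rangle|^2dt$, $\langle|X|^p_{\delta_1}\rangle(T)=\sum_n|n|^pa(n,T)$, and $P(N,T)=\sum_{|n|>N}a(n,T)$. For $\alpha'\in[0,\infty]$ define $S^+(\alpha')=-\limsup_{T\to\infty}\frac{\log P(T^{\alpha'}-2,T)}{\log T}$, and $\alpha_u^+=\sup\{\alpha'\ge0: S^+(\alpha')<\infty\}$. The upper transport exponent is $\beta^+_{\delta_1}(p)=\limsup_{T\to\infty}\frac{\log\langle|X|^p_{\delta_1}\rangle(T)}{p\log T}$ for $p>0$. *)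

(* Defs.v *)
From HB Require Import structures.
From mathcomp Require Import all_boot all_order all_algebra.
From mathcomp Require Import all_classical all_reals all_analysis.
Set Implicit Arguments. Unset Strict Implicit. Unset Printing Implicit Defensive.
Import Order.TTheory GRing.Theory Num.Theory.
Import numFieldNormedType.Exports.
Local Open Scope classical_set_scope.
Local Open Scope ring_scope.

Section Fib.
Variable R : realType.

Definition fracR (x : R) : R := x - (Num.floor x)%:~R.

Definition omega : R := (Num.sqrt 5 - 1) / 2.

Definition fibV (lam : R) (n : int) : R :=
  if (1 - omega <= fracR (n%:~R * omega)) && (fracR (n%:~R * omega) < 1)
  then lam else 0.

(* hpow lam k n = (H^k delta_1)(n), where
   [H psi](n) = psi(n+1) + psi(n-1) + V(n) psi(n) *)
Fixpoint hpow (lam : R) (k : nat) (n : int) : R :=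
  match k with
  | 0 => if n == 1%Z then 1 else 0
  | k'.+1 => hpow lam k' (n + 1) + hpow lam k' (n - 1) + fibV lam n * hpow lam k' n
  end.

(* <e^{-itH} delta_1, delta_n> = sum_k (-i t)^k / k! (H^k delta_1)(n)
   (norm-convergent exponential series of the bounded operator -itH);
   since (H^k delta_1)(n) is real, its real and imaginary parts are: *)
Definition amp_re (lam t : R) (n : int) : R :=
  limn (series (fun k : nat =>
    if odd k then 0 else (-1) ^+ k./2 * t ^+ k / (k`!)%:R * hpow lam k n)).
Definition amp_im (lam t : R) (n : int) : R :=
  limn (series (fun k : nat =>
    if odd k then (-1) ^+ (k.+1)./2 * t ^+ k / (k`!)%:R * hpow lam k n else 0)).

Definition amp2 (lam t : R) (n : int) : R := amp_re lam t n ^+ 2 + amp_im lam t n ^+ 2.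

Local Open Scope ereal_scope.

Definition aT (lam : R) (n : int) (T : R) : \bar R :=
  (2 / T)%:E * \int[@lebesgue_measure R]_(t in `[0%R, +oo[%classic)
                 (expR (- (2 * t / T)) * amp2 lam t n)%:E.

Definition momentX (lam p T : R) : \bar R :=
  \esum_(n in [set: int]) ((`|n|%:~R : R) `^ p)%:E * aT lam n T.

Definition Ptail (lam : R) (N : \bar R) (T : R) : \bar R :=
  \esum_(n in [set n : int | N < ((`|n|%:~R : R))%:E]) aT lam n T.

Definition eln (x : \bar R) : \bar R :=
  match x with
  | r%:E => if (0 < r)%R then (ln r)%:E else -oo
  | +oo => +oo
  | -oo => -oo
  end.

(* T^a for a in [0, +oo] (T > 1): T^{+oo} = +oo *)
Definition epow (T : R) (a : \bar R) : \bar R :=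
  match a with
  | r%:E => (T `^ r)%:E
  | +oo => +oo
  | -oo => 0
  end.

Definition limsup_oo (f : R -> \bar R) : \bar R := limf_esup f (pinfty_nbhs R).

Definition Splus (lam : R) (a : \bar R) : \bar R :=
  - limsup_oo (fun T => eln (Ptail lam (epow T a - 2%:E) T) * ((ln T)^-1)%:E).

Definition alpha_u_plus (lam : R) : \bar R :=
  ereal_sup [set a : \bar R | 0 <= a /\ Splus lam a < +oo].

Definition beta_plus (lam p : R) : \bar R :=
  limsup_oo (fun T => eln (momentX lam p T) * ((p * ln T)^-1)%:E).

Local Close Scope ereal_scope.

Definition xi (lam : R) : R := (lam - 4 + Num.sqrt ((lam - 4) ^+ 2 - 12)) / 2.
Definition alpha_lam (lam : R) : R := 2 * ln ((Num.sqrt 5 + 1) / 2) / ln (xi lam).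

End Fib.

(* Main.v *)
Require Import Defs.
From mathcomp Require Import all_boot all_order all_algebra.
From mathcomp Require Import all_classical all_reals all_analysis.
From mathcomp Require Import measurable_realfun cyclic separable cyclotomic polyrcf.
From mathcomp Require Import ring lra zify.
Set Implicit Arguments. Unset Strict Implicit. Unset Printing Implicit Defensive.
Import Order.TTheory GRing.Theory Num.Theory.
From mathcomp Require Import complex.
Import numFieldNormedType.Exports Normc.
Local Open Scope classical_set_scope.
Local Open Scope ring_scope.

(** Let x_n be the trace of the transfer matrix over fib n sites; it satisfies
    x_{n+3} = x_{n+2} x_{n+1} - x_n and a Fricke invariant equal to 4 + lam^2.
    For lam >= 8 and real energies with |x_n| <= s (s slightly above 2), the
    recursion and the differentiated invariant give |x_n'|^2 >= eta^(n-2) for any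
    eta slightly below xi(lam).  All roots of x_n are real, so such a derivative
    bound passes to complex energies: |x_n(E + i eps)| > s as soon as
    eps^2 eta^n is large.  Once all traces exceed s, they grow
    like (s - 1)^(fib j), j counting the levels past that point.

    A large trace at z forces decay of any approximate solution g of
    (H - z) g = delta_1: summation by parts bounds Im z times the mass of g
    beyond a site by its flux through that site, and the Wronskian with a growing
    solution bounds the flux.  Taking Im z ~ 1/T, the number of sites at which
    decay sets in is about phi^n with T^2 ~ eta^n, i.e. T^alpha.

    In place of resolvents and Plancherel, g is a truncated generating function of
    Chebyshev vectors U_m(H/2A) delta_1, which solves the equation with
    z = A (w + 1/w) up to a small error.  Powers of H are averages of these over
    roots of unity on the circle |w| = r < 1, and e^{-itH} is the limit of
    (1 - itH/N)^N. *)

(** The number [xi lam] is the fixed point of one step of the derivative recursion at s = 2. A trace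
    b next to two traces of size at most 2 has |b| >= lam - 2 and derivative at most the sum of
    theirs, so from one small level to the next the derivative gains a factor x as soon as x <= (lam
    - 2) - 2 - 3 / x; equality is x^2 - (lam - 4) x + 3 = 0. Small levels are at most two apart, so
    |x_n'|^2 gains one x per level; hence the 2 in [alpha_lam]. The threshold cannot be 2 itself,
    since growth past it is like (s - 1)^(fib j). The price of s > 2, measured by k = s^2 - 4, is a
    rate below [xi lam]; every exponent a > [alpha_lam lam] leaves room for it. For |w| = r the
    point z = A (w + 1/w) runs over an ellipse, which crosses the real axis. A is so large that the
    flat ends lie outside the spectrum, where decay is elementary. The height is at most 1/(2T), so
    |e^{-itz}|^2 <= e^{t/T} is absorbed by the weight e^{-2t/T}. *)

Fixpoint fib (n : nat) : nat :=
  match n with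
  | 0 => 0
  | 1 => 1
  | (m.+1 as k).+1 => (fib k + fib m)%N
  end.

Lemma fibS2 n : fib n.+2 = (fib n.+1 + fib n)%N.
Proof. by []. Qed.

Lemma fib_mono m n : (m <= n)%N -> (fib m <= fib n)%N.
Proof.
apply: (@homo_leq _ fib leq) => // [k l p|k]; first exact: leq_trans.
by case: k => // k; rewrite fibS2 leq_addr.
Qed.

Lemma fib_gt0 n : (0 < n)%N -> (0 < fib n)%N.
Proof. by move=> n0; exact: (@leq_trans (fib 1)) (fib_mono n0). Qed.

(** * The trace recursion *)

(** When p <= t, the recursion v >= t q - p gives v - 1 >= (t - 1) (q - 1): the quantities a - 1 are
    supermultiplicative, so exponents add like Fibonacci numbers. The invariant a_i <= a_(i+2) keeps
    p <= t available. *)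
Lemma escape_bound (R : realFieldType) (s : R) (a : nat -> R) (j : nat) :
  2 <= s -> (forall n, a n.+2 * a n.+1 - a n <= a n.+3) ->
  a j <= s -> s < a j.+1 -> s < a j.+2 ->
  forall m, s < a (j + m.+1)%N /\ (s - 1) ^+ fib m.+1 <= a (j + m.+1)%N - 1.
Proof.
move=> s2 rec aj aj1 aj2.
suff P m : [/\ s < a (j + m).+1, s < a (j + m).+2, a (j + m)%N <= a (j + m).+2,
    (s - 1) ^+ fib m.+1 <= a (j + m).+1 - 1
    & (s - 1) ^+ fib m.+2 <= a (j + m).+2 - 1].
  by move=> m; case: (P m) => ? _ _ ? _; rewrite addnS.
elim: m => [|m [h1 h2 h3 h4 h5]].
  by rewrite addn0 /= !expr1; split => //; lra.
rewrite addnS; have r := rec (j + m)%N.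
set p := a (j + m)%N in h3 r; set q := a _.+1 in h1 h4 r *.
set t := a (j + m).+2 in h2 h3 h5 r *; set v := a _ in r *.
have A : t * (q - 1) <= v by rewrite mulrBr mulr1; lra.
have B : (t - 1) * (q - 1) <= v - 1 by rewrite mulrBl mul1r; lra.
have C : 1 * (q - 1) <= (t - 1) * (q - 1) by apply: ler_wpM2r; lra.
have D : (t - 1) * 1 <= (t - 1) * (q - 1) by apply: ler_wpM2l; lra.
split => //; [lra|lra|].
rewrite fibS2 exprD; apply: le_trans B; apply: ler_pM => //; apply: exprn_ge0; lra.
Qed.

(** Two consecutive values above s, traced back to the last small value before them, would satisfy
    the hypotheses of [escape_bound] and never come back below s. *)
Lemma small_pred (R : realFieldType) (s : R) (a : nat -> R) (n : nat) :
  2 <= s -> (forall n, a n.+2 * a n.+1 - a n <= a n.+3) ->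
  a 0%N <= s -> a n.+2 <= s -> a n.+1 <= s \/ a n <= s.
Proof.
move=> s2 rec a0 an2.
case: (lerP (a n.+1) s) => [|h1]; first by left.
case: (lerP (a n) s) => [|h0]; first by right.
have [j [jn aj H]] : exists j, [/\ (j < n)%N, a j <= s &
    forall i, (j < i <= n.+1)%N -> s < a i].
  elim: n h0 {an2} h1 => [|n IH] h0 h1; first by rewrite ltNge a0 in h0.
  case: (lerP (a n) s) => hn.
    exists n; split => // i /andP[ni]; rewrite leq_eqVlt => /predU1P[->//|].
    rewrite ltnS => ni'; by have -> : i = n.+1 by apply/eqP; rewrite eqn_leq ni' ni.
  have [j [jn aj H]] := IH hn h0.
  exists j; split => //; first by rewrite ltnS ltnW.
  move=> i /andP[ji]; rewrite leq_eqVlt => /predU1P[->//|ni].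
  by apply: H; rewrite ji.
have [||E _] := @escape_bound R s a j s2 rec aj _ _ (n.+1 - j)%N.
- by apply: H; rewrite leqnn /= ltnS ltnW.
- by apply: H; rewrite leqnSn /= ltnS.
- have jn1 : (j <= n.+1)%N := leq_trans (ltnW jn) (leqnSn n).
  move: E; rewrite addnS (subnKC jn1) => E.
  by have := lt_le_trans E an2; rewrite ltxx.
Qed.
(** As a quadratic in b the invariant reads (2b - yw)^2 = 4 lam^2 + (4 - y^2)(4 - w^2), and the last
    product is at least -4k. *)
Lemma fricke_big (R : realFieldType) (lam s k b y w : R) :
  8 <= lam -> 0 <= k -> k <= 1 / 4 -> s ^+ 2 = 4 + k ->
  b ^+ 2 + y ^+ 2 + w ^+ 2 - b * y * w = 4 + lam ^+ 2 ->
  `|y| <= s -> `|w| <= s -> lam - 2 - k <= `|b|.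
Proof.
move=> lam8 k0 k1 sk inv ys ws.
have y2 : y ^+ 2 <= 4 + k.
  by rewrite -real_normK ?num_real // -sk; apply: lerXn2r; rewrite ?nnegrE // (le_trans _ ys).
have w2 : w ^+ 2 <= 4 + k.
  by rewrite -real_normK ?num_real // -sk; apply: lerXn2r; rewrite ?nnegrE // (le_trans _ ws).
have yw : `|y * w| <= 4 + k.
  by rewrite normrM -sk expr2; apply: ler_pM.
have y0 := sqr_ge0 y; have w0 := sqr_ge0 w.
have P : - (4 * k) <= (4 - y ^+ 2) * (4 - w ^+ 2) by nra.
have E : (2 * lam - k) ^+ 2 <= (2 * b - y * w) ^+ 2.
  have -> : (2 * b - y * w) ^+ 2 = 4 * lam ^+ 2 + (4 - y ^+ 2) * (4 - w ^+ 2).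
    have -> : lam ^+ 2 = b ^+ 2 + y ^+ 2 + w ^+ 2 - b * y * w - 4 by rewrite inv; ring.
    ring.
  nra.
have F : 2 * lam - k <= `|2 * b - y * w|.
  rewrite -(@ler_pXn2r _ 2) ?nnegrE //; last by lra.
  by rewrite (real_normK (num_real _)).
have G : `|2 * b - y * w| <= 2 * `|b| + `|y * w|.
  by rewrite (le_trans (ler_normB _ _)) // normrM (ger0_norm (ler0n _ 2)).
lra.
Qed.

(** Rests on (2y - bw)^2 = (2b - yw)^2 - (4 - w^2)(b^2 - y^2), where the subtracted term is at least
    -k b^2. The two quantities compared are the partial derivatives of the invariant in y and in
    b. *)
Lemma fricke_deriv_coef (R : realFieldType) (k b y w : R) :
  0 <= k -> k <= 1 / 4 -> 5 <= `|b| -> y ^+ 2 <= 4 + k -> w ^+ 2 <= 4 + k ->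
  `|y * w| <= 4 + k -> `|2 * y - b * w| <= (1 + k) * `|2 * b - y * w|.
Proof.
move=> k0 k1 b5 y2 w2 yw.
have b2 : 25 <= b ^+ 2.
  by rewrite -(real_normK (num_real b)); have := normr_ge0 b; nra.
have A : `|b| <= `|2 * b - y * w|.
  have := lerB_dist (2 * b) (y * w); rewrite normrM (ger0_norm (ler0n _ 2)); lra.
have B : b ^+ 2 <= (2 * b - y * w) ^+ 2.
  by rewrite -(real_normK (num_real b)) -(real_normK (num_real (2 * b - y * w)));
     apply: lerXn2r; rewrite ?nnegrE.
rewrite -(@ler_pXn2r _ 2) ?nnegrE //; last by apply: mulr_ge0 => //; lra.
rewrite exprMn !(real_normK (num_real _)).
have w0 := sqr_ge0 w; have y0 := sqr_ge0 y.
have C : - (k * b ^+ 2) <= (4 - w ^+ 2) * (b ^+ 2 - y ^+ 2) by nra.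
have -> : (2 * y - b * w) ^+ 2 =
   (2 * b - y * w) ^+ 2 - (4 - w ^+ 2) * (b ^+ 2 - y ^+ 2) by ring.
set Z := (2 * b - y * w) ^+ 2 in B *.
nra.
Qed.

Lemma fricke_deriv (R : realFieldType) (s k b y w db dy dw : R) :
  0 <= k -> k <= 1 / 4 -> s ^+ 2 = 4 + k -> 5 <= `|b| -> `|y| <= s -> `|w| <= s ->
  (2 * b - y * w) * db + (2 * y - b * w) * dy + (2 * w - b * y) * dw = 0 ->
  `|db| <= (1 + k) * (`|dy| + `|dw|).
Proof.
move=> k0 k1 sk b5 ys ws J.
have y2 : y ^+ 2 <= 4 + k.
  by rewrite -real_normK ?num_real // -sk; apply: lerXn2r; rewrite ?nnegrE // (le_trans _ ys).
have w2 : w ^+ 2 <= 4 + k.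
  by rewrite -real_normK ?num_real // -sk; apply: lerXn2r; rewrite ?nnegrE // (le_trans _ ws).
have yw : `|y * w| <= 4 + k by rewrite normrM -sk expr2; apply: ler_pM.
have A := fricke_deriv_coef k0 k1 b5 y2 w2 yw.
have B : `|2 * w - b * y| <= (1 + k) * `|2 * b - y * w|.
  by rewrite (mulrC y w) fricke_deriv_coef // mulrC.
have C : 0 < `|2 * b - y * w|.
  have := lerB_dist (2 * b) (y * w); rewrite normrM (ger0_norm (ler0n _ 2)); lra.
rewrite -(ler_pM2l C) -normrM.
have -> : (2 * b - y * w) * db = - ((2 * y - b * w) * dy + (2 * w - b * y) * dw).
  by apply/eqP; rewrite -subr_eq0 opprK addrA J.
rewrite normrN (le_trans (ler_normD _ _)) // !normrM.
have hy := ler_wpM2r (normr_ge0 dy) A.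
have hw := ler_wpM2r (normr_ge0 dw) B.
set W := `|2 * b - y * w| in hy hw *; lra.
Qed.

(** Serves the level patterns small, large, small, small and small, small, large, small: b is the
    large trace, d and dp are the derivatives at the two small levels before the last one. *)
Lemma norm_step1 (R : realFieldType) (s k xi B b x d db dp : R) :
  1 <= xi -> 0 <= s -> 0 <= k ->
  xi <= B - s * (1 + k) - (s * (1 + k) + 1) / xi ->
  B <= `|b| -> `|x| <= s -> `|db| <= (1 + k) * (`|d| + `|dp|) ->
  xi * `|dp| <= `|d| ->
  xi * `|d| <= `|b * d + x * db - dp|.
Proof.
move=> xi1 s0 k0 rate Bb xs dbs dps.
have xi0 : 0 < xi by lra.
have A : `|b| * `|d| - s * ((1 + k) * (`|d| + `|dp|)) - `|dp| <= `|b * d + x * db - dp|.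
  have h1 := lerB_dist (b * d + x * db) dp.
  have h2 := lerB_dist (b * d) (- (x * db)).
  rewrite opprK normrN !normrM in h2.
  have h3 : `|x| * `|db| <= s * ((1 + k) * (`|d| + `|dp|)) by apply: ler_pM.
  lra.
apply: le_trans A.
have dp' : `|dp| <= `|d| / xi by rewrite ler_pdivlMr // mulrC.
have h4 : B * `|d| <= `|b| * `|d| by apply: ler_wpM2r.
have h5 : xi * `|d| <= (B - s * (1 + k) - (s * (1 + k) + 1) / xi) * `|d|.
  by apply: ler_wpM2r.
have h6 : (s * (1 + k) + 1) * `|dp| <= (s * (1 + k) + 1) * (`|d| / xi).
  by apply: ler_wpM2l => //; nra.
have E : (s * (1 + k) + 1) / xi * `|d| = (s * (1 + k) + 1) * (`|d| / xi) by ring.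
rewrite !mulrBl E in h5; lra.
Qed.

(** Serves the pattern small, large, small, large, small. Bounding the derivative of the last large
    trace by its neighbours would involve the very derivative to be estimated, so it is expanded by
    the recursion instead; b then occurs twice, which pays for the cruder bounds on the other
    terms. *)
Lemma norm_step2 (R : realFieldType) (s k xi B b x v c d db dp : R) :
  2 <= xi -> 2 <= s -> s <= 9 / 4 -> 0 <= k -> k <= 1 / 4 -> 6 - k <= B ->
  xi <= B - s * (1 + k) - (s * (1 + k) + 1) / xi ->
  B <= `|b| -> `|x| <= s -> `|v| <= s -> `|c| <= 2 -> `|db| <= (1 + k) * (`|d| + `|dp|) ->
  xi * `|dp| <= `|d| ->
  xi * `|d| <= `|(2 * b + v) * d + c * db - x * dp|.
Proof.
move=> xi1 s2 s3 k0 k1 B6 rate Bb xs vs cs dbs dps.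
have xi0 : 0 < xi by lra.
have s0 : 0 <= s by lra.
have A : (2 * `|b| - s) * `|d| - 2 * ((1 + k) * (`|d| + `|dp|)) - s * `|dp|
    <= `|(2 * b + v) * d + c * db - x * dp|.
  have h1 := lerB_dist ((2 * b + v) * d + c * db) (x * dp).
  have h2 := lerB_dist ((2 * b + v) * d) (- (c * db)).
  rewrite opprK normrN !normrM in h2.
  have h3 : `|c| * `|db| <= 2 * ((1 + k) * (`|d| + `|dp|)) by apply: ler_pM.
  have h4 := lerB_dist (2 * b) (- v).
  rewrite opprK normrN normrM (ger0_norm (ler0n _ 2)) in h4.
  have h5 : (2 * `|b| - s) * `|d| <= `|2 * b + v| * `|d| by apply: ler_wpM2r => //; lra.
  have h6 : `|x * dp| <= s * `|dp| by rewrite normrM ler_wpM2r.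
  lra.
apply: le_trans A.
have h4 : B * `|d| <= `|b| * `|d| by apply: ler_wpM2r.
have h5 : xi * `|d| <= (B - s * (1 + k) - (s * (1 + k) + 1) / xi) * `|d|.
  by apply: ler_wpM2r.
have h7 : 2 * `|dp| <= `|d| by have := normr_ge0 dp; nra.
have h8 : 0 <= (s * (1 + k) + 1) / xi * `|d|.
  by rewrite !(mulr_ge0, invr_ge0, addr_ge0) // (ltW xi0).
have h9 : s * (2 * `|dp|) <= s * `|d| by apply: ler_wpM2l => //; lra.
have h10 : k * (2 * `|dp|) <= k * `|d| by apply: ler_wpM2l.
have h11 : xi * `|d| <= B * `|d| - s * (1 + k) * `|d| by rewrite !mulrBl in h5; lra.
have h13 : 0 <= (s - 2) * (k * `|d|) by rewrite !mulr_ge0 // subr_ge0.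
have d0 := normr_ge0 d.
have h14 : (6 - k) * `|d| <= B * `|d| by apply: ler_wpM2r.
have h15 : k * `|d| <= 1 / 4 * `|d| by apply: ler_wpM2r.
have h16 : s * `|d| <= 9 / 4 * `|d| by apply: ler_wpM2r.
have h17 : 2 * `|d| <= s * `|d| by apply: ler_wpM2r.
lra.
Qed.

(** Induction over the small levels. [fricke_big] excludes three of them in a row and [small_pred]
    excludes two large levels right before a small one, so they are one or two apart, and each
    passage gains a factor xi. The spare xi on the right covers the start D 1 = D 2 = 1. *)
Lemma trace_deriv_lower (R : realFieldType) (lam s k xi : R) (X D : nat -> R) :
  8 <= lam -> 2 <= s -> s <= 9 / 4 -> 0 <= k -> k <= 1 / 4 -> s ^+ 2 = 4 + k ->
  2 <= xi -> xi <= (lam - 2 - k) - s * (1 + k) - (s * (1 + k) + 1) / xi ->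
  X 0%N = 2 -> D 0%N = 0 -> D 1%N = 1 -> D 2%N = 1 ->
  (forall n, X n.+3 = X n.+2 * X n.+1 - X n) ->
  (forall n, D n.+3 = D n.+2 * X n.+1 + X n.+2 * D n.+1 - D n) ->
  (forall n, X n.+2 ^+ 2 + X n.+1 ^+ 2 + X n ^+ 2 - X n.+2 * X n.+1 * X n = 4 + lam ^+ 2) ->
  (forall n, (2 * X n.+2 - X n.+1 * X n) * D n.+2
           + (2 * X n.+1 - X n.+2 * X n) * D n.+1
           + (2 * X n - X n.+2 * X n.+1) * D n = 0) ->
  forall n, `|X n.+1| <= s -> xi ^+ n <= xi * D n.+1 ^+ 2.
Proof.
move=> lam8 s2 s3 k0 k1 sk xi2 rate X0 D0 D1 D2 recX recD inv dinv.
have s0 : 0 <= s by lra.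
have B6 : 6 - k <= lam - 2 - k by lra.
have xi1 : 1 <= xi by lra.
have xi0 : 0 <= xi by lra.
have not3 n : `|X n| <= s -> `|X n.+1| <= s -> `|X n.+2| <= s -> False.
  move=> a b c; have := fricke_big lam8 k0 k1 sk (inv n) b a; lra.
have mid n : `|X n| <= s -> `|X n.+2| <= s -> lam - 2 - k <= `|X n.+1| /\
    `|D n.+1| <= (1 + k) * (`|D n.+2| + `|D n|).
  move=> a b.
  have big : lam - 2 - k <= `|X n.+1|.
    by apply: (fricke_big lam8 k0 k1 sk _ b a); rewrite -(inv n); ring.
  split=> //; apply: (fricke_deriv k0 k1 sk _ b a); first by lra.
  by rewrite -(dinv n); ring.
have top n : `|X n| <= s -> `|X n.+1| <= s -> lam - 2 - k <= `|X n.+2| /\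
    `|D n.+2| <= (1 + k) * (`|D n.+1| + `|D n|).
  move=> a b.
  have big := fricke_big lam8 k0 k1 sk (inv n) b a.
  split=> //; apply: (fricke_deriv k0 k1 sk _ b a); first by lra.
  by rewrite -(dinv n); ring.
(* The induction must carry the previous small level and the gain made since: both step lemmas need
   the ratio of two successive derivatives. *)
pose Q n := `|X n.+1| <= s -> xi ^+ n <= xi * D n.+1 ^+ 2 /\
  ((`|X n| <= s /\ xi * `|D n| <= `|D n.+1|) \/
   (exists m, [/\ n = m.+1, s < `|X n|, `|X m| <= s & xi * `|D m| <= `|D n.+1|])).
have grow j n (d e : R) : (n <= j.+2)%N -> xi ^+ j <= xi * d ^+ 2 -> xi * `|d| <= `|e| ->
    xi ^+ n <= xi * e ^+ 2.
  move=> nj hj de.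
  have h1 : xi ^+ n <= xi ^+ j.+2 by exact: ler_weXn2l.
  have h2 : xi ^+ 2 * d ^+ 2 <= e ^+ 2.
    rewrite -exprMn -(real_normK (num_real e)) -(real_normK (num_real (xi * d))).
    apply: lerXn2r; rewrite ?nnegrE //.
    by rewrite normrM (ger0_norm xi0).
  apply: (le_trans h1); apply: (@le_trans _ _ (xi * (xi ^+ 2 * d ^+ 2))).
    have -> : xi ^+ j.+2 = xi ^+ 2 * xi ^+ j by rewrite -exprD.
    by rewrite mulrCA; apply: ler_wpM2l => //; exact: exprn_ge0.
  exact: ler_wpM2l.
suff QP n : Q n by move=> n h; case: (QP n h).
elim/ltn_ind: n => -[|[|n]] IH.
- move=> _; rewrite expr0 D1 expr1n mulr1; split; first by lra.
  by left; rewrite X0 D0 normr0 mulr0 normr1 (ger0_norm (ler0n _ 2)).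
- move=> h; rewrite expr1 D2 expr1n mulr1; split => //.
  right; exists 0%N; rewrite D0 normr0 mulr0 X0 (ger0_norm (ler0n _ 2)); split => //.
  by rewrite ltNge; apply/negP => h1; apply: (not3 0%N) => //; rewrite X0 (ger0_norm (ler0n _ 2)).
move=> h.
have recA i : `|X i.+2| * `|X i.+1| - `|X i| <= `|X i.+3|.
  by rewrite recX -normrM; exact: lerB_dist.
have aX0 : `|X 0%N| <= s by rewrite X0 (ger0_norm (ler0n _ 2)).
case: (@small_pred R s (fun i => `|X i|) n.+1 s2 recA aX0 h) => h1.
  have [g1 [[h2 _]|[m [[<-] h2 h3 h4]]]] := IH n.+1 (leqnn _) h1.
    by case: (not3 _ h2 h1 h).
  have [big db] := mid _ h3 h1.
  have st : xi * `|D n.+2| <= `|D n.+3|.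
    rewrite recD [D _ * X _]mulrC.
    exact: (norm_step1 xi1 s0 k0 rate big h1 db h4).
  by split; [apply: (grow n.+1 _ (D n.+2)) | left].
case: (lerP `|X n.+2| s) => h1'.
  have [g1 [[h2 _]|[m [[<-] h2 h3 h4]]]] := IH n.+1 (leqnn _) h1'.
    by case: (not3 _ h2 h1' h).
  by have := lt_le_trans h2 h1; rewrite ltxx.
have [g1 [[h2 h3]|[m [E h2 h3 h4]]]] := IH n (leqnSn _) h1.
  have [big db] := top _ h2 h1.
  have st : xi * `|D n.+1| <= `|D n.+3|.
    have -> : D n.+3 = X n.+2 * D n.+1 + X n.+1 * D n.+2 - D n by rewrite recD; ring.
    exact: (norm_step1 xi1 s0 k0 rate big h1 db h3).
  by split; [apply: (grow n _ (D n.+1)) | right; exists n.+1].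
subst n.
have [big db] := mid _ h3 h1.
have [big' _] := mid _ h1 h.
(* Multiplied by the large x_(m+1), this quantity equals x_(m+4) + x_(m+2) x_m, which contains small
   traces only. *)
have c2 : `|X m.+2 ^+ 2 - 1| <= 2.
  have E : (X m.+2 ^+ 2 - 1) * X m.+1 = X m.+4 + X m.+2 * X m.
    by rewrite (recX m.+1) (recX m); ring.
  have h5 : `|X m.+2 ^+ 2 - 1| * `|X m.+1| <= s + s ^+ 2.
    rewrite -normrM E (le_trans (ler_normD _ _)) // lerD // normrM expr2.
    by apply: ler_pM.
  rewrite leNgt; apply/negP => c2.
  have h6 : 2 * (lam - 2 - k) <= `|X m.+2 ^+ 2 - 1| * `|X m.+1|.
    by apply: ler_pM => //; [move: lam8 k1; clear; lra | exact: ltW].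
  by move: h5 h6 sk lam8 k1 s3; clear; lra.
have st : xi * `|D m.+2| <= `|D m.+4|.
  have -> : D m.+4 = (2 * X m.+3 + X m) * D m.+2 + (X m.+2 ^+ 2 - 1) * D m.+1 - X m.+2 * D m.
    by rewrite (recD m.+1) (recD m) (recX m); ring.
  exact: (norm_step2 xi2 s2 s3 k0 k1 B6 rate big' h1 h3 c2 db h4).
by split; [apply: (grow m.+1 _ (D m.+2)) | right; exists m.+2].
Qed.

(** * Real-rooted polynomials off the real axis *)

Lemma horner_prod_XsubC (R : comNzRingType) (c : R) (rs : seq R) (x : R) :
  (c *: \prod_(r <- rs) ('X - r%:P)).[x] = c * \prod_(r <- rs) (x - r).
Proof.
by rewrite hornerZ horner_prod; congr (_ * _); apply: eq_bigr => r _; rewrite hornerXsubC.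
Qed.

Lemma horner_deriv_prod_XsubC (R : fieldType) (c : R) (rs : seq R) (x : R) :
  x \notin rs ->
  (c *: \prod_(r <- rs) ('X - r%:P))^`().[x] =
  c * (\prod_(r <- rs) (x - r)) * \sum_(r <- rs) (x - r)^-1.
Proof.
rewrite derivZ hornerZ -mulrA => xrs; congr (_ * _).
elim: rs xrs => [|r rs IH]; first by rewrite !big_nil derivC horner0 mulr0.
rewrite inE negb_or => /andP[xr /IH {}IH].
rewrite !big_cons derivM derivXsubC mul1r hornerD hornerM hornerXsubC IH horner_prod.
rewrite (eq_bigr (fun r => x - r)); last by move=> i _; rewrite hornerXsubC.
by field; rewrite subr_eq0.
Qed.

Lemma seq_max_below (R : realFieldType) (rs : seq R) (E : R) :
  has (fun r => r < E) rs ->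
  exists r, [/\ r \in rs, r < E & forall q, q \in rs -> q < E -> q <= r].
Proof.
elim: rs => // r rs IH /=; case: (boolP (has _ rs)) => [h _|h].
  have [m [mrs mE mmax]] := IH h.
  case: (boolP (r < E)) => rE; last first.
    exists m; split => //; first by rewrite inE mrs orbT.
    by move=> q; rewrite inE => /predU1P[->|/mmax]//; rewrite (negbTE rE).
  have [rm|mr] := lerP r m.
    exists m; split => //; first by rewrite inE mrs orbT.
    by move=> q; rewrite inE => /predU1P[->|/mmax].
  exists r; split => //; first by rewrite inE eqxx.
  move=> q; rewrite inE => /predU1P[->//|/mmax] h' qE.
  exact: (le_trans (h' qE) (ltW mr)).
rewrite orbF => rE; exists r; split => //; first by rewrite inE eqxx.
move=> q; rewrite inE => /predU1P[->//|qrs] qE.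
by move/hasPn: h => /(_ q qrs); rewrite qE.
Qed.

(** Moving left from E to the nearest root r, the logarithmic derivative increases and so stays
    positive; thus P^2 increases on (r, E) and |P| <= s there. The mean value theorem exhibits P(E)
    / (E - r) as a value of P' at a point where [hL] applies. *)
Lemma slope_from_left_root (R : rcfType) (c s L E : R) (rs : seq R) :
  (forall x, `|c * \prod_(r <- rs) (x - r)| <= s ->
     L <= `|(c *: \prod_(r <- rs) ('X - r%:P))^`().[x]|) ->
  `|c * \prod_(r <- rs) (E - r)| <= s -> E \notin rs -> c != 0 ->
  0 < \sum_(r <- rs) (E - r)^-1 ->
  exists2 r, r \in rs & L <= `|c * \prod_(q <- rem r rs) (E - q)|.
Proof.
set P := c *: _ => hL Es Ers c0 S0.
have evP x : P.[x] = c * \prod_(r <- rs) (x - r) by rewrite horner_prod_XsubC.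
have hasr : has (fun r => r < E) rs.
  apply/negPn/negP => /hasPn h; move: S0; rewrite ltNge => /negP; apply.
  rewrite big_seq; apply: sumr_le0 => r /h; rewrite -leNgt => Er.
  by rewrite invr_le0 subr_le0.
have [r [rrs rE rmax]] := seq_max_below hasr.
exists r => //.
have nrs x : r < x -> x <= E -> x \notin rs.
  move=> rx; rewrite le_eqVlt => /predU1P[->//|xE].
  by apply/negP => xrs; have := rmax x xrs xE; rewrite leNgt rx.
have mono x : r < x -> x < E -> P.[x] ^+ 2 <= P.[E] ^+ 2.
  move=> rx xE.
  have [y] := poly_mvt (P ^+ 2) xE.
  rewrite !horner_exp inE /= => /andP[xy yE] eq.
  rewrite -subr_ge0 eq; apply: mulr_ge0; last by rewrite subr_ge0 ltW.
  have yrs : y \notin rs by apply: nrs; [exact: lt_trans xy | exact: ltW].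
  rewrite expr2 derivM hornerD !hornerM [P^`().[y] * _]mulrC -mulr2n mulrn_wge0 //.
  rewrite horner_deriv_prod_XsubC // -evP mulrA; apply: mulr_ge0.
    by rewrite -expr2 sqr_ge0.
  apply: le_trans (ltW S0) _; rewrite big_seq [leRHS]big_seq.
  apply: ler_sum => q qrs.
  have qE : q != E by apply: contraNneq Ers => <-.
  have qy : q != y by apply: contraNneq yrs => <-.
  case: (ltrP q E) => [hq|hq].
    have qr := rmax q qrs hq.
    rewrite lef_pV2 ?posrE ?subr_gt0 //; last by apply: le_lt_trans qr (lt_trans rx xy).
      by rewrite lerD2r ltW.
  have hq' : E < q by rewrite lt_neqAle eq_sym qE.
  rewrite lef_nV2 ?negrE ?subr_lt0 //; last by apply: lt_trans yE hq'.
  by rewrite lerD2r ltW.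
have [y] := poly_mvt P rE.
rewrite inE /= => /andP[ry yE].
have -> : P.[r] = 0.
  by rewrite evP (big_rem r) //= subrr mul0r mulr0.
rewrite subr0 evP (big_rem r) //= => eq.
have eq' : c * \prod_(q <- rem r rs) (E - q) = P^`().[y].
  apply: (@mulIf _ (E - r)); first by rewrite subr_eq0 gt_eqF.
  by rewrite -eq; ring.
rewrite eq'; apply: hL; rewrite -evP; apply: le_trans Es; rewrite -evP.
rewrite -(@ler_pXn2r _ 2) ?nnegrE // !(real_normK (num_real _)).
exact: mono.
Qed.

(** The derivative bound excludes a zero logarithmic derivative at E. If it is negative, the useful
    root lies to the right, and the reflection x to -x brings it to the left. *)
Lemma slope_from_root (R : rcfType) (c s L E : R) (rs : seq R) :
  0 < L ->
  (forall x, `|c * \prod_(r <- rs) (x - r)| <= s ->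
     L <= `|(c *: \prod_(r <- rs) ('X - r%:P))^`().[x]|) ->
  `|c * \prod_(r <- rs) (E - r)| <= s -> c != 0 ->
  exists2 r, r \in rs & L <= `|c * \prod_(q <- rem r rs) (E - q)|.
Proof.
move=> L0 hL Es c0; have LE := hL E Es.
case: (boolP (E \in rs)) => [Ers|Ers].
  exists E => //; move: LE; rewrite (big_rem E) //= derivZ derivM derivXsubC mul1r.
  by rewrite hornerZ hornerD hornerM hornerXsubC subrr mul0r addr0 -hornerZ horner_prod_XsubC.
have S0 : \sum_(r <- rs) (E - r)^-1 != 0.
  apply/eqP => S0; move: LE; rewrite horner_deriv_prod_XsubC // S0 mulr0 normr0.
  by rewrite leNgt L0.
case: (ltrP 0 (\sum_(r <- rs) (E - r)^-1)) => [|Sn].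
  exact: (slope_from_left_root hL Es Ers c0).
pose c' := c * (-1) ^+ size rs; pose rs' := map -%R rs.
have refl (l : seq R) (x : R) :
    \prod_(r <- map -%R l) (x - r) = (-1) ^+ size l * \prod_(r <- l) (- x - r).
  rewrite big_map; elim: l => [|a l IH]; first by rewrite !big_nil mulr1.
  by rewrite !big_cons IH /= exprS; ring.
have evc' (x : R) : c' * \prod_(r <- rs') (x - r) = c * \prod_(r <- rs) (- x - r).
  by rewrite refl mulrA /c' -[_ * _ * _ ^+ _]mulrA -expr2 sqrr_sign mulr1.
have dP : c' *: \prod_(r <- rs') ('X - r%:P) =
    (c *: \prod_(r <- rs) ('X - r%:P)) \Po (- 'X).
  rewrite linearZ /= rmorph_prod /= /rs' big_map /c' -scalerA; congr (_ *: _).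
  elim: (rs) => [|a l IH]; first by rewrite !big_nil scale1r.
  rewrite !big_cons -IH comp_polyB comp_polyX comp_polyC /= exprS rmorphN /= -!mul_polyC.
  by rewrite polyCM polyCN polyC1; ring.
have [|||||r] := @slope_from_left_root R c' s L (- E) rs'.
- move=> x; rewrite evc' => /hL; rewrite dP deriv_comp derivN derivX hornerM.
  by rewrite horner_comp !hornerE mulrN1 normrN.
- by rewrite evc' opprK.
- by rewrite mem_map //; exact: oppr_inj.
- by rewrite mulf_neq0 // signr_eq0.
- have opp r : (- E - - r)^-1 = - (E - r)^-1 by rewrite -invrN; congr (_ ^-1); ring.
  by rewrite big_map (eq_bigr _ (fun r _ => opp r)) sumrN oppr_gt0 lt_neqAle S0.
move=> /mapP[q qrs ->]; 
have -> : rem (- q) rs' = map -%R (rem q rs).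
  rewrite /rs'; elim: (rs) => //= a l IH; rewrite eqr_opp.
  by case: eqP => //= _; rewrite IH.
move=> h; exists q => //; move: h.
by rewrite refl opprK /c' !normrM !normrX normrN1 !expr1n mul1r mulr1.
Qed.

Lemma sqr_normcE (R : rcfType) (z : R[i]) : normc z ^+ 2 = Re z ^+ 2 + Im z ^+ 2.
Proof. by case: z => a b /=; rewrite sqr_sqrtr // addr_ge0 ?sqr_ge0. Qed.

Lemma normc_ge0 (R : rcfType) (z : R[i]) : 0 <= normc z.
Proof. by case: z => a b; apply: sqrtr_ge0. Qed.

Lemma normcX (R : rcfType) (z : R[i]) n : normc (z ^+ n) = normc z ^+ n.
Proof. by elim: n => [|n IH]; rewrite ?expr0 ?normc1 // !exprS normcM IH. Qed.

Lemma normc_prod (R : rcfType) (I : Type) (r : seq I) (F : I -> R[i]) :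
  normc (\prod_(i <- r) F i) = \prod_(i <- r) normc (F i).
Proof. by elim/big_ind2: _ => [|x a y b <- <-|//]; rewrite ?normc1 // normcM. Qed.

Lemma normc_sum (R : rcfType) (I : Type) (r : seq I) (P : pred I) (F : I -> R[i]) :
  normc (\sum_(i <- r | P i) F i) <= \sum_(i <- r | P i) normc (F i).
Proof.
elim/big_ind2: _ => [|x a y b hx hy|//]; first by rewrite normc0.
exact: le_trans (le_normcD _ _) (lerD hx hy).
Qed.

Lemma normc_real (R : rcfType) (x : R) : normc x%:C%C = `|x|.
Proof. by rewrite /= expr0n addr0 sqrtr_sqr. Qed.

Lemma normRe_le (R : rcfType) (z : R[i]) : `|Re z| <= normc z.
Proof.
rewrite -(@ler_pXn2r _ 2) ?nnegrE ?normc_ge0 // sqr_normcE (real_normK (num_real _)).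
by rewrite lerDl sqr_ge0.
Qed.

Lemma normIm_le (R : rcfType) (z : R[i]) : `|Im z| <= normc z.
Proof.
rewrite -(@ler_pXn2r _ 2) ?nnegrE ?normc_ge0 // sqr_normcE (real_normK (num_real _)).
by rewrite lerDr sqr_ge0.
Qed.

(** * Traces of transfer matrices *)

(** The ring is a parameter so that the same recursion serves real energies, complex energies and,
    with ['X] for z, polynomials in the energy. The terms 2 and z extend the recursion backwards
    from the one-site trace z - lam. *)
Fixpoint trace3 (R : nzRingType) (lam z : R) (n : nat) : R * R * R :=
  if n is m.+1 then
    let: (a, b, c) := trace3 lam z m in (b, c, c * b - a)
  else (2, z, z - lam).

Definition trace_seq (R : nzRingType) (lam z : R) (n : nat) : R := (trace3 lam z n).1.1.

Lemma trace_seqS3 (R : nzRingType) (lam z : R) n :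
  trace_seq lam z n.+3 = trace_seq lam z n.+2 * trace_seq lam z n.+1 - trace_seq lam z n.
Proof. by rewrite /trace_seq /=; case: trace3 => -[]. Qed.

Lemma trace_seq_inv (R : comNzRingType) (lam z : R) n :
  trace_seq lam z n.+2 ^+ 2 + trace_seq lam z n.+1 ^+ 2 + trace_seq lam z n ^+ 2
  - trace_seq lam z n.+2 * trace_seq lam z n.+1 * trace_seq lam z n = 4 + lam ^+ 2.
Proof.
elim: n => [|n <-]; first by rewrite /trace_seq /=; ring.
by rewrite trace_seqS3; ring.
Qed.

Lemma rmorph_trace_seq (R S : nzRingType) (f : {rmorphism R -> S}) (lam z : R) n :
  f (trace_seq lam z n) = trace_seq (f lam) (f z) n.
Proof.
suff H : [/\ f (trace_seq lam z n) = trace_seq (f lam) (f z) n,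
    f (trace_seq lam z n.+1) = trace_seq (f lam) (f z) n.+1
  & f (trace_seq lam z n.+2) = trace_seq (f lam) (f z) n.+2] by case: H.
elim: n => [|n [h0 h1 h2]].
  by rewrite /trace_seq /= rmorph_nat rmorphB.
by split => //; rewrite !trace_seqS3 rmorphB rmorphM h0 h1 h2.
Qed.

Lemma horner_trace_seq (R : comNzRingType) (lam x : R) n :
  (trace_seq lam%:P 'X n).[x] = trace_seq lam x n.
Proof.
rewrite -[LHS]/(horner_eval x _) rmorph_trace_seq /=.
by rewrite /horner_eval hornerC hornerX.
Qed.

Lemma trace_seq_deriv_lower (R : realFieldType) (lam s k xi x : R) n :
  8 <= lam -> 2 <= s -> s <= 9 / 4 -> 0 <= k -> k <= 1 / 4 -> s ^+ 2 = 4 + k ->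
  2 <= xi -> xi <= (lam - 2 - k) - s * (1 + k) - (s * (1 + k) + 1) / xi ->
  `|trace_seq lam x n.+1| <= s ->
  xi ^+ n <= xi * (trace_seq lam%:P 'X n.+1)^`().[x] ^+ 2.
Proof.
move=> lam8 s2 s3 k0 k1 sk xi2 rate; move: n.
pose p := trace_seq lam%:P 'X.
apply: (trace_deriv_lower (X := trace_seq lam x) (D := fun n => (p n)^`().[x])
  lam8 s2 s3 k0 k1 sk xi2 rate) => //.
- by rewrite /p /trace_seq /= -polyC_natr derivC horner0.
- by rewrite /p /trace_seq /= derivX hornerC.
- by rewrite /p /trace_seq /= derivB derivX derivC subr0 hornerC.
- by move=> m; exact: trace_seqS3.
- move=> m; rewrite /p trace_seqS3 derivB derivM hornerD hornerN hornerD !hornerM.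
  by rewrite !horner_trace_seq.
- by move=> m; exact: trace_seq_inv.
move=> m; have := congr1 (fun q : {poly R} => q^`().[x]) (trace_seq_inv lam%:P 'X m).
rewrite -/p -polyC_natr -!polyC_exp -polyCD derivC horner0 => E.
rewrite -!(horner_trace_seq lam) -/p -[RHS]E.
rewrite !expr2 !(derivD, derivB, derivM, derivN) !(hornerD, hornerN, hornerM); ring.
Qed.

(** * Solutions of the difference equation and transfer matrices *)

Fixpoint sol2 (K : nzRingType) (v : nat -> K) (z y1 y0 : K) (n : nat) : K * K :=
  if n is m.+1 then
    let: (a, b) := sol2 v z y1 y0 m in (b, (z - v n) * b - a)
  else (y0, y1).

Definition sol (K : nzRingType) (v : nat -> K) (z y1 y0 : K) (n : nat) : K :=
  (sol2 v z y1 y0 n).1.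

Lemma solS2 (K : nzRingType) (v : nat -> K) (z y1 y0 : K) n :
  sol v z y1 y0 n.+2 = (z - v n.+1) * sol v z y1 y0 n.+1 - sol v z y1 y0 n.
Proof. by rewrite /sol /=; case: sol2. Qed.

Lemma sol_lin (K : comNzRingType) (v : nat -> K) (z y1 y0 : K) n :
  sol v z y1 y0 n = y1 * sol v z 1 0 n + y0 * sol v z 0 1 n.
Proof.
suff H : sol v z y1 y0 n = y1 * sol v z 1 0 n + y0 * sol v z 0 1 n /\
   sol v z y1 y0 n.+1 = y1 * sol v z 1 0 n.+1 + y0 * sol v z 0 1 n.+1 by case: H.
elim: n => [|n [h0 h1]]; first by rewrite /sol /=; split; ring.
by split => //; rewrite !solS2 h0 h1; ring.
Qed.

Lemma sol_wronskian (K : comNzRingType) (v : nat -> K) (z : K) n :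
  sol v z 1 0 n.+1 * sol v z 0 1 n - sol v z 1 0 n * sol v z 0 1 n.+1 = 1.
Proof.
elim: n => [|n IH]; first by rewrite /sol /=; ring.
by rewrite !solS2 -[RHS]IH; ring.
Qed.

Lemma sol_shift (K : comNzRingType) (v : nat -> K) (z y1 y0 : K) q p :
  (forall m, (0 < m <= p)%N -> v (q + m)%N = v m) ->
  forall m, (m <= p)%N ->
  sol v z y1 y0 (q + m)%N =
    sol v z y1 y0 q.+1 * sol v z 1 0 m + sol v z y1 y0 q * sol v z 0 1 m /\
  sol v z y1 y0 (q + m.+1)%N =
    sol v z y1 y0 q.+1 * sol v z 1 0 m.+1 + sol v z y1 y0 q * sol v z 0 1 m.+1.
Proof.
move=> per m mp; rewrite -!(sol_lin _ _ (sol v z y1 y0 q.+1)).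
elim: m mp => [|m IH] mp; first by rewrite addn0 addn1.
have [h0 h1] := IH (ltnW mp); split => //.
by rewrite !addnS solS2 solS2 -h0 -h1 -!addnS per // mp.
Qed.

(** Trace of the transfer matrix over the sites 1 to q; its columns are the solutions with initial
    data (1, 0) and (0, 1). *)
Definition sol_trace (K : nzRingType) (v : nat -> K) (z : K) (q : nat) : K :=
  sol v z 1 0 q.+1 + sol v z 0 1 q.

(** The repetitions of v give M_(q+p) = M_p M_q and M_(q+p+q) = M_q M_p M_q. Since det M_q = 1,
    Cayley-Hamilton yields tr (M_q M_p M_q) = tr (M_p M_q) tr M_q - tr M_p. *)
Lemma sol_trace_fib (K : comNzRingType) (v : nat -> K) (lam z : K) :
  v 1%N = lam -> v 2%N = 0 -> v 3%N = lam ->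
  (forall n m, (2 < n)%N -> (0 < m <= fib n.-1)%N -> v (fib n + m)%N = v m) ->
  forall n, sol_trace v z (fib n.+2) = trace_seq lam z n.+2.
Proof.
move=> v1 v2 v3 per n.
suff H : [/\ sol_trace v z (fib n.+2) = trace_seq lam z n.+2,
    sol_trace v z (fib n.+3) = trace_seq lam z n.+3
  & sol_trace v z (fib n.+4) = trace_seq lam z n.+4] by case: H.
elim: n => [|n [h0 h1 h2]].
  by rewrite /sol_trace /trace_seq /sol /= v1 v2 v3; split; ring.
split => //; rewrite trace_seqS3 -h0 -h1 -h2.
set q := fib n.+3; set p := fib n.+2.
have e4 : fib n.+4 = (q + p)%N by [].
have -> : fib n.+4.+1 = (fib n.+4 + q)%N by [].
have per1 m : (0 < m <= p)%N -> v (q + m)%N = v m by exact: (per n.+3).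
have per2 m : (0 < m <= q)%N -> v (fib n.+4 + m)%N = v m by exact: (per n.+4).
have [c1 c2] := sol_shift z 1 0 per2 (leqnn q).
have [d1 d2] := sol_shift z 0 1 per2 (leqnn q).
have [c3 c4] := sol_shift z 1 0 per1 (leqnn p).
have [d3 d4] := sol_shift z 0 1 per1 (leqnn p).
rewrite /sol_trace -addnS c2 d1 e4 -addnS c3 c4 d3 d4.
have W := sol_wronskian v z q.
move: (sol v z 1 0 q.+1) (sol v z 0 1 q) (sol v z 1 0 q) (sol v z 0 1 q.+1) W => a d c b W.
move: (sol v z 1 0 p.+1) (sol v z 0 1 p) (sol v z 1 0 p) (sol v z 0 1 p.+1) => a' d' c' b'.
(* The claim becomes a polynomial identity once the coefficient 1 of tr M_p is replaced by the
   determinant [W]. *)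
rewrite -[X in _ = _ - X]mul1r -[X in _ = _ - X * _]W; ring.
Qed.

Definition csol (R : rcfType) (v : nat -> R) (z y1 y0 : R[i]) : nat -> R[i] :=
  sol (fun n => (v n)%:C%C) z y1 y0.

Lemma csol_im (R : rcfType) (v : nat -> R) (z y1 y0 : R[i]) n :
  Im (csol v z y1 y0 n.+1 * (csol v z y1 y0 n)^*%C) =
  Im (y1 * y0^*%C) + Im z * \sum_(1 <= m < n.+1) normc (csol v z y1 y0 m) ^+ 2.
Proof.
elim: n => [|n IH]; first by rewrite big_geq // mulr0 addr0.
rewrite big_nat_recr //= mulrDr addrA -IH /csol solS2.
move: (sol _ _ _ _ n) (sol _ _ _ _ n.+1) => [a b] [c d]; case: z {IH} => x y.
by rewrite sqr_normcE /=; ring.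
Qed.

(* A trace-zero matrix M of determinant 1 has M^2 = -1; the resulting antiperiodic
   solution would violate monotonicity of the flux if Im z were nonzero. *)
Lemma sol_trace_real_root (R : rcfType) (v : nat -> R) (z : R[i]) q :
  (0 < q)%N -> sol_trace (fun n => (v n)%:C%C) z q = 0 -> Im z = 0.
Proof.
rewrite /sol_trace => q0 T.
set a := sol _ z 1 0 q.+1 in T; set d := sol _ z 0 1 q in T.
pose c := csol v z 1 0 q; pose b := csol v z 0 1 q.+1.
have W : a * d - c * b = 1 by exact: sol_wronskian.
have da : d = - a by apply/eqP; rewrite -addr_eq0 addrC T.
have e1 : csol v z a c q.+1 = -1.
  by rewrite /csol sol_lin -/a -/(csol v z 0 1 q.+1) -/b -W da; ring.
have e0 : csol v z a c q = 0.
  by rewrite /csol sol_lin -/d -/(csol v z 1 0 q) -/c da; ring.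
have := csol_im v z 1 0 q; have := csol_im v z a c q.
rewrite e1 e0 conjc0 !mulr0 /= -/c -/a.
rewrite -/(csol v z 1 0 q.+1) -/c.
have -> : csol v z 1 0 q.+1 = a by [].
set S1 := \sum_(_ <= _ < _) _; set S2 := \sum_(_ <= _ < _) _ => h1 h2.
have S1p : 0 <= S1 by apply: sumr_ge0 => i _; rewrite sqr_ge0.
have S2p : 1 <= S2.
  rewrite /S2 big_ltn // {1}/csol {1}/sol [sol2 _ _ _ _ _]/= normc1 expr1n lerDl.
  by apply: sumr_ge0 => i _; rewrite sqr_ge0.
have : Im z * (S1 + S2) = 0 by rewrite mulrDr; move: h1 h2; clear; lra.
move/eqP; rewrite mulf_eq0 => /predU1P[//|/eqP S0].
by exfalso; move: S0 S1p S2p; clear; lra.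
Qed.

Lemma trace_seq_real_roots (R : rcfType) (v : nat -> R) (lam : R) n (z : R[i]) :
  v 1%N = lam -> v 2%N = 0 -> v 3%N = lam ->
  (forall n m, (2 < n)%N -> (0 < m <= fib n.-1)%N -> v (fib n + m)%N = v m) ->
  trace_seq lam%:C%C z n.+1 = 0 -> Im z = 0.
Proof.
move=> v1 v2 v3 per; case: n => [T|n T]; first by have -> : z = 0 := T.
apply: (@sol_trace_real_root _ v z (fib n.+2)); first exact: fib_gt0.
rewrite (sol_trace_fib (lam := lam%:C%C)) //= ?v1 ?v2 ?v3 // => k m k2 mk.
by rewrite per.
Qed.

Lemma trace_seq_split (R : rcfType) (lam : R) n :
  (forall z : R[i], trace_seq lam%:C%C z n = 0 -> Im z = 0) ->
  exists2 crs : R * seq R, trace_seq lam%:P 'X n = crs.1 *: \prod_(r <- crs.2) ('X - r%:P)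
  & forall z : R[i], normc (trace_seq lam%:C%C z n) ^+ 2 =
      crs.1 ^+ 2 * \prod_(r <- crs.2) ((Re z - r) ^+ 2 + Im z ^+ 2).
Proof.
move=> real_root; set p := trace_seq lam%:P 'X n.
pose f := map_poly (real_complex R).
have fp : f p = trace_seq lam%:C%C%:P 'X n.
  by rewrite /f rmorph_trace_seq /= map_polyC map_polyX.
have [rs Ers] := closed_field_poly_normal (f p).
have rsR r : r \in rs -> r = (Re r)%:C%C.
  move=> rrs; have : Im r = 0.
    apply: real_root; rewrite -horner_trace_seq -fp Ers horner_prod_XsubC.
    by rewrite (big_rem r) //= subrr mul0r mulr0.
  by case: r {rrs} => a b /= ->.
exists (lead_coef p, map (@Re R) rs) => /=.
  apply: (map_poly_inj (real_complex R)); rewrite -/f Ers lead_coef_map.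
  rewrite [RHS]map_polyZ; congr (_ *: _).
  rewrite rmorph_prod big_map big_seq [RHS]big_seq; apply: eq_bigr => r /rsR {1}->.
  by rewrite rmorphB /= map_polyX map_polyC.
move=> z; rewrite -horner_trace_seq -fp Ers horner_prod_XsubC normcM exprMn lead_coef_map.
rewrite normc_real (real_normK (num_real _)) normc_prod -prodrXl big_map; congr (_ * _).
rewrite big_seq [RHS]big_seq; apply: eq_bigr => r /rsR ->.
by rewrite sqr_normcE; case: (z) => x y /=; rewrite subr0.
Qed.

(** As all roots are real, leaving the real axis only increases |x|, which settles the case |x(Re
    z)| > s. Otherwise one root is split off: its factor contributes at least |Im z|, and the rest
    of the product, evaluated at Re z, is at least the slope bound L. *)
Lemma trace_seq_lower (R : rcfType) (v : nat -> R) (lam s k xi : R) n (z : R[i]) :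
  8 <= lam -> 2 <= s -> s <= 9 / 4 -> 0 <= k -> k <= 1 / 4 -> s ^+ 2 = 4 + k ->
  2 <= xi -> xi <= (lam - 2 - k) - s * (1 + k) - (s * (1 + k) + 1) / xi ->
  v 1%N = lam -> v 2%N = 0 -> v 3%N = lam ->
  (forall n m, (2 < n)%N -> (0 < m <= fib n.-1)%N -> v (fib n + m)%N = v m) ->
  s ^+ 2 * xi < Im z ^+ 2 * xi ^+ n ->
  s < normc (trace_seq lam%:C%C z n.+1).
Proof.
move=> lam8 s2 s3 k0 k1 sk xi2 rate v1 v2 v3 per big.
have s0 : 0 <= s by lra.
have xi0 : 0 < xi by lra.
have [|[c rs] /= Ep En] := @trace_seq_split R lam n.+1.
  by move=> w; apply: (trace_seq_real_roots v1 v2 v3 per).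
rewrite -(@ltr_pXn2r _ 2) ?nnegrE ?normc_ge0 // En.
have evp x : trace_seq lam x n.+1 = c * \prod_(r <- rs) (x - r).
  by rewrite -horner_trace_seq Ep horner_prod_XsubC.
have [hE|hE] := lerP `|trace_seq lam (Re z) n.+1| s; last first.
  apply: (@lt_le_trans _ _ (`|trace_seq lam (Re z) n.+1| ^+ 2)).
    by rewrite ltr_pXn2r ?nnegrE.
  rewrite (real_normK (num_real _)) evp exprMn; apply: ler_wpM2l; first exact: sqr_ge0.
  rewrite -prodrXl; apply: ler_prod => r _; rewrite sqr_ge0 /=.
  by rewrite lerDl sqr_ge0.
pose L := Num.sqrt (xi ^+ n / xi).
have L2 : L ^+ 2 = xi ^+ n / xi by rewrite sqr_sqrtr // divr_ge0 ?exprn_ge0 // ltW.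
have L0 : 0 < L by rewrite sqrtr_gt0 divr_gt0 ?exprn_gt0.
have hL x : `|c * \prod_(r <- rs) (x - r)| <= s ->
     L <= `|(c *: \prod_(r <- rs) ('X - r%:P))^`().[x]|.
  rewrite -evp -Ep => /(trace_seq_deriv_lower lam8 s2 s3 k0 k1 sk xi2 rate) h.
  rewrite -(@ler_pXn2r _ 2) ?nnegrE ?(ltW L0) // L2 (real_normK (num_real _)).
  by rewrite ler_pdivrMr // mulrC.
have c0 : c != 0.
  apply/eqP => c0; have := hL 0; rewrite c0 mul0r normr0 scale0r derivC horner0 normr0.
  by move=> /(_ s0); rewrite leNgt L0.
rewrite evp in hE; have [r rrs hr] := slope_from_root L0 hL hE c0.
apply: (@lt_le_trans _ _ (Im z ^+ 2 * L ^+ 2)).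
  by rewrite L2 mulrA ltr_pdivlMr.
rewrite (big_rem r) //= [leRHS]mulrCA.
apply: ler_pM; [exact: sqr_ge0 | exact: sqr_ge0 | by rewrite lerDr sqr_ge0 |].
apply: (@le_trans _ _ (`|c * \prod_(q <- rem r rs) (Re z - q)| ^+ 2)).
  by apply: lerXn2r; rewrite ?nnegrE // ltW.
rewrite (real_normK (num_real _)) exprMn; apply: ler_wpM2l; first exact: sqr_ge0.
rewrite -prodrXl; apply: ler_prod => q _; rewrite sqr_ge0 /=.
by rewrite lerDl sqr_ge0.
Qed.

(** [escape_bound] has to start at the last small level i. It exists because x_0 = 2 is small, and i
    <= n by [trace_seq_lower], so at least j further levels remain. *)
Lemma trace_seq_growth (R : rcfType) (v : nat -> R) (lam s k xi : R) n j (z : R[i]) :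
  8 <= lam -> 2 <= s -> s <= 9 / 4 -> 0 <= k -> k <= 1 / 4 -> s ^+ 2 = 4 + k ->
  2 <= xi -> xi <= (lam - 2 - k) - s * (1 + k) - (s * (1 + k) + 1) / xi ->
  v 1%N = lam -> v 2%N = 0 -> v 3%N = lam ->
  (forall n m, (2 < n)%N -> (0 < m <= fib n.-1)%N -> v (fib n + m)%N = v m) ->
  s ^+ 2 * xi < Im z ^+ 2 * xi ^+ n ->
  (s - 1) ^+ fib j.+1 <= normc (trace_seq lam%:C%C z (n + j).+1).
Proof.
move=> lam8 s2 s3 k0 k1 sk xi2 rate v1 v2 v3 per big.
pose a i := normc (trace_seq lam%:C%C z i).
have xi1 : 1 <= xi by lra.
have large i : (n < i)%N -> s < a i.
  case: i => // i ni.
  apply: (trace_seq_lower lam8 s2 s3 k0 k1 sk xi2 rate v1 v2 v3 per).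
  apply: (lt_le_trans big); apply: ler_wpM2l; first exact: sqr_ge0.
  exact: ler_weXn2l.
have a0 : a 0%N <= s.
  have -> : a 0%N = normc (2 : R)%:C%C by rewrite rmorph_nat.
  by rewrite normc_real normr_nat.
have recA i : a i.+2 * a i.+1 - a i <= a i.+3.
  rewrite /a trace_seqS3 -normcM lerBlDr -[X in normc X <= _](subrK (trace_seq lam%:C%C z i)).
  exact: le_normcD.
have [i [ni ai H]] : exists i, [/\ (i <= n)%N, a i <= s & forall l, (i < l)%N -> s < a l].
  elim: n large {big} => [|n IH] large; first by exists 0%N; split.
  have [hn|hn] := lerP (a n.+1) s; first by exists n.+1; split.
  have [l|i [ni ai H]] := IH.
    by rewrite leq_eqVlt => /predU1P[<-//|/large].
  by exists i; split => //; exact: leqW.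
have [_ E] := escape_bound s2 recA ai (H _ (ltnSn _)) (H _ (ltnW (ltnSn _))) (n + j - i)%N.
rewrite addnS subnKC in E; last by rewrite (leq_trans ni) // leq_addr.
apply: (@le_trans _ _ (a (n + j).+1 - 1)); last by rewrite lerBlDr lerDl.
apply: le_trans E; apply: ler_weXn2l; first by lra.
apply: fib_mono; rewrite ltnS; move: ni; clear; lia.
Qed.

(** * The Fibonacci potential *)

Lemma omega_sq (R : realType) : omega R ^+ 2 = 1 - omega R.
Proof.
have h : Num.sqrt (5 : R) ^+ 2 = 5 by rewrite sqr_sqrtr.
rewrite /omega; move: h; set q := Num.sqrt _ => h.
have -> : ((q - 1) / 2) ^+ 2 = (q ^+ 2 - 2 * q + 1) / 4 by field.
by rewrite h; field.
Qed.

Lemma omega_bounds (R : realType) : 3 / 5 < omega R /\ omega R < 5 / 8.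
Proof.
have h := omega_sq R.
have h0 : 0 < omega R.
  rewrite /omega divr_gt0 // subr_gt0 -[ltLHS]sqrtr1 ltr_sqrt //; lra.
split; rewrite ltNge; apply/negP => h1; nra.
Qed.

(* m^2 - m p - p^2 is a norm form of Q(sqrt 5); it bounds |m omega - p| below. *)
Lemma norm_form_neq0 (m p : int) : 0 < m -> m ^+ 2 - m * p - p ^+ 2 != 0.
Proof.
move=> m0; apply/eqP => h.
have e : 5 * m ^+ 2 = (2 * p + m) ^+ 2 by lia.
have e' : (5 * absz m ^ 2)%N = (absz (2 * p + m)%R ^ 2)%N.
  by have := congr1 absz e; rewrite abszM !abszX.
have mn : (0 < absz m)%N by lia.
have qn : (0 < absz (2 * p + m)%R)%N by rewrite lt0n; apply/negP => /eqP q0; move: e'; rewrite q0; nia.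
have := congr1 (logn 5) e'; rewrite lognM ?expn_gt0 ?mn // !lognX.
rewrite (_ : logn 5 5 = 1%N) // => h5; lia.
Qed.

Lemma norm_form_factor (R : realType) (m p : int) :
  (m ^+ 2 - m * p - p ^+ 2)%:~R =
  (m%:~R * omega R - p%:~R) * (m%:~R * (1 + omega R) + p%:~R).
Proof.
have h := omega_sq R; rewrite !rmorphB !rmorphXn /= rmorphM /=.
set w := omega R in h *; set a := m%:~R; set b := p%:~R.
have -> : (a * w - b) * (a * (1 + w) + b) = a ^+ 2 * (w + w ^+ 2) - a * b - b ^+ 2 by ring.
by rewrite h; ring.
Qed.

Lemma omega_irrational (R : realType) (m p : int) : 0 < m -> m%:~R * omega R != p%:~R.
Proof.
move=> m0; apply/eqP => h; have := norm_form_factor R m p.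
rewrite h subrr mul0r => /eqP; rewrite intr_eq0; apply/negP; exact: norm_form_neq0.
Qed.

Lemma fib_binet (R : realType) n :
  (fib n)%:R * (1 + 2 * omega R) = (1 + omega R) ^+ n - (- omega R) ^+ n /\
  (fib n.+1)%:R * (1 + 2 * omega R) = (1 + omega R) ^+ n.+1 - (- omega R) ^+ n.+1.
Proof.
have h := omega_sq R; elim: n => [|n [h0 h1]]; first by rewrite /= !expr0 !expr1; split; ring.
split => //; rewrite fibS2 natrD mulrDl h0 h1 !exprS; set w := omega R in h *.
have e1 : (1 + w) * ((1 + w) * (1 + w) ^+ n) = (1 + 2 * w + w ^+ 2) * (1 + w) ^+ n by ring.
have e2 : - w * (- w * (- w) ^+ n) = w ^+ 2 * (- w) ^+ n by ring.
by rewrite e1 e2 h; ring.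
Qed.

Lemma omega_pow_fib (R : realType) n :
  (fib n.+1)%:R * omega R - (fib n)%:R = - (- omega R) ^+ n.+1.
Proof.
have h := omega_sq R; elim: n => [|n IH]; first by rewrite /= expr1; ring.
rewrite exprS fibS2 natrD.
have -> : (- omega R) ^+ n.+1 = (fib n)%:R - (fib n.+1)%:R * omega R by lra.
set w := omega R in h *.
have -> : - (- w * ((fib n)%:R - (fib n.+1)%:R * w)) =
  w * (fib n)%:R - (fib n.+1)%:R * w ^+ 2 by ring.
by rewrite h; ring.
Qed.

(** The norm form is a nonzero integer and factors as d (m sqrt 5 - d) with d = m omega - p and sqrt
    5 = 1 + 2 omega. If |d| <= omega^n, the bound on m makes this product less than 1 in modulus. *)
Lemma omega_approx (R : realType) n (m p : int) :
  (4 < n)%N -> 0 < m -> m <= (fib n.-1)%:Z + 1 -> omega R ^+ n < `|m%:~R * omega R - p%:~R|.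
Proof.
move=> n4 m0 mn; rewrite ltNge; apply/negP => hd.
have [w0 w1] := omega_bounds R; have wsq := omega_sq R.
have w00 : 0 < omega R by lra.
have w11 : omega R <= 1 by lra.
have fac := norm_form_factor R m p.
have one : 1 <= `|(m ^+ 2 - m * p - p ^+ 2)%:~R : R|.
  rewrite -intr_norm ler1z; have := norm_form_neq0 p m0; set N := m ^+ 2 - _ - _; clear; lia.
move: hd one; rewrite fac normrM; set d := _ - p%:~R => hd one.
set t := omega R ^+ n in hd.
(* This is t <= omega^5. The case n = 4 is out of reach: 3 omega - 2 = - omega^4 is an equality. *)
have Ht : 0 < t <= 5 * omega R - 3.
  rewrite exprn_gt0 //=.
  have -> : 5 * omega R - 3 = omega R ^+ 5.
    have -> : omega R ^+ 5 = omega R * (omega R ^+ 2) ^+ 2 by ring.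
    rewrite wsq; move: wsq; set w := omega R => wsq.
    have -> : w * (1 - w) ^+ 2 = w - 2 * w ^+ 2 + w * w ^+ 2 by ring.
    rewrite wsq; have -> : w - 2 * (1 - w) + w * (1 - w) = 4 * w - 2 - w ^+ 2 by ring.
    by rewrite wsq; ring.
  by apply: ler_wiXn2l => //; exact: ltW.
have Ed : m%:~R * (1 + omega R) + p%:~R = m%:~R * (1 + 2 * omega R) - d.
  by rewrite /d; ring.
rewrite Ed in one.
have mR : m%:~R <= (fib n.-1)%:R + 1 :> R.
  by have := mn; rewrite -(ler_int R) rmorphD /= => h; exact: h.
have B : `|m%:~R * (1 + 2 * omega R) - d| <= ((fib n.-1)%:R + 1) * (1 + 2 * omega R) + t.
  apply: le_trans (ler_normB _ _) _; apply: lerD => //.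
  rewrite ger0_norm; last by apply: mulr_ge0; [rewrite ler0z ltW | rewrite addr_ge0 // mulr_ge0 // ltW].
  by apply: ler_wpM2r => //; rewrite addr_ge0 // mulr_ge0 // ltW.
have [bin _] := fib_binet R n.-1.
have C : (fib n.-1)%:R * (1 + 2 * omega R) <= (1 + omega R) ^+ n.-1 + omega R ^+ n.-1.
  rewrite bin lerD2l; apply: le_trans (ler_norm _) _.
  by rewrite normrN normrX normrN ger0_norm // ltW.
have one' : 1 <= t * ((1 + omega R) ^+ n.-1 + omega R ^+ n.-1 + (1 + 2 * omega R) + t).
  apply: (le_trans one); apply: ler_pM => //; apply: (le_trans B).
  by rewrite mulrDl mul1r lerD2r lerD2r.
have n0 : (0 < n)%N by exact: leq_trans n4.
have e1 : t * (1 + omega R) ^+ n.-1 = omega R.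
  rewrite /t -(prednK n0) // exprS -mulrA -exprMn.
  have -> : omega R * (1 + omega R) = 1 by rewrite mulrDr mulr1 -expr2 wsq; ring.
  by rewrite expr1n mulr1.
have e2 : omega R ^+ n.-1 = t * (1 + omega R).
  rewrite /t -[in RHS](prednK n0) // exprS mulrAC.
  have -> : omega R * (1 + omega R) = 1 by rewrite mulrDr mulr1 -expr2 wsq; ring.
  by rewrite mul1r.
rewrite !mulrDr e1 e2 in one'.
move: Ht w0 w1 one' => /andP[t0 t1] w0 w1; set w := omega R in t1 w0 w1 * => one'.
have t2 : t <= 1 / 8 by lra.
have t3 : t * t <= t * (1 / 8) by apply: ler_wpM2l => //; exact: ltW.
have t4 : t * w <= t * (5 / 8) by apply: ler_wpM2l; exact: ltW.
have t5 : t * (t * w) <= t * (1 / 8) by apply: ler_wpM2l; [exact: ltW | lra].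
rewrite !mulrDr !mulr1 in one'; clear - one' t2 t3 t4 t5 t0 t1 w1; lra.
Qed.

Lemma fibV_floor (R : realType) (lam : R) (n k : int) :
  k%:~R <= n%:~R * omega R -> n%:~R * omega R < k%:~R + 1 ->
  fibV lam n = if 1 - omega R <= n%:~R * omega R - k%:~R then lam else 0.
Proof.
move=> h1 h2; rewrite /fibV /fracR.
have -> : Num.floor (n%:~R * omega R) = k.
  by apply: floor_def; rewrite h1 rmorphD.
by have -> : n%:~R * omega R - k%:~R < 1; [rewrite ltrBlDl | rewrite andbT].
Qed.

Lemma floor_ex (R : realType) (x : R) : exists k : int, k%:~R <= x /\ x < k%:~R + 1.
Proof.
exists (Num.floor x); rewrite floor_le_tmp; split => //.
by have := floorD1_gt x; rewrite rmorphD.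
Qed.

Lemma fibV_small (R : realType) (lam : R) :
  [/\ fibV lam 1 = lam, fibV lam 2 = 0, fibV lam 3 = lam, fibV lam 4 = lam & fibV lam 5 = 0].
Proof.
have [w0 w1] := omega_bounds R.
have V (n k : int) := @fibV_floor R lam n k.
split.
- by rewrite (V 1 0); [case: lerP => //; lra | lra | lra].
- by rewrite (V 2 1); [case: lerP => //; lra | lra | lra].
- by rewrite (V 3 1); [case: lerP => //; lra | lra | lra].
- by rewrite (V 4 2); [case: lerP => //; lra | lra | lra].
- by rewrite (V 5 3); [case: lerP => //; lra | lra | lra].
Qed.

(** The shift moves m omega mod 1 by omega^n in modulus. The value could change only by crossing 0
    or 1 - omega, that is, if m omega or (m + 1) omega were that close to an integer;
    [omega_approx], which for this purpose reaches up to fib n.-1 + 1, forbids it. The levels 3 and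
    4 are checked by hand. *)
Lemma fibV_period (R : realType) (lam : R) n m :
  (2 < n)%N -> (0 < m <= fib n.-1)%N ->
  fibV lam (fib n + m)%N%:Z = fibV lam m%:Z.
Proof.
move=> n2 /andP[m0 mn].
have [V1 V2 V3 V4 V5] := fibV_small lam.
have [|n4] := leqP n 4.
  rewrite leq_eqVlt ltnS => /predU1P[En|n3].
    move: m0 mn; rewrite En; case: m => [|[|[|m]]] //= _ _; rewrite ?V1 ?V4 ?V2 ?V5 //.
  have En : n = 3%N by lia.
  by move: m0 mn; rewrite En; case: m => [|[|m]] //= _ _; rewrite ?V1 ?V3.
have [w0 w1] := omega_bounds R.
have [k [k1 k2]] := floor_ex (m%:~R * omega R).
have h1 := @omega_approx R n m k n4 ltac:(lia) ltac:(lia).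
have h2 := @omega_approx R n m (k + 1) n4 ltac:(lia) ltac:(lia).
have h3 := @omega_approx R n (m%:Z + 1) (k + 1) n4 ltac:(lia) ltac:(lia).
have sig := omega_pow_fib R n.-1.
rewrite (prednK (leq_trans _ n4)) // in sig.
set s := - (- omega R) ^+ n in sig.
have hs : `|s| <= omega R ^+ n.
  by rewrite normrN normrX normrN ger0_norm //; lra.
have Ex : (fib n + m)%N%:~R * omega R = (fib n.-1)%:R + (m%:~R * omega R + s).
  by rewrite -sig PoszD rmorphD /=; ring.
have eps0 : 0 <= omega R ^+ n by apply: exprn_ge0; lra.
rewrite !rmorphD /= in h2 h3.
move: hs; rewrite ler_norml => /andP[s1 s2].
rewrite (fibV_floor lam k1 k2) (@fibV_floor R lam _ ((fib n.-1)%:Z + k)); last 2 first.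
- rewrite Ex rmorphD /=; move: h1 h2 k1 k2 s1 s2; clear.
  by case: ger0P => ?; case: ger0P => ?; lra.
- rewrite Ex rmorphD /=; move: h1 h2 k1 k2 s1 s2; clear.
  by case: ger0P => ?; case: ger0P => ?; lra.
congr (if _ then _ else _).
rewrite Ex rmorphD /=; move: h1 h2 h3 k1 k2; rewrite mulrDl.
set x := m%:~R * omega R => h1 h2 h3 k1 k2.
clear - h1 h2 h3 k1 k2 s1 s2 w0 w1.
move: (k%:~R : R) x (omega R) (omega R ^+ n) s h1 h2 h3 k1 k2 s1 s2 w0 w1; clear.
move=> K x w e s + + + h1 h2 h3 h4 h5 h6.
have [?|?] := ger0P; have [?|?] := ger0P; have [?|?] := ger0P => *; apply/idP/idP; lra.
Qed.

(** Both sides ask whether an integer lies between m omega and (m + 1) omega; they differ only in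
    which endpoint is included, and neither endpoint is an integer. *)
Lemma fibV_reflect (R : realType) (lam : R) m :
  (0 < m)%N -> fibV lam (- m.+1%:Z) = fibV lam m%:Z.
Proof.
move=> m0; have [w0 w1] := omega_bounds R.
have [k [k1 k2]] := floor_ex (m.+1%:~R * omega R).
have i1 := @omega_irrational R m.+1 k ltac:(lia).
have i2 := @omega_irrational R m k ltac:(lia).
have E : m.+1%:~R * omega R = m%:~R * omega R + omega R.
  by rewrite -[m.+1%:Z]/(Posz m.+1) -addn1 PoszD rmorphD /=; ring.
set x := m%:~R * omega R in E i2 *; rewrite E in k1 k2 i1.
have k3 : k%:~R < x + omega R by rewrite lt_neqAle eq_sym i1.
rewrite (@fibV_floor R lam _ (- k - 1)); last 2 first.
- by rewrite rmorphN /= mulNr E rmorphB rmorphN /=; move: k2; clear; lra.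
- by rewrite rmorphN /= mulNr E rmorphB rmorphN /=; move: k3; clear; lra.
rewrite rmorphN /= mulNr E rmorphB rmorphN /=.
case: (ltgtP x k%:~R) i2 => // hx _.
  rewrite (@fibV_floor R lam m (k - 1)) ?rmorphB -/x /=; [|lra|lra].
  by case: lerP => ?; case: lerP => ?; lra.
rewrite (@fibV_floor R lam m k) -/x; [|lra|lra].
by case: lerP => ?; case: lerP => ?; lra.
Qed.

(** * Decay from large traces *)

Lemma tail_flux (R : rcfType) (v : nat -> R) (z : R[i]) (g e : nat -> R[i]) (B b : nat) :
  (forall m, (B <= m)%N -> g m = 0) ->
  (forall m, g m.+2 + g m + (v m.+1)%:C%C * g m.+1 - z * g m.+1 = e m.+1) ->
  Im (g b * (g b.+1)^*%C) =
  Im z * (\sum_(b.+1 <= m < B) normc (g m) ^+ 2) +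
  \sum_(b.+1 <= m < B) Im (e m * (g m)^*%C).
Proof.
move=> gB eq.
have step m : Im (g m * (g m.+1)^*%C) - Im (g m.+1 * (g m.+2)^*%C) =
    Im z * normc (g m.+1) ^+ 2 + Im (e m.+1 * (g m.+1)^*%C).
  rewrite -eq sqr_normcE; move: (g m) (g m.+1) (g m.+2) (z) (v m.+1).
  by move=> [a a'] [c c'] [d d'] [x x'] w /=; ring.
have [Bb|bB] := leqP B b.
  by rewrite gB // mul0r !big_geq ?(leqW Bb) // mulr0 addr0.
rewrite mulr_sumr -big_split /= big_add1.
have -> : \sum_(b <= i < B.-1) (Im z * normc (g i.+1) ^+ 2 + Im (e i.+1 * (g i.+1)^*%C)) =
    \sum_(b <= i < B.-1) - (Im (g i.+1 * (g i.+2)^*%C) - Im (g i * (g i.+1)^*%C)).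
  by apply: eq_bigr => i _; rewrite -step opprB.
rewrite sumrN telescope_sumr; last by rewrite -ltnS (prednK (leq_ltn_trans _ bB)).
rewrite (prednK (leq_ltn_trans _ bB)) // (gB B) // conjc0 mulr0 /=.
by rewrite sub0r opprK.
Qed.

Lemma tail_wronskian (R : rcfType) (v : nat -> R) (z y1 y0 : R[i]) (g e : nat -> R[i]) (b : nat) :
  (forall m, g m.+2 + g m + (v m.+1)%:C%C * g m.+1 - z * g m.+1 = e m.+1) ->
  csol v z y1 y0 b.+1 * g b - csol v z y1 y0 b * g b.+1 =
  y1 * g 0%N - y0 * g 1%N - \sum_(1 <= m < b.+1) csol v z y1 y0 m * e m.
Proof.
move=> eq; elim: b => [|b IH]; first by rewrite big_geq // subr0.
rewrite big_nat_recr //= opprD addrA -IH -eq /csol solS2.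
by ring.
Qed.

(** The imaginary part of the Wronskian times the conjugate of Y g_(b+1) is |Y|^2 times the flux of
    g plus |g_(b+1)|^2 times the flux of y. Up to the error both fluxes have the sign of Im z, so
    nothing cancels and the second may be dropped. One factor |Y| is divided out; the other is the
    gain. *)
Lemma tail_bound (R : rcfType) (v : nat -> R) (z y1 y0 : R[i]) (g e : nat -> R[i]) (B b : nat) :
  (forall m, (B <= m)%N -> g m = 0) ->
  (forall m, g m.+2 + g m + (v m.+1)%:C%C * g m.+1 - z * g m.+1 = e m.+1) ->
  Im (y1 * y0^*%C) = 0 ->
  `|Im z| * (\sum_(b.+1 <= m < B) normc (g m) ^+ 2) * normc (csol v z y1 y0 b.+1) <=
  (\sum_(b.+1 <= m < B) normc (e m) * normc (g m)) * normc (csol v z y1 y0 b.+1) +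
  normc (y1 * g 0%N - y0 * g 1%N - \sum_(1 <= m < b.+1) csol v z y1 y0 m * e m)
    * normc (g b.+1).
Proof.
move=> gB eq y10.
rewrite -(tail_wronskian y1 y0 b eq).
have F := tail_flux b gB eq; have G := csol_im v z y1 y0 b.
rewrite y10 add0r in G.
set tau := \sum_(b.+1 <= m < B) normc (g m) ^+ 2 in F *.
set err := \sum_(b.+1 <= m < B) Im _ in F.
set S := \sum_(1 <= m < b.+1) _ in G.
have S0 : 0 <= S by apply: sumr_ge0 => i _; exact: sqr_ge0.
have tau0 : 0 <= tau by apply: sumr_ge0 => i _; exact: sqr_ge0.
have err_le : `|err| <= \sum_(b.+1 <= m < B) normc (e m) * normc (g m).
  apply: le_trans (ler_norm_sum _ _ _) _; apply: ler_sum => m _.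
  apply: le_trans (normIm_le _) _; rewrite normcM.
  by have -> : normc (g m)^*%C = normc (g m); [case: (g m) => p q /=; rewrite sqrrN|].
set eta := \sum_(b.+1 <= m < B) _ in err_le *.
set Y := csol v z y1 y0 b.+1 in G *; set y := csol v z y1 y0 b in G *.
set om := Y * g b - y * g b.+1.
have key : Im (om * (Y * g b.+1)^*%C) =
    Im z * (normc Y ^+ 2 * tau + normc (g b.+1) ^+ 2 * S) + normc Y ^+ 2 * err.
  have -> : Im (om * (Y * g b.+1)^*%C) = normc Y ^+ 2 * Im (g b * (g b.+1)^*%C) +
     normc (g b.+1) ^+ 2 * Im (Y * y^*%C).
    rewrite /om !sqr_normcE; move: (g b) (g b.+1) (Y) (y) => [p p'] [q q'] [a a'] [c c'] /=.
    by ring.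
  by rewrite F G; ring.
have N1 : normc (Y * g b.+1)^*%C = normc Y * normc (g b.+1).
  by rewrite -normcM; case: (_ * _) => p q /=; rewrite sqrrN.
have up : `|Im (om * (Y * g b.+1)^*%C)| <= normc om * (normc Y * normc (g b.+1)).
  by rewrite -N1 -normcM; exact: normIm_le.
have low : `|Im z| * (normc Y ^+ 2 * tau + normc (g b.+1) ^+ 2 * S) - normc Y ^+ 2 * eta
    <= `|Im (om * (Y * g b.+1)^*%C)|.
  rewrite key.
  have h := lerB_dist (Im z * (normc Y ^+ 2 * tau + normc (g b.+1) ^+ 2 * S)) (- (normc Y ^+ 2 * err)).
  rewrite opprK in h; apply: le_trans h.
  have h0 : 0 <= normc Y ^+ 2 * tau + normc (g b.+1) ^+ 2 * S.
    by apply: addr_ge0; apply: mulr_ge0 => //; exact: sqr_ge0.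
  rewrite normrM (ger0_norm h0) lerD2l lerN2 normrN normrM (ger0_norm (sqr_ge0 _)).
  by apply: ler_wpM2l => //; exact: sqr_ge0.
have Y0 := normc_ge0 Y.
have := le_trans low up; move: Y0; rewrite le_eqVlt => /predU1P[<-|Yp].
  by move=> _; rewrite !mulr0 add0r mulr_ge0 ?normc_ge0.
move=> h; rewrite -(ler_pM2l Yp).
have h1 : 0 <= `|Im z| * (normc (g b.+1) ^+ 2 * S).
  by apply: mulr_ge0 => //; apply: mulr_ge0 => //; exact: sqr_ge0.
move: h h1; move: (normc Y) (normc om) (normc (g b.+1)) (`|Im z|) => a c d x h h1.
rewrite mulrDr in h.
have -> : a * (x * tau * a) = x * (a ^+ 2 * tau) by ring.
have -> : a * (eta * a + c * d) = a ^+ 2 * eta + c * (a * d) by ring.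
by rewrite -lerBlDl; apply: le_trans h; rewrite lerB // lerDl.
Qed.

(** Crude, but it only ever multiplies the truncation error, which tends to 0 while the number of
    sites stays fixed. *)
Lemma csol_bound (R : rcfType) (v : nat -> R) (z y1 y0 : R[i]) (C : R) :
  1 <= C -> (forall m, normc (z - (v m)%:C%C) + 1 <= C) ->
  normc y1 <= 1 -> normc y0 <= 1 -> forall m, normc (csol v z y1 y0 m) <= C ^+ m.
Proof.
move=> C1 hC h1 h0.
suff H m : normc (csol v z y1 y0 m) <= C ^+ m /\ normc (csol v z y1 y0 m.+1) <= C ^+ m.+1.
  by move=> m; case: (H m).
elim: m => [|m [IH0 IH1]].
  by rewrite expr0 expr1 /csol /sol /=; split => //; exact: le_trans C1.
split => //; rewrite /csol solS2; apply: le_trans (le_normcD _ _) _.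
rewrite normcN normcM [C ^+ m.+2]exprS.
apply: le_trans (_ : (normc (z - (v m.+1)%:C%C) + 1) * C ^+ m.+1 <= _); last first.
  by apply: ler_wpM2r => //; apply: exprn_ge0; apply: le_trans C1.
rewrite mulrDl mul1r; apply: lerD.
  by apply: ler_wpM2l => //; exact: normc_ge0.
by apply: le_trans IH0 _; apply: ler_weXn2l.
Qed.

(** One diagonal entry of the transfer matrix is at least Th / 2. It is the value at b + 1 of a
    standard solution, with b = q or b = q - 1, whose initial flux vanishes; so [tail_bound]
    applies, and site n belongs to the tail. The constant [e1] accounts for the source at site 1. *)
Lemma tail_from_trace (R : rcfType) (v : nat -> R) (z : R[i]) (g e : nat -> R[i])
    (B q n : nat) (Gam C eb e1 eps Th : R) :
  (forall m, (B <= m)%N -> g m = 0) ->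
  (forall m, g m.+2 + g m + (v m.+1)%:C%C * g m.+1 - z * g m.+1 = e m.+1) ->
  (forall m, normc (g m) <= Gam) ->
  1 <= C -> (forall m, normc (z - (v m)%:C%C) + 1 <= C) ->
  normc (e 1%N) <= e1 -> (forall m, (1 < m)%N -> normc (e m) <= eb) ->
  0 < eps -> eps <= `|Im z| -> 0 < Th ->
  Th <= normc (sol_trace (fun m => (v m)%:C%C) z q) ->
  (1 < q)%N -> (q < n)%N ->
  normc (g n) ^+ 2 <=
    (B%:R * eb * Gam + (2 * Gam + e1 + q.+1%:R * C ^+ q * eb) * Gam * (2 / Th)) / eps.
Proof.
move=> gB eq gG C1 hC he1 heb eps0 epsz Th0 hTh q1 qn.
have G0 : 0 <= Gam by apply: le_trans (gG 0%N); exact: normc_ge0.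
have eb0 : 0 <= eb by apply: le_trans (heb 2%N _) => //; exact: normc_ge0.
have e10 : 0 <= e1 by apply: le_trans he1; exact: normc_ge0.
have C0 : 0 <= C by apply: le_trans C1.
set Om := 2 * Gam + e1 + q.+1%:R * C ^+ q * eb.
have Om0 : 0 <= Om.
  by rewrite /Om !addr_ge0 ?mulr_ge0 ?exprn_ge0.
have [Bn|nB] := leqP B n.
  rewrite gB // normc0 expr0n /= divr_ge0 ?(ltW eps0) // addr_ge0 ?mulr_ge0 ?invr_ge0 ?(ltW Th0) //.
suff main b y1 y0 : (0 < b)%N -> (b <= q)%N -> normc y1 <= 1 -> normc y0 <= 1 ->
    Im (y1 * y0^*%C) = 0 -> Th / 2 <= normc (csol v z y1 y0 b.+1) ->
    normc (g n) ^+ 2 <= (B%:R * eb * Gam + Om * Gam * (2 / Th)) / eps.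
  have tr2 : Th <= normc (csol v z 1 0 q.+1) + normc (csol v z 0 1 q).
    by apply: le_trans hTh _; exact: le_normcD.
  have [h|h] := lerP (Th / 2) (normc (csol v z 1 0 q.+1)).
    apply: (main q 1 0) => //; rewrite ?normc1 ?normc0 //; first exact: ltnW.
    by rewrite conjc0 mulr0.
  apply: (main q.-1 0 1); rewrite ?normc1 ?normc0 ?mul0r ?leq_pred //; first by case: (q) q1 => [|[]].
  rewrite prednK; last exact: ltnW.
  by move: tr2 h; clear; lra.
move=> b0 bq hy1 hy0 y10 hY; set Y := normc _ in hY.
have Y0 : 0 < Y by apply: lt_le_trans hY; rewrite divr_gt0.
have := tail_bound b gB eq y10; rewrite -/Y.
set tau := \sum_(_ <= _ < _) _ ^+ 2; set eta := \sum_(_ <= _ < _) _.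
set om := normc (_ - _ - _) => tb.
have taug : normc (g n) ^+ 2 <= tau.
  rewrite /tau (big_cat_nat (n := n) (leq_ltn_trans bq qn) (ltnW nB)) /=.
  by rewrite [X in _ <= _ + X]big_ltn // addrCA lerDl addr_ge0 //;
    apply: sumr_ge0 => i _; exact: sqr_ge0.
have etab : eta <= B%:R * eb * Gam.
  rewrite /eta big_nat; apply: le_trans (_ : \sum_(b.+1 <= i < B) eb * Gam <= _).
    rewrite [leRHS]big_nat; apply: ler_sum => i /andP[bi _].
    apply: ler_pM; rewrite ?normc_ge0 //; apply: heb.
    by apply: leq_trans bi; rewrite ltnS.
  rewrite sumr_const_nat -[_ *+ _]mulr_natl mulrA; apply: ler_wpM2r => //.
  by apply: ler_wpM2r => //; rewrite ler_nat leq_subr.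
have omb : om <= Om.
  have o1 : normc (y1 * g 0%N - y0 * g 1%N) <= 1 * Gam + 1 * Gam.
    apply: le_trans (le_normcD _ _) _; rewrite normcN !normcM.
    by apply: lerD; apply: ler_pM; rewrite ?normc_ge0.
  have o2 : normc (\sum_(1 <= m < b.+1) csol v z y1 y0 m * e m) <=
      e1 + q.+1%:R * (C ^+ q * eb).
    rewrite big_ltn //; apply: le_trans (le_normcD _ _) _; apply: lerD.
      by rewrite normcM -[leRHS]mul1r; apply: ler_pM; rewrite ?normc_ge0.
    apply: le_trans (normc_sum _ _ _) _.
    apply: le_trans (_ : \sum_(2 <= i < b.+1) C ^+ q * eb <= _).
      rewrite big_nat [leRHS]big_nat; apply: ler_sum => i /andP[i2 ib].
      rewrite normcM; apply: ler_pM; rewrite ?normc_ge0 ?heb //.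
      apply: le_trans (csol_bound C1 hC hy1 hy0 i) _; apply: ler_weXn2l => //.
      by apply: leq_trans bq.
    rewrite sumr_const_nat -[_ *+ _]mulr_natl; apply: ler_wpM2r.
      by rewrite mulr_ge0 // exprn_ge0.
    by rewrite ler_nat; apply: leq_trans (leq_subr _ _) _; rewrite ltnS.
  have o3 := le_normcD (y1 * g 0%N - y0 * g 1%N) (- \sum_(1 <= m < b.+1) csol v z y1 y0 m * e m).
  rewrite normcN in o3; rewrite /om /Om -mulrA.
  by move: o1 o2 o3; clear; lra.
have etaY : eta * Y <= B%:R * eb * Gam * Y by apply: ler_wpM2r => //; exact: ltW.
have omg : om * normc (g b.+1) <= Om * Gam by apply: ler_pM; rewrite ?normc_ge0.
have OG : Om * Gam <= Om * Gam * (2 / Th) * Y.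
  have Y2 : 1 <= 2 / Th * Y.
    by rewrite mulrAC ler_pdivlMr // mul1r; move: hY; clear; lra.
  rewrite -[X in _ <= X]mulrA -[leLHS]mulr1; apply: ler_wpM2l => //; exact: mulr_ge0.
have tau0 : 0 <= tau by apply: sumr_ge0 => i _; exact: sqr_ge0.
rewrite ler_pdivlMr //; apply: le_trans (_ : tau * eps <= _).
  by apply: ler_wpM2r => //; exact: ltW.
rewrite -(ler_pM2r Y0) mulrDl.
apply: le_trans (_ : `|Im z| * tau * Y <= _).
  rewrite [tau * eps]mulrC; apply: ler_wpM2r; first exact: ltW.
  exact: ler_wpM2r.
by move: tb etaY omg OG; clear; lra.
Qed.

(* Covers real parts outside the spectrum, where Im z may be arbitrarily small. *)
Lemma far_decay (R : rcfType) (v : nat -> R) (z : R[i]) (g e : nat -> R[i]) (Gam eb : R) :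
  (forall m, g m.+2 + g m + (v m.+1)%:C%C * g m.+1 - z * g m.+1 = e m.+1) ->
  (forall m, normc (g m) <= Gam) -> (forall m, 4 <= normc (z - (v m)%:C%C)) ->
  (forall m, (1 < m)%N -> normc (e m) <= eb) ->
  forall j m, (j < m)%N -> normc (g m) <= Gam / 2 ^+ j + eb.
Proof.
move=> eq gG far heb.
have eb0 : 0 <= eb by apply: le_trans (heb 2%N _) => //; exact: normc_ge0.
elim=> [|j IH] m; first by rewrite expr0 divr1 (le_trans (gG m)) // lerDl.
case: m => // -[//|m] jm.
have E : (z - (v m.+2)%:C%C) * g m.+2 = g m.+3 + g m.+1 - e m.+2.
  by rewrite -eq; ring.
have h1 : 4 * normc (g m.+2) <= normc (g m.+3) + normc (g m.+1) + normc (e m.+2).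
  apply: le_trans (_ : normc ((z - (v m.+2)%:C%C) * g m.+2) <= _).
    by rewrite normcM; apply: ler_wpM2r => //; exact: normc_ge0.
  rewrite E; apply: le_trans (le_normcD _ _) _; rewrite normcN lerD2r; exact: le_normcD.
have h2 := IH m.+3 ltac:(lia); have h3 := IH m.+1 ltac:(lia); have h4 := heb m.+2 isT.
have e2 : Gam / 2 ^+ j = 2 * (Gam / 2 ^+ j.+1).
  by rewrite exprS invfM; clear; lra.
rewrite e2 in h2 h3; move: h1 h2 h3 h4 eb0; clear; lra.
Qed.

(** * Chebyshev vectors *)

Definition Hop (K : nzRingType) (V f : int -> K) (n : int) : K :=
  f (n + 1) + f (n - 1) + V n * f n.

Definition delta1 (K : nzRingType) (n : int) : K := if n == 1 then 1 else 0.

(* cheb V A m = U_m(H / 2A) delta_1, with U_m the Chebyshev polynomials of the second kind. *)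
Fixpoint cheb2 (K : unitRingType) (V : int -> K) (A : K) (m : nat) : (int -> K) * (int -> K) :=
  if m is k.+1 then
    let: (f, h) := cheb2 V A k in (h, fun n => Hop V h n / A - f n)
  else (delta1 K, fun n => Hop V (delta1 K) n / A).

Definition cheb (K : unitRingType) (V : int -> K) (A : K) (m : nat) : int -> K := (cheb2 V A m).1.

Lemma chebS2 (K : unitRingType) (V : int -> K) (A : K) m n :
  cheb V A m.+2 n = Hop V (cheb V A m.+1) n / A - cheb V A m n.
Proof. by rewrite /cheb /=; case: cheb2. Qed.

Lemma cheb_supp (K : unitRingType) (V : int -> K) (A : K) m n :
  (m < absz (n - 1)%R)%N -> cheb V A m n = 0.
Proof.
suff H : ((m < absz (n - 1)%R)%N -> cheb V A m n = 0) /\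
   ((m.+1 < absz (n - 1)%R)%N -> cheb V A m.+1 n = 0) by case: H.
elim: m n => [|m IH] n.
  split=> h; rewrite /cheb /= /Hop /delta1.
    by case: eqP => // e; lia.
  do 3 (case: eqP => [e|_]; first by lia).
  by rewrite mulr0 !addr0 mul0r.
split; first by case: (IH n).
move=> h; rewrite chebS2 /Hop; have [_ h1] := IH (n + 1); have [_ h2] := IH (n - 1).
have [h3 h4] := IH n; rewrite h1 ?h2 ?h3 ?h4 ?mulr0 ?addr0 ?mul0r ?subr0 //; lia.
Qed.

(** Replaces sums over all integers: the vectors it is applied to in exact identities have finite
    support, and a window [-L, L] with some margin contains it. *)
Definition wsum (K : nmodType) (L : nat) (f : int -> K) : K :=
  \sum_(0 <= i < L.*2.+1) f (i%:Z - L%:Z).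

Lemma eq_wsum (K : nmodType) (L : nat) (f h : int -> K) : f =1 h -> wsum L f = wsum L h.
Proof. by move=> fh; apply: eq_bigr => i _; exact: fh. Qed.

Lemma wsumD (K : nmodType) (L : nat) (f h : int -> K) :
  wsum L (fun n => f n + h n) = wsum L f + wsum L h.
Proof. exact: big_split. Qed.

Lemma wsumZ (K : pzSemiRingType) (L : nat) (c : K) (f : int -> K) :
  wsum L (fun n => c * f n) = c * wsum L f.
Proof. by rewrite /wsum mulr_sumr. Qed.

Lemma wsumN (K : zmodType) (L : nat) (f : int -> K) :
  wsum L (fun n => - f n) = - wsum L f.
Proof. by rewrite /wsum sumrN. Qed.

Lemma wsum_ge0 (K : numDomainType) (L : nat) (f : int -> K) :
  (forall n, 0 <= f n) -> 0 <= wsum L f.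
Proof. by move=> f0; apply: sumr_ge0. Qed.

Lemma ler_wsum (K : numDomainType) (L : nat) (f h : int -> K) :
  (forall n, f n <= h n) -> wsum L f <= wsum L h.
Proof. by move=> f0; apply: ler_sum. Qed.

Lemma wsum_shift (K : zmodType) (L : nat) (f : int -> K) :
  f (- L%:Z) = 0 -> f (L%:Z + 1) = 0 -> wsum L (fun n => f (n + 1)) = wsum L f.
Proof.
move=> f0 f1; rewrite /wsum.
have -> : \sum_(0 <= i < L.*2.+1) f (i%:Z - L%:Z + 1) =
   \sum_(1 <= i < L.*2.+2) f (i%:Z - L%:Z).
  rewrite [RHS]big_add1 /=; apply: eq_bigr => i _; congr f.
  by rewrite -[i.+1]addn1 PoszD; ring.
rewrite [LHS]big_nat_recr //= [RHS]big_ltn // sub0r f0 add0r.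
have -> : L.*2.+1%:Z - L%:Z = L%:Z + 1 by lia.
by rewrite f1 addr0.
Qed.

Lemma wsum_term (K : numDomainType) (L : nat) (f : int -> K) n :
  (forall n, 0 <= f n) -> (absz n <= L)%N -> f n <= wsum L f.
Proof.
move=> f0 nL; rewrite /wsum (bigD1_seq (absz (n + L%:Z)%R)) ?iota_uniq //=; last first.
  by rewrite mem_index_iota; lia.
have -> : (absz (n + L%:Z)%R)%:Z - L%:Z = n by lia.
by rewrite lerDl; apply: sumr_ge0.
Qed.

(** Zero already at the edges -L and L, so that shifting by one site preserves [wsum L]. *)
Definition vanish (K : nmodType) (L : nat) (f : int -> K) :=
  forall n : int, (L <= absz n)%N -> f n = 0.

Lemma wsum_shiftl (K : zmodType) (L : nat) (f : int -> K) :
  vanish L f -> wsum L (fun n => f (n + 1)) = wsum L f.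
Proof. by move=> fL; apply: wsum_shift; apply: fL; lia. Qed.

Lemma wsum_shiftr (K : zmodType) (L : nat) (f : int -> K) :
  vanish L f -> wsum L (fun n => f (n - 1)) = wsum L f.
Proof.
move=> fL; rewrite -(@wsum_shift _ L (fun n => f (n - 1))); try by apply: fL; lia.
by apply: eq_wsum => n; rewrite addrK.
Qed.

Lemma Hop_sym (K : comNzRingType) (L : nat) (V f h : int -> K) :
  vanish L f -> vanish L h ->
  wsum L (fun n => Hop V f n * h n) = wsum L (fun n => f n * Hop V h n).
Proof.
move=> fL hL.
have E1 : wsum L (fun n => f (n + 1) * h n) = wsum L (fun n => f n * h (n - 1)).
  rewrite -(@wsum_shift _ L (fun n => f n * h (n - 1))).
  - by apply: eq_wsum => n; rewrite addrK.
  - by rewrite fL ?mul0r //; lia.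
  - by rewrite fL ?mul0r //; lia.
have E2 : wsum L (fun n => f n * h (n + 1)) = wsum L (fun n => f (n - 1) * h n).
  rewrite -(@wsum_shift _ L (fun n => f (n - 1) * h n)).
  - by apply: eq_wsum => n; rewrite addrK.
  - by rewrite hL ?mulr0 //; lia.
  - by rewrite hL ?mulr0 //; lia.
have -> : wsum L (fun n => Hop V f n * h n) =
   wsum L (fun n => f (n + 1) * h n) + wsum L (fun n => f (n - 1) * h n)
   + wsum L (fun n => V n * f n * h n).
  by rewrite -!wsumD; apply: eq_wsum => n; rewrite /Hop; ring.
rewrite E1 -E2 -!wsumD; apply: eq_wsum => n; rewrite /Hop; ring.
Qed.

Lemma Hop_form (K : realFieldType) (L : nat) (lam : K) (V f h : int -> K) :
  (forall n, 0 <= V n <= lam) -> vanish L f -> vanish L h ->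
  wsum L (fun n => Hop V f n * h n) <=
  (1 + lam / 2) * (wsum L (fun n => f n ^+ 2) + wsum L (fun n => h n ^+ 2)).
Proof.
move=> hV fL hL.
have f2L : vanish L (fun n => f n ^+ 2) by move=> n /fL ->; rewrite expr0n.
have am (a b : K) : a * b <= a ^+ 2 / 2 + b ^+ 2 / 2.
  by have := sqr_ge0 (a - b); rewrite sqrrB -mulr_natl; lra.
apply: le_trans (_ : wsum L (fun n => (1 / 2) * f (n + 1) ^+ 2 + (1 / 2) * f (n - 1) ^+ 2 +
   (lam / 2 * f n ^+ 2 + (1 + lam / 2) * h n ^+ 2)) <= _).
  apply: ler_wsum => n; rewrite /Hop.
  have h1 := am (f (n + 1)) (h n); have h2 := am (f (n - 1)) (h n); have h3 := am (f n) (h n).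
  have [v0 v1] := andP (hV n).
  have h4 : V n * (f n * h n) <= V n * (f n ^+ 2 / 2 + h n ^+ 2 / 2) by apply: ler_wpM2l.
  have h5 : V n * (f n ^+ 2 / 2 + h n ^+ 2 / 2) <= lam * (f n ^+ 2 / 2 + h n ^+ 2 / 2).
    by apply: ler_wpM2r => //; have := sqr_ge0 (f n); have := sqr_ge0 (h n); lra.
  move: h1 h2 h4 h5; move: (f (n + 1)) (f (n - 1)) (f n) (h n) (V n); clear.
  move=> a b c d v h1 h2 h4 h5; lra.
rewrite !wsumD !wsumZ (wsum_shiftl f2L) (wsum_shiftr f2L).
by set a := wsum _ _; set b := wsum _ _; clear; lra.
Qed.

(** Operator form of U_m^2 + U_(m+1)^2 - 2x U_m U_(m+1) = 1 at x = H / 2A. The recurrence and the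
    symmetry of H carry it from m to m + 1. *)
Lemma cheb_energy (K : realFieldType) (L : nat) (V : int -> K) (A : K) m :
  (m + 4 <= L)%N ->
  wsum L (fun n => cheb V A m n ^+ 2) + wsum L (fun n => cheb V A m.+1 n ^+ 2)
  - A^-1 * wsum L (fun n => Hop V (cheb V A m) n * cheb V A m.+1 n) = 1.
Proof.
have supp k : (k + 3 <= L)%N -> vanish L (cheb V A k).
  by move=> kL n nL; apply: cheb_supp; lia.
elim: m => [|m IH] mL.
  have E : wsum L (fun n => cheb V A 1 n ^+ 2) =
      A^-1 * wsum L (fun n => Hop V (cheb V A 0) n * cheb V A 1 n).
    by rewrite -wsumZ; apply: eq_wsum => n; rewrite /cheb /=; ring.
  rewrite E addrK /wsum (bigD1_seq L.+1) ?iota_uniq //=; last first.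
    by rewrite mem_index_iota; lia.
  have -> : L.+1%:Z - L%:Z = 1 by lia.
  rewrite /cheb /= /delta1 /= expr1n big1_seq ?addr0 // => i /andP[iL _].
  by case: eqP => [e|_]; [lia | rewrite expr0n].
rewrite -(IH ltac:(lia)).
have S := @Hop_sym K L V _ _ (supp m ltac:(lia)) (supp m.+1 ltac:(lia)).
have E2 : wsum L (fun n => cheb V A m.+2 n ^+ 2) =
   A^-1 * wsum L (fun n => Hop V (cheb V A m.+1) n * cheb V A m.+2 n)
   - wsum L (fun n => cheb V A m.+2 n * cheb V A m n).
  rewrite -wsumZ -wsumN -wsumD; apply: eq_wsum => n.
  by rewrite expr2 {1}chebS2; ring.
have E3 : wsum L (fun n => cheb V A m.+2 n * cheb V A m n) =
   A^-1 * wsum L (fun n => cheb V A m n * Hop V (cheb V A m.+1) n)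
   - wsum L (fun n => cheb V A m n ^+ 2).
  rewrite -wsumZ -wsumN -wsumD; apply: eq_wsum => n.
  by rewrite chebS2; ring.
by rewrite E2 E3 -S; ring.
Qed.

(** For this A the mixed term of [cheb_energy] is at most a quarter of the two squared norms, so
    each squared norm is at most 4/3, uniformly in m. *)
Lemma cheb_bound (K : realFieldType) (lam : K) (V : int -> K) (A : K) m n :
  0 <= lam -> (forall n, 0 <= V n <= lam) -> A = 2 * (lam + 4) -> `|cheb V A m n| <= 2.
Proof.
move=> lam0 hV EA; set L := (absz n + m + 5)%N.
have A0 : 0 < A by lra.
have En := @cheb_energy K L V A m ltac:(lia).
have supp k : (k + 3 <= L)%N -> vanish L (cheb V A k).
  by move=> kL l lL; apply: cheb_supp; lia.
have F := Hop_form hV (supp m ltac:(lia)) (supp m.+1 ltac:(lia)).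
have T := @wsum_term K L (fun n => cheb V A m n ^+ 2) n (fun n => sqr_ge0 _) ltac:(lia).
have P := @wsum_ge0 K L (fun n => cheb V A m.+1 n ^+ 2) (fun n => sqr_ge0 _).
have P' := @wsum_ge0 K L (fun n => cheb V A m n ^+ 2) (fun n => sqr_ge0 _).
have F' : A^-1 * wsum L (fun n => Hop V (cheb V A m) n * cheb V A m.+1 n) <=
   1 / 4 * (wsum L (fun n => cheb V A m n ^+ 2) + wsum L (fun n => cheb V A m.+1 n ^+ 2)).
  rewrite mulrC ler_pdivrMr //; apply: le_trans F _.
  rewrite mulrAC; apply: ler_wpM2r; last by lra.
  exact: addr_ge0.
rewrite -(@ler_pXn2r _ 2) ?nnegrE // (real_normK (num_real _)).
move: En T P P' F'; set a := wsum _ _; set b := wsum _ _; set c := _ * wsum _ _.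
by set d := cheb _ _ _ _ ^+ 2; clear; lra.
Qed.

Lemma ex_prim_root (R : rcfType) (P : nat) :
  (0 < P)%N -> exists w : R[i], P.-primitive_root w.
Proof.
move=> P0; have [rs Ers] := closed_field_poly_normal ('X^P - 1 : {poly R[i]}).
rewrite (monicP _) ?monicXnsubC // scale1r in Ers.
have unity : all P.-unity_root rs by apply/allP=> z; rewrite -root_prod_XsubC -Ers.
have sz : (P < (size rs).+1)%N by rewrite -(size_prod_XsubC rs id) -Ers size_XnsubC.
have [|w] := hasP (has_prim_root P0 unity _ sz); last by exists w.
by rewrite -separable_prod_XsubC -Ers separable_Xn_sub_1 // pnatr_eq0 -lt0n.
Qed.

(** * Averages over circles *)

Definition cgen (R : rcfType) (V : int -> R) (A : R) (M : nat) (w : R[i]) (n : int) : R[i] :=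
  \sum_(m < M.+1) (cheb V A m n)%:C%C * w ^+ m.

Lemma cgenS (R : rcfType) (V : int -> R) (A : R) (M : nat) (w : R[i]) (n : int) :
  cgen V A M.+1 w n = cgen V A M w n + (cheb V A M.+1 n)%:C%C * w ^+ M.+1.
Proof. exact: big_ord_recr. Qed.

(** The three-term recurrence telescopes and leaves two boundary terms of order |w|^M besides the
    source -A / w at site 1. *)
Lemma cgen_eq (R : rcfType) (V : int -> R) (A : R) (M : nat) (w : R[i]) (n : int) :
  A != 0 -> w != 0 ->
  Hop (fun n => (V n)%:C%C) (cgen V A M w) n - A%:C%C * (w + w^-1) * cgen V A M w n =
  A%:C%C * ((cheb V A M.+1 n)%:C%C * w ^+ M - (cheb V A M n)%:C%C * w ^+ M.+1
            - (delta1 R n)%:C%C / w).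
Proof.
move=> A0 w0; elim: M => [|M IH].
  rewrite /Hop /cgen !big_ord_recl !big_ord0 !addr0 expr0 !mulr1 expr1.
  have -> : (cheb V A 1 n)%:C%C = ((cheb V A 0 (n + 1))%:C%C + (cheb V A 0 (n - 1))%:C%C
     + (V n)%:C%C * (cheb V A 0 n)%:C%C) / A%:C%C.
    by rewrite {1}/cheb /= -!rmorphM -!rmorphD -rmorphV ?unitfE // -rmorphM.
  rewrite -[delta1 R n]/(cheb V A 0 n); field.
  by rewrite w0 fmorph_eq0.
have E : (Hop V (cheb V A M.+1) n)%:C%C =
    A%:C%C * ((cheb V A M.+2 n)%:C%C + (cheb V A M n)%:C%C).
  by rewrite -rmorphD -rmorphM chebS2 subrK mulrCA divff // mulr1.
have -> : Hop (fun n => (V n)%:C%C) (cgen V A M.+1 w) n =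
   Hop (fun n => (V n)%:C%C) (cgen V A M w) n + (Hop V (cheb V A M.+1) n)%:C%C * w ^+ M.+1.
  by rewrite /Hop !cgenS !rmorphD rmorphM; ring.
rewrite cgenS mulrDr opprD addrACA IH E !exprS; field.
exact: w0.
Qed.

(** A discrete Cauchy integral over |w| = r. It extracts the constant coefficient exactly from
    Laurent polynomials whose exponents are below P in modulus. *)
Definition circ_avg (R : rcfType) (P : nat) (zeta : R[i]) (r : R) (f : R[i] -> R[i]) : R[i] :=
  P%:R^-1 * \sum_(j < P) f (r%:C%C * zeta ^+ j).

Section CircAvg.
Variables (R : rcfType) (P : nat) (zeta : R[i]) (r : R).
Hypotheses (P0 : (0 < P)%N) (prim : P.-primitive_root zeta) (r0 : 0 < r).

Let avg := circ_avg P zeta r.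

Lemma prim_root_normc : normc zeta = 1.
Proof.
have := congr1 (@normc R) (prim_expr_order prim); rewrite normcX normc1 => /eqP.
by rewrite pexpr_eq1 ?normc_ge0 // => /eqP.
Qed.

Lemma node_normc j : normc (r%:C%C * zeta ^+ j) = r.
Proof.
by rewrite normcM normcX prim_root_normc expr1n mulr1 normc_real ger0_norm // ltW.
Qed.

Lemma node_neq0 j : r%:C%C * zeta ^+ j != 0.
Proof.
apply/eqP => h; have := node_normc j; rewrite h normc0 => h0.
by move: r0; rewrite -h0 ltxx.
Qed.

Lemma eq_avg f h : (forall w, w != 0 -> f w = h w) -> avg f = avg h.
Proof. by move=> fh; congr (_ * _); apply: eq_bigr => j _; apply: fh; exact: node_neq0. Qed.

Lemma avgD f h : avg (fun w => f w + h w) = avg f + avg h.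
Proof. by rewrite /avg /circ_avg big_split mulrDr. Qed.

Lemma avgZ c f : avg (fun w => c * f w) = c * avg f.
Proof. by rewrite /avg /circ_avg -mulr_sumr mulrCA. Qed.

Lemma avg_sum (I : Type) (s : seq I) (F : I -> R[i] -> R[i]) :
  avg (fun w => \sum_(i <- s) F i w) = \sum_(i <- s) avg (F i).
Proof. by rewrite /avg /circ_avg exchange_big mulr_sumr. Qed.

Lemma avg_expz (i : int) : (absz i < P)%N -> avg (fun w => w ^ i) = (i == 0)%:R.
Proof.
move=> iP; have z0 : zeta != 0.
  apply/eqP => h; have := prim_root_normc; rewrite h normc0 => /eqP.
  by rewrite eq_sym oner_eq0.
have rC0 : r%:C%C != 0 :> R[i] by rewrite fmorph_eq0 gt_eqF.
have -> : avg (fun w => w ^ i) = P%:R^-1 * (r%:C%C ^ i * \sum_(j < P) (zeta ^ i) ^+ j).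
  rewrite /avg /circ_avg; congr (_ * _); rewrite mulr_sumr; apply: eq_bigr => j _.
  by rewrite exprzMl ?unitfE // ?expf_neq0 // !exprnP !exprz_exp [X in zeta ^ X]mulrC.
have [->|i0] := eqVneq i 0.
  rewrite !expr0z mul1r (eq_bigr (fun=> 1)); last by move=> j _; rewrite expr1n.
  by rewrite sumr_const card_ord -[1 *+ P]mulr_natl mulr1 mulVf // pnatr_eq0 -lt0n.
have zi1 : zeta ^ i != 1.
  have ai : (0 < absz i)%N by lia.
  have h : zeta ^+ (absz i) != 1.
    by rewrite -(prim_order_dvd prim) gtnNdvd.
  case: i iP i0 ai h => k // kP _ k0 h.
  by rewrite NegzE -exprnN; apply: contraNneq h => h; rewrite -invr_eq1 h.
have : (zeta ^ i - 1) * \sum_(j < P) (zeta ^ i) ^+ j = 0.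
  rewrite -subrX1 exprnP exprz_exp mulrC -exprz_exp -exprnP.
  by rewrite (prim_expr_order prim) exp1rz subrr.
by move/eqP; rewrite mulf_eq0 subr_eq0 (negbTE zi1) /= => /eqP ->; rewrite !mulr0.
Qed.

Lemma avg_pwS k (i : int) :
  avg (fun w => w ^ i * (w + w^-1) ^+ k.+1) =
  avg (fun w => w ^ (i + 1) * (w + w^-1) ^+ k) + avg (fun w => w ^ (i - 1) * (w + w^-1) ^+ k).
Proof.
rewrite -avgD; apply: eq_avg => w w0.
by rewrite !expfzDr // expr1z exprN1 exprS; ring.
Qed.

Lemma avg_pw_eq0 k (i : int) : k%:Z < i -> i + k%:Z < P%:Z ->
  avg (fun w => w ^ i * (w + w^-1) ^+ k) = 0.
Proof.
elim: k i => [|k IH] i ki iP.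
  rewrite (eq_avg (h := fun w => w ^ i)) => [|w _]; last by rewrite expr0 mulr1.
  by rewrite avg_expz; [case: eqP => // i0; lia | lia].
by rewrite avg_pwS !IH ?addr0 //; lia.
Qed.

Lemma avg_pw_sym k (i : int) : (absz i + k < P)%N ->
  avg (fun w => w ^ i * (w + w^-1) ^+ k) = avg (fun w => w ^ (- i) * (w + w^-1) ^+ k).
Proof.
elim: k i => [|k IH] i iP.
  have E (l : int) : avg (fun w => w ^ l * (w + w^-1) ^+ 0) = avg (fun w => w ^ l).
    by apply: eq_avg => w _; rewrite expr0 mulr1.
  by rewrite !E !avg_expz ?oppr_eq0 ?abszN //; lia.
rewrite !avg_pwS (IH (i + 1)) ?(IH (i - 1)); try lia.
by rewrite addrC; congr (_ + _); apply: eq_avg => w _; congr (_ ^ _ * _); ring.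
Qed.

Lemma avg_bound f (X : R) : (forall w, normc w = r -> normc (f w) <= X) -> normc (avg f) <= X.
Proof.
move=> fX; rewrite /avg /circ_avg normcM normcV -(rmorph_nat (real_complex R)) normc_real normr_nat.
rewrite ler_pdivrMl ?ltr0n //; apply: le_trans (normc_sum _ _ _) _.
apply: le_trans (_ : \sum_(j < P) X <= _).
  by apply: ler_sum => j _; apply: fX; exact: node_normc.
by rewrite sumr_const card_ord mulr_natl.
Qed.

End CircAvg.

(** For k = 0 the constant coefficient of (1 - w^2) [cgen] is [cheb V A 0], that is [delta1]. Each
    further H becomes a factor A (w + 1/w) through [cgen_eq]: the boundary terms have exponents
    strictly between 0 and P, and the source gives 1/w - w, odd under w to 1/w, against the even (w
    + 1/w)^k. Both average to 0. *)
Lemma iter_Hop_avg (R : rcfType) (V : int -> R) (A r : R) (M P k : nat) (zeta : R[i]) n :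
  (0 < P)%N -> P.-primitive_root zeta -> 0 < r -> A != 0 ->
  (k <= M)%N -> (M + k + 5 <= P)%N ->
  (iter k (Hop V) (delta1 R) n)%:C%C =
  circ_avg P zeta r (fun w => (1 - w ^+ 2) * (A%:C%C * (w + w^-1)) ^+ k * cgen V A M w n).
Proof.
move=> P0 prim r0 A0; elim: k n => [|k IH] n kM MP.
  have Z (l : nat) : (0 < l < P)%N -> circ_avg P zeta r (fun w => w ^ l%:Z) = 0.
    by move=> lP; rewrite (avg_expz P0 prim r0) /=; [case: eqP => // l0; lia | lia].
  rewrite (eq_avg P0 prim r0 (h := fun w => \sum_(m < M.+1)
    (cheb V A m n)%:C%C * (w ^ m%:Z + (-1) * w ^ m.+2%:Z))).
    rewrite avg_sum big_ord_recl big1 => [|m _].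
      rewrite addr0 avgZ avgD avgZ (avg_expz P0 prim r0) /=; last by lia.
      by rewrite Z ?mulr0 ?addr0 ?mulr1 //; lia.
    have mM := ltn_ord m; rewrite lift0 avgZ avgD avgZ !Z; try lia.
    by rewrite mulr0 addr0 mulr0.
  move=> w w0; rewrite expr0 mulr1 /cgen mulr_sumr; apply: eq_bigr => m _.
  by rewrite -!exprnP !exprS; ring.
rewrite /= /Hop !rmorphD rmorphM /= !IH; try lia.
rewrite -avgZ -!avgD.
pose e w := A%:C%C * ((cheb V A M.+1 n)%:C%C * w ^+ M - (cheb V A M n)%:C%C * w ^+ M.+1
            - (delta1 R n)%:C%C / w).
apply/eqP; rewrite -subr_eq0; apply/eqP.
rewrite -[X in _ + X]mulN1r -avgZ -avgD.
rewrite (eq_avg P0 prim r0 (h := fun w => A%:C%C ^+ k.+1 * (cheb V A M.+1 n)%:C%C *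
     (w ^ M%:Z * (w + w^-1) ^+ k + (-1) * (w ^ (M + 2)%N%:Z * (w + w^-1) ^+ k))
   + (- A%:C%C ^+ k.+1 * (cheb V A M n)%:C%C *
     (w ^ (M + 1)%N%:Z * (w + w^-1) ^+ k + (-1) * (w ^ (M + 3)%N%:Z * (w + w^-1) ^+ k))
   + - A%:C%C ^+ k.+1 * (delta1 R n)%:C%C *
     (w ^ (-1) * (w + w^-1) ^+ k + (-1) * (w ^ 1 * (w + w^-1) ^+ k))))).
  have Z (l : nat) : (k < l)%N -> (l + k < P)%N ->
      circ_avg P zeta r (fun w => w ^ l%:Z * (w + w^-1) ^+ k) = 0.
    by move=> kl lP; apply: (avg_pw_eq0 P0 prim r0); lia.
  have S := @avg_pw_sym R P zeta r P0 prim r0 k 1 ltac:(lia).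
  rewrite !avgD !avgZ !avgD !avgZ S !Z; try lia.
  by ring.
move=> w w0; have := cgen_eq V M n A0 w0; rewrite /Hop => E.
set X := (1 - w ^+ 2) * (A%:C%C * (w + w^-1)) ^+ k.
transitivity (X * (A%:C%C * ((cheb V A M.+1 n)%:C%C * w ^+ M - (cheb V A M n)%:C%C * w ^+ M.+1
            - (delta1 R n)%:C%C / w))).
  by rewrite -E /X [_ ^+ k.+1]exprS; ring.
rewrite /X exprN1 !expr1z -!exprnP !exprD exprMn !exprS expr0; field.
exact: w0.
Qed.

(** * The vectors (1 + cH)^N delta_1, which approximate the propagator at c = -it/N *)

Definition evo (R : rcfType) (V : int -> R) (c : R[i]) (N : nat) (n : int) : R[i] :=
  \sum_(k < N.+1) (c ^+ k *+ 'C(N, k)) * (iter k (Hop V) (delta1 R) n)%:C%C.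

Lemma evo_avg (R : rcfType) (V : int -> R) (A r : R) (M P N : nat) (zeta c : R[i]) n :
  (0 < P)%N -> P.-primitive_root zeta -> 0 < r -> A != 0 ->
  (N <= M)%N -> (M + N + 5 <= P)%N ->
  evo V c N n = circ_avg P zeta r (fun w =>
     (1 - w ^+ 2) * (1 + c * (A%:C%C * (w + w^-1))) ^+ N * cgen V A M w n).
Proof.
move=> P0 prim r0 A0 NM MP.
rewrite (eq_avg P0 prim r0 (h := fun w => \sum_(k < N.+1) (c ^+ k *+ 'C(N, k)) *
   ((1 - w ^+ 2) * (A%:C%C * (w + w^-1)) ^+ k * cgen V A M w n))); last first.
  move=> w _; rewrite exprDn [(1 - _) * _]mulr_sumr [LHS]mulr_suml; apply: eq_bigr => k _.
  by rewrite expr1n mul1r exprMn mulrnAr !mulrnAl; congr (_ *+ _); ring.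
rewrite avg_sum; apply: eq_bigr => k _; rewrite avgZ; congr (_ * _).
have kN : (k <= N)%N by rewrite -ltnS.
apply: (iter_Hop_avg _ _ P0 prim r0 A0); lia.
Qed.

Lemma evo_le (R : rcfType) (V : int -> R) (A r X Y : R) (M N : nat) (c : R[i]) n :
  0 < r -> r <= 1 -> A != 0 -> (N <= M)%N ->
  (forall w, normc w = r -> normc (1 + c * (A%:C%C * (w + w^-1))) ^+ N <= X) ->
  (forall w, normc w = r -> normc (cgen V A M w n) <= Y) ->
  normc (evo V c N n) <= 2 * X * Y.
Proof.
move=> r0 r1 A0 NM hX hY; pose P := (M + N + 5)%N.
have P0 : (0 < P)%N by rewrite /P addnS.
have [zeta prim] := @ex_prim_root R P P0.
rewrite (evo_avg _ _ _ P0 prim r0 A0 NM (leqnn _)).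
apply: (avg_bound P0 prim r0) => w wr.
rewrite !normcM normcX; apply: ler_pM; rewrite ?mulr_ge0 ?exprn_ge0 ?normc_ge0 ?hY //.
apply: ler_pM; rewrite ?exprn_ge0 ?normc_ge0 ?hX //.
apply: le_trans (le_normcD _ _) _; rewrite normcN normc1 normcX wr.
have : r ^+ 2 <= 1 by rewrite exprn_ile1 // ltW.
by move=> ?; lra.
Qed.

Lemma evoS (R : rcfType) (V : int -> R) (c : R[i]) N n :
  evo V c N.+1 n = evo V c N n + c * Hop (fun n => (V n)%:C%C) (evo V c N) n.
Proof.
pose h k n := (iter k (Hop V) (delta1 R) n)%:C%C.
have E : c * Hop (fun n => (V n)%:C%C) (evo V c N) n =
    \sum_(k < N.+1) (c ^+ k.+1 *+ 'C(N, k)) * h k.+1 n.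
  rewrite /Hop /evo mulr_sumr -!big_split mulr_sumr; apply: eq_bigr => k _ /=.
  rewrite /h /= /Hop !rmorphD rmorphM exprS -mulrnAr.
  by move: (_ *+ _) => d; ring.
rewrite E /evo -/h big_ord_recl [in RHS]big_ord_recl.
have -> : \sum_(i < N.+1) (c ^+ lift ord0 i *+ 'C(N.+1, lift ord0 i)) * h (lift ord0 i) n =
  \sum_(i < N.+1) (c ^+ i.+1 *+ 'C(N, i.+1)) * h i.+1 n +
  \sum_(i < N.+1) (c ^+ i.+1 *+ 'C(N, i)) * h i.+1 n.
  rewrite -big_split; apply: eq_bigr => i _; rewrite lift0 binS mulrnDr.
  exact: mulrDl.
rewrite addrA; congr (_ + _).
rewrite !bin0; congr (_ + _).
rewrite big_ord_recr /= bin_small // mulr0n mul0r addr0.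
by apply: eq_bigr => i _.
Qed.

Lemma evo0 (R : rcfType) (V : int -> R) (c : R[i]) n : evo V c 0 n = (delta1 R n)%:C%C.
Proof. by rewrite /evo big_ord1 expr0 bin0 mulr1n mul1r. Qed.

Lemma evo_supp (R : rcfType) (V : int -> R) (c : R[i]) N n :
  (N < absz (n - 1)%R)%N -> evo V c N n = 0.
Proof.
elim: N n => [|N IH] n h.
  by rewrite evo0 /delta1; case: eqP => // e; lia.
by rewrite evoS /Hop !IH ?(mulr0, addr0) //; lia.
Qed.

Lemma Hop_norm (K : realFieldType) (L : nat) (lam : K) (V f : int -> K) :
  (forall n, 0 <= V n <= lam) -> vanish L f ->
  wsum L (fun n => Hop V f n ^+ 2) <= 3 * (2 + lam ^+ 2) * wsum L (fun n => f n ^+ 2).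
Proof.
move=> hV fL.
have f2L : vanish L (fun n => f n ^+ 2) by move=> n /fL ->; rewrite expr0n.
apply: le_trans (_ : wsum L (fun n => 3 * f (n + 1) ^+ 2 + 3 * f (n - 1) ^+ 2 +
   3 * lam ^+ 2 * f n ^+ 2) <= _).
  apply: ler_wsum => n; rewrite /Hop; have [v0 v1] := andP (hV n).
  have h1 : V n ^+ 2 * f n ^+ 2 <= lam ^+ 2 * f n ^+ 2.
    by apply: ler_wpM2r; [exact: sqr_ge0 | apply: lerXn2r; rewrite ?nnegrE // (le_trans v0)].
  move: h1; move: (f (n + 1)) (f (n - 1)) (f n) (V n); clear => a b c v h1.
  have h2 := sqr_ge0 (a - b); have h3 := sqr_ge0 (a - v * c); have h4 := sqr_ge0 (b - v * c).
  have -> : (a + b + v * c) ^+ 2 = 3 * a ^+ 2 + 3 * b ^+ 2 + 3 * (v ^+ 2 * c ^+ 2) -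
    ((a - b) ^+ 2 + (a - v * c) ^+ 2 + (b - v * c) ^+ 2) by ring.
  by move: h1 h2 h3 h4; set p := (_ - _) ^+ 2; set q := (_ - _) ^+ 2; set t := (_ - _) ^+ 2;
     clear; lra.
rewrite !wsumD !wsumZ (wsum_shiftl f2L) (wsum_shiftr f2L).
by set a := wsum _ _; clear; lra.
Qed.

(** By symmetry of H the cross term of |(1 - isH) f|^2 vanishes, so one step costs only a
    second-order factor; at s = t/N the product of N such factors stays bounded. *)
Lemma evo_norm (R : rcfType) (V : int -> R) (lam s : R) (L N : nat) :
  (forall n, 0 <= V n <= lam) -> (N + 3 <= L)%N ->
  wsum L (fun n => normc (evo V (- s)*i%C N n) ^+ 2) <= (1 + s ^+ 2 * (3 * (2 + lam ^+ 2))) ^+ N.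
Proof.
move=> hV; elim: N => [|N IH] NL.
  rewrite expr0 /wsum (bigD1_seq L.+1) ?iota_uniq //=; last first.
    by rewrite mem_index_iota; lia.
  have -> : L.+1%:Z - L%:Z = 1 by lia.
  rewrite big1_seq => [|i /andP[iL _]].
    by rewrite evo0 normc_real /delta1 eqxx normr1 expr1n addr0.
  rewrite evo_supp ?normc0 ?expr0n //; lia.
set K := 3 * (2 + lam ^+ 2).
pose p n := Re (evo V (- s)*i%C N n); pose q n := Im (evo V (- s)*i%C N n).
have sup : vanish L p /\ vanish L q.
  by split=> n nL; rewrite /p /q evo_supp //; lia.
have [pL qL] := sup.
have E n : normc (evo V (- s)*i%C N.+1 n) ^+ 2 =
   (p n ^+ 2 + q n ^+ 2) + s ^+ 2 * (Hop V p n ^+ 2 + Hop V q n ^+ 2)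
   + (2 * s) * (p n * Hop V q n + (-1) * (Hop V p n * q n)).
  rewrite evoS sqr_normcE /p /q /Hop.
  case: (evo _ _ _ n) => a b; case: (evo _ _ _ (n + 1)) => a1 b1.
  by case: (evo _ _ _ (n - 1)) => a2 b2 /=; ring.
rewrite (eq_wsum _ E) !wsumD !wsumZ !wsumD wsumZ (Hop_sym V pL qL) mulN1r subrr mulr0 addr0.
have h1 := Hop_norm hV pL; have h2 := Hop_norm hV qL.
have IH' := IH ltac:(lia).
have E' : wsum L (fun n => normc (evo V (- s)*i%C N n) ^+ 2) =
    wsum L (fun n => p n ^+ 2) + wsum L (fun n => q n ^+ 2).
  by rewrite -wsumD; apply: eq_wsum => n; rewrite sqr_normcE.
rewrite E' in IH'; rewrite [leRHS]exprS.
apply: le_trans (_ : (1 + s ^+ 2 * K) *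
   (wsum L (fun n => p n ^+ 2) + wsum L (fun n => q n ^+ 2)) <= _); last first.
  apply: ler_wpM2l => //; rewrite /K; have := sqr_ge0 s; have := sqr_ge0 lam.
  by move: (s ^+ 2) (lam ^+ 2); clear => a b ha hb; nra.
rewrite mulrDl mul1r lerD2l -mulrA; apply: ler_wpM2l; first exact: sqr_ge0.
by rewrite mulrDr; apply: lerD.
Qed.

(** * Decay at a single site, for energies on the ellipse *)

Lemma joukowski_cases (R : rcfType) (A r lam : R) (w : R[i]) :
  0 < r -> r < 1 -> 0 <= lam -> A = 2 * (lam + 4) -> normc w = r ->
  let z := A%:C%C * (w + w^-1) in
  [/\ lam + 4 <= `|Re z| \/ A * (r^-1 - r) / 2 <= `|Im z|,
      `|Im z| <= A * (r^-1 - r) & normc z <= A * (r + r^-1)].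
Proof.
move=> r0 r1 lam0 EA wr z.
have A0 : 0 < A by rewrite EA; lra.
have ri : 1 < r^-1 by rewrite invf_gt1.
have N : Re w ^+ 2 + Im w ^+ 2 = r ^+ 2 by rewrite -sqr_normcE wr.
have Ez : Re z = A * (1 + r^-1 ^+ 2) * Re w /\ Im z = A * (1 - r^-1 ^+ 2) * Im w.
  rewrite /z; move: N; case: (w) => a b /= ->.
  by rewrite exprVn; split; ring.
have [E1 E2] := Ez.
have ir2 : r^-1 ^+ 2 * r = r^-1 by rewrite expr2 -mulrA mulVf ?mulr1 // gt_eqF.
have imw : `|Im w| <= r by rewrite -wr; exact: normIm_le.
have c2 : 0 <= r^-1 ^+ 2 - 1 by rewrite subr_ge0; apply: exprn_ege1; exact: ltW.
have nIm : `|Im z| = A * (r^-1 ^+ 2 - 1) * `|Im w|.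
  by rewrite E2 normrM normrM (gtr0_norm A0) -[in `|1 - _|]opprB normrN (ger0_norm c2) //.
have nRe : `|Re z| = A * (1 + r^-1 ^+ 2) * `|Re w|.
  by rewrite E1 normrM normrM (gtr0_norm A0) ger0_norm // addr_ge0 // sqr_ge0.
have G2 : `|Im z| <= A * (r^-1 - r).
  rewrite nIm -mulrA; apply: ler_wpM2l; first exact: ltW.
  apply: le_trans (ler_wpM2l c2 imw) _.
  by rewrite mulrBl mul1r ir2.
have G3 : normc z <= A * (r + r^-1).
  rewrite /z normcM normc_real (gtr0_norm A0); apply: ler_wpM2l; first exact: ltW.
  by apply: le_trans (le_normcD _ _) _; rewrite normcV wr.
apply: And3 G2 G3.
have [h|h] := lerP (r / 2) `|Re w|.
  left; rewrite nRe; apply: le_trans (_ : A * (1 + r^-1 ^+ 2) * (r / 2) <= _).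
    have -> : A * (1 + r^-1 ^+ 2) * (r / 2) = A / 2 * (r + r^-1 ^+ 2 * r) by ring.
    rewrite ir2 EA; have -> : 2 * (lam + 4) / 2 = lam + 4 by field.
    rewrite ler_peMr //; first by lra.
    by rewrite (le_trans (ltW ri)) // lerDr ltW.
  by apply: ler_wpM2l => //; rewrite mulr_ge0 ?addr_ge0 ?sqr_ge0 // ltW.
right; rewrite nIm.
have h2 : r / 2 <= `|Im w|.
  rewrite -(@ler_pXn2r _ 2) ?nnegrE ?divr_ge0 ?(ltW r0) // (real_normK (num_real _)).
  have : `|Re w| ^+ 2 <= (r / 2) ^+ 2.
    by apply: lerXn2r; rewrite ?nnegrE ?divr_ge0 ?(ltW r0) // ltW.
  rewrite (real_normK (num_real _)) !exprMn exprVn => h2.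
  by have := sqr_ge0 r; lra.
rewrite -[leLHS]mulrA -[leRHS]mulrA; apply: ler_wpM2l; first exact: ltW.
have -> : (r^-1 - r) / 2 = (r^-1 ^+ 2 - 1) * (r / 2).
  by rewrite -[X in (X - r) / 2]ir2; ring.
exact: ler_wpM2l.
Qed.

Lemma cgen_bound (R : rcfType) (V : int -> R) (A lam : R) M (w : R[i]) n r :
  0 <= lam -> (forall n, 0 <= V n <= lam) -> A = 2 * (lam + 4) ->
  0 < r -> r < 1 -> normc w = r -> normc (cgen V A M w n) <= 2 / (1 - r).
Proof.
move=> lam0 hV EA r0 r1 wr; rewrite /cgen; apply: le_trans (normc_sum _ _ _) _.
apply: le_trans (_ : \sum_(i < M.+1) 2 * r ^+ i <= _).
  apply: ler_sum => i _; rewrite normcM normcX wr normc_real.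
  by apply: ler_wpM2r; [rewrite exprn_ge0 // ltW | exact: (cheb_bound _ _ lam0 hV EA)].
rewrite -mulr_sumr; apply: ler_wpM2l => //.
have d0 : 0 < 1 - r by rewrite subr_gt0.
rewrite -[leRHS]mul1r ler_pdivlMr // mulrC.
have -> : (1 - r) * (\sum_(i < M.+1) r ^+ i) = 1 - r ^+ M.+1.
  by rewrite -opprB mulNr -subrX1 opprB.
by rewrite lerBlDr lerDl exprn_ge0 // ltW.
Qed.

Ltac nonneg := repeat first
  [ assumption | apply: ltW; assumption | exact: ler0n | exact: normc_ge0
  | apply: addr_ge0 | apply: mulr_ge0 | rewrite invr_ge0 | apply: exprn_ge0 ].

Lemma one_sided_site (R : rcfType) (v : nat -> R) (lam s k xi : R) (z : R[i]) (g e : nat -> R[i])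
    (B n0 j n q : nat) (Gam C eb e1 eps Th : R) :
  q = fib (n0 + j).+1 -> Th = (s - 1) ^+ fib j.+1 ->
  8 <= lam -> 2 <= s -> s <= 9 / 4 -> 0 <= k -> k <= 1 / 4 -> s ^+ 2 = 4 + k ->
  2 <= xi -> xi <= (lam - 2 - k) - s * (1 + k) - (s * (1 + k) + 1) / xi ->
  v 1%N = lam -> v 2%N = 0 -> v 3%N = lam ->
  (forall n m, (2 < n)%N -> (0 < m <= fib n.-1)%N -> v (fib n + m)%N = v m) ->
  (forall m, 0 <= v m <= lam) ->
  (forall m, (B <= m)%N -> g m = 0) ->
  (forall m, g m.+2 + g m + (v m.+1)%:C%C * g m.+1 - z * g m.+1 = e m.+1) ->
  (forall m, normc (g m) <= Gam) ->
  1 <= C -> normc z + lam + 1 <= C ->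
  normc (e 1%N) <= e1 -> (forall m, (1 < m)%N -> normc (e m) <= eb) -> 0 <= e1 ->
  0 < eps -> lam + 4 <= `|Re z| \/ eps <= `|Im z| ->
  s ^+ 2 * xi < eps ^+ 2 * xi ^+ n0 -> (2 < (n0 + j).+1)%N -> (q < n)%N ->
  normc (g n) ^+ 2 <=
    (B%:R * eb * Gam + (2 * Gam + e1 + q.+1%:R * C ^+ q * eb) * Gam * (2 / Th)) / eps
    + (Gam / 2 ^+ n.-1 + eb) ^+ 2.
Proof.
move=> Eq ETh lam8 s2 s3 k0 k1 sk xi2 rate v1 v2 v3 per hv gB eq gG C1 hC he1 heb e10 eps0 cases big j2 qn.
have G0 : 0 <= Gam by apply: le_trans (gG 0%N); exact: normc_ge0.
have eb0 : 0 <= eb by apply: le_trans (heb 2%N _) => //; exact: normc_ge0.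
have Th0 : 0 < Th by rewrite ETh; apply: exprn_gt0; lra.
have q1 : (1 < q)%N by rewrite Eq; apply: (@leq_trans (fib 3)) => //; exact: fib_mono.
have nC m : normc (z - (v m)%:C%C) + 1 <= C.
  apply: le_trans hC; rewrite lerD2r; apply: le_trans (le_normcD _ _) _.
  have [v0 vl] := andP (hv m).
  by rewrite normcN normc_real ger0_norm // lerD2l.
case: cases => [far|near].
  have farv m : 4 <= normc (z - (v m)%:C%C).
    have [v0 vl] := andP (hv m).
    apply: le_trans (normRe_le _); rewrite (_ : Re _ = Re z - v m); last by case: (z) => a b.
    have := lerB_dist (Re z) (v m); rewrite (ger0_norm v0); move: far vl; clear; lra.
  have n1 : (0 < n)%N by exact: leq_ltn_trans qn.
  have nn : (n.-1 < n)%N by rewrite prednK.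
  have h := far_decay eq gG farv heb nn.
  apply: le_trans (_ : (Gam / 2 ^+ n.-1 + eb) ^+ 2 <= _).
    by apply: lerXn2r => //; rewrite nnegrE ?normc_ge0 // addr_ge0 // divr_ge0 // exprn_ge0.
  rewrite lerDr divr_ge0 ?(ltW eps0) // addr_ge0 ?mulr_ge0 ?invr_ge0 ?(ltW Th0) //.
  by rewrite !addr_ge0 ?mulr_ge0 ?exprn_ge0 // (le_trans _ C1).
apply: le_trans (_ : (B%:R * eb * Gam + (2 * Gam + e1 + q.+1%:R * C ^+ q * eb) * Gam * (2 / Th))
  / eps <= _); last by rewrite lerDl sqr_ge0.
apply: (tail_from_trace gB eq gG C1 nC he1 heb eps0 near Th0 _ q1 qn).
have [i Ei] : exists i, (n0 + j)%N = i.+1 by exists (n0 + j).-1; rewrite prednK //; move: j2; case: (n0 + j)%N.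
rewrite ETh Eq Ei (sol_trace_fib (lam := lam%:C%C)) ?v1 ?v2 ?v3 //; last first.
  by move=> a b a2 bb; rewrite per.
rewrite -Ei; apply: (trace_seq_growth j lam8 s2 s3 k0 k1 sk xi2 rate v1 v2 v3 per).
apply: (lt_le_trans big); apply: ler_wpM2r; first by apply: exprn_ge0; lra.
by rewrite -(real_normK (num_real (Im z))); apply: lerXn2r; rewrite ?nnegrE // ltW.
Qed.

(** The point is that K depends neither on M nor on w: the last term disappears as M grows with
    everything else fixed. *)
Lemma cgen_site (R : rcfType) (V : int -> R) (lam s k xi A r eps : R) (n0 j : nat) (n : int) (Gam : R) :
  Gam = 2 / (1 - r) ->
  8 <= lam -> 2 <= s -> s <= 9 / 4 -> 0 <= k -> k <= 1 / 4 -> s ^+ 2 = 4 + k ->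
  2 <= xi -> xi <= (lam - 2 - k) - s * (1 + k) - (s * (1 + k) + 1) / xi ->
  V 1 = lam -> V 2 = 0 -> V 3 = lam ->
  (forall n m, (2 < n)%N -> (0 < m <= fib n.-1)%N -> V (fib n + m)%N%:Z = V m%:Z) ->
  (forall m, (0 < m)%N -> V (- m.+1%:Z) = V m%:Z) ->
  (forall m, 0 <= V m <= lam) -> A = 2 * (lam + 4) -> 0 < r -> r < 1 ->
  0 < eps -> eps <= A * (r^-1 - r) / 2 ->
  s ^+ 2 * xi < eps ^+ 2 * xi ^+ n0 -> (2 < (n0 + j).+1)%N -> ((fib (n0 + j).+1).+1 < absz n)%N ->
  exists2 K, 0 <= K & forall M w, normc w = r ->
    normc (cgen V A M w n) ^+ 2 <=
    ((2 * Gam + (4 * A + A / r)) * Gam * 2 / eps + Gam ^+ 2) / (s - 1) ^+ fib j.+1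
    + M.+2%:R * r ^+ M * K.
Proof.
move=> EG lam8 s2 s3 k0 k1 sk xi2 rate v1 v2 v3 per refl hV EA r0 r1 eps0 epsr big j2.
set q := fib _ => nq; set Th := _ ^+ fib _.
have lam0 : 0 <= lam by lra.
have A0 : 0 < A by lra.
have G0 : 0 <= Gam by rewrite EG divr_ge0 // subr_ge0 ltW.
have Th0 : 0 < Th by apply: exprn_gt0; lra.
set e1 := 4 * A + A / r.
have e10 : 0 <= e1 by rewrite addr_ge0 ?mulr_ge0 ?invr_ge0 // ltW.
pose C := A * (r + r^-1) + lam + 1.
have C1 : 1 <= C by rewrite lerDr addr_ge0 // mulr_ge0 ?addr_ge0 ?invr_ge0 // ltW.
have C0 : 0 <= C by apply: le_trans C1.
pose K := 4 * A * (Gam / eps + (q.+1%:R * C ^+ q * Gam * (2 / Th)) / eps + (2 * Gam + 4 * A)).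
have K0 : 0 <= K.
  by rewrite /K; nonneg.
exists K => // M w wr.
have w0 : w != 0 by apply/eqP => h; move: wr r0; rewrite h normc0 => <-; rewrite ltxx.
have [cases imz nz] := joukowski_cases r0 r1 lam0 EA wr.
set z := A%:C%C * (w + w^-1) in cases imz nz.
pose eb := 4 * A * r ^+ M.
have rM0 : 0 <= r ^+ M by rewrite exprn_ge0 // ltW.
have rM1 : r ^+ M <= 1 by rewrite exprn_ile1 // ltW.
have eb0 : 0 <= eb by rewrite !mulr_ge0 // ltW.
pose e (l : int) := A%:C%C * ((cheb V A M.+1 l)%:C%C * w ^+ M - (cheb V A M l)%:C%C * w ^+ M.+1
            - (delta1 R l)%:C%C / w).
have eqn l := cgen_eq V M l (lt0r_neq0 A0) w0.
have cb m l := cheb_bound m l lam0 hV EA.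
have ebd (l : int) : normc (A%:C%C * ((cheb V A M.+1 l)%:C%C * w ^+ M - (cheb V A M l)%:C%C * w ^+ M.+1)) <= eb.
  rewrite normcM normc_real (gtr0_norm A0) /eb [4 * A]mulrC -mulrA; apply: ler_wpM2l; first exact: ltW.
  apply: le_trans (le_normcD _ _) _; rewrite normcN !normcM !normc_real !normcX wr.
  have h1 : `|cheb V A M.+1 l| * r ^+ M <= 2 * r ^+ M by apply: ler_wpM2r.
  have h2 : `|cheb V A M l| * r ^+ M.+1 <= 2 * r ^+ M.
    apply: ler_pM => //; first by rewrite exprn_ge0 // ltW.
    by rewrite exprS ler_piMl // ltW.
  by move: h1 h2; clear; lra.
have esmall (l : int) : l != 1 -> normc (e l) <= eb.
  by move=> l1; rewrite /e /delta1 (negbTE l1) mul0r subr0.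
have e1b (l : int) : normc (e l) <= e1.
  rewrite /e mulrBr; apply: le_trans (le_normcD _ _) _; apply: lerD.
    by apply: le_trans (ebd l) _; rewrite /eb ler_piMr // mulr_ge0 // ltW.
  rewrite normcN !normcM !normcV normc_real (gtr0_norm A0) wr normc_real.
  apply: ler_wpM2l; first exact: ltW.
  by rewrite ler_piMl ?invr_ge0 ?(ltW r0) // /delta1; case: eqP => _; rewrite ?normr1 ?normr0.
have gb l := cgen_bound M l lam0 hV EA r0 r1 wr; rewrite -EG in gb.
have cs : lam + 4 <= `|Re z| \/ eps <= `|Im z|.
  by case: cases => h; [left | right; apply: le_trans h].
have Cz : normc z + lam + 1 <= C by rewrite /C !lerD2r.
have concl (x : R) m : (q < m)%N ->
  x <= (M.+2%:R * eb * Gam + (2 * Gam + e1 + q.+1%:R * C ^+ q * eb) * Gam * (2 / Th)) / eps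
    + (Gam / 2 ^+ m.-1 + eb) ^+ 2 ->
  x <= ((2 * Gam + e1) * Gam * 2 / eps + Gam ^+ 2) / Th + M.+2%:R * r ^+ M * K.
  move=> qm hx; apply: le_trans hx _.
  set u := (2 ^+ m.-1)^-1.
  have t0 : 0 < 2 ^+ m.-1 :> R by exact: exprn_gt0.
  have u0 : 0 <= u by rewrite invr_ge0 ltW.
  have u1 : u <= 1 by rewrite invf_le1 // exprn_ege1 // ler1n.
  (* The decay 2^(1 - m) outside the spectrum is already below 1 / Th, because s - 1 <= 2 and fib
     j.+1 <= q < m. *)
  have uTh : u ^+ 2 <= Th^-1.
    apply: le_trans (_ : u <= _); first by rewrite expr2 ler_piMr.
    rewrite lef_pV2 ?posrE //; apply: le_trans (_ : 2 ^+ fib j.+1 <= _).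
      by apply: lerXn2r; rewrite ?nnegrE //; move: s2 s3; clear; lra.
    apply: ler_weXn2l; first by rewrite ler1n.
    have fq : (fib j.+1 <= q)%N by apply: fib_mono; rewrite ltnS leq_addl.
    by apply: leq_trans fq _; move: qm; clear; case: m.
  have sq : (Gam * u + eb) ^+ 2 <= Gam ^+ 2 * Th^-1 + eb * (2 * Gam + 4 * A).
    have -> : (Gam * u + eb) ^+ 2 = Gam ^+ 2 * u ^+ 2 + eb * (2 * (Gam * u) + eb) by ring.
    apply: lerD; first by apply: ler_wpM2l => //; exact: exprn_ge0.
    apply: ler_wpM2l => //; apply: lerD; first by rewrite ler_wpM2l // ler_piMr.
    by rewrite /eb ler_piMr // mulr_ge0 // ltW.
  have B1 : 1 <= M.+2%:R :> R by rewrite ler1n.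
  have BI (x0 : R) : 0 <= x0 -> eb * x0 <= M.+2%:R * (eb * x0).
    by move=> h; rewrite ler_peMl // mulr_ge0.
  have E1 : M.+2%:R * r ^+ M * K = M.+2%:R * eb * Gam / eps +
     M.+2%:R * (eb * (q.+1%:R * C ^+ q * Gam * (2 / Th) / eps)) + M.+2%:R * (eb * (2 * Gam + 4 * A)).
    by rewrite /K /eb; ring.
  have F1 := BI (q.+1%:R * C ^+ q * Gam * (2 / Th) / eps) ltac:(nonneg).
  have F2 := BI (2 * Gam + 4 * A) ltac:(nonneg).
  rewrite E1.
  have -> : (M.+2%:R * eb * Gam + (2 * Gam + e1 + q.+1%:R * C ^+ q * eb) * Gam * (2 / Th)) / eps =
     M.+2%:R * eb * Gam / eps + (2 * Gam + e1) * Gam * 2 / eps / Th +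
     eb * (q.+1%:R * C ^+ q * Gam * (2 / Th) / eps) by ring.
  rewrite [(_ + Gam ^+ 2) / Th]mulrDl.
  by move: sq F1 F2; rewrite -/u; clear; lra.
have [npos|nneg] := lerP 0 n.
  have [m Em] : exists m : nat, n = m%:Z by exists (absz n); move: npos; clear; lia.
  rewrite Em; apply: (concl _ m); first by move: nq; rewrite Em; clear; lia.
  apply: (one_sided_site (v := fun m => V m%:Z) (g := fun m => cgen V A M w m%:Z)
     (e := fun m => e m%:Z) (z := z) (n0 := n0) (j := j) (erefl q) (erefl Th) lam8 s2 s3 k0 k1 sk xi2 rate v1 v2 v3) => //.
  - move=> l Ml; rewrite /cgen big1 // => i _; rewrite cheb_supp ?mul0r //.
    by have := ltn_ord i; move: Ml; clear; lia.
  - move=> l; rewrite /e -eqn /Hop -/z.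
    have -> : l.+1%:Z + 1 = l.+2%:Z by clear; lia.
    by have -> : l.+1%:Z - 1 = l%:Z by clear; lia.
  - by move=> l l1; apply: esmall; move: l1; clear; lia.
  - by move: nq; rewrite Em; clear; lia.
(* On the left, sites are counted as -1 - m. By reflection the potential there is [V m] for m >= 1,
   so the right half-line argument applies; the source at site 1 lies outside. *)
have [m Em] : exists m : nat, n = - 1 - m%:Z by exists (absz n).-1; move: nneg; clear; lia.
rewrite Em; apply: (concl _ m); first by move: nq; rewrite Em; clear; lia.
apply: (one_sided_site (v := fun m => if m is 0 then lam else V m%:Z) (g := fun m => cgen V A M w (- 1 - m%:Z))
     (e := fun m => e (- 1 - m%:Z)) (z := z) (n0 := n0) (j := j) (erefl q) (erefl Th) lam8 s2 s3 k0 k1 sk xi2 rate v1 v2 v3) => //.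
- move=> a [//|b] a2 bb; rewrite -[RHS](per a b.+1 a2 bb).
  by rewrite addnS.
- by case=> [|l] //; rewrite lam0 lexx.
- move=> l Ml; rewrite /cgen big1 // => i _; rewrite cheb_supp ?mul0r //.
  by have := ltn_ord i; move: Ml; clear; lia.
- move=> l; rewrite /e -eqn /Hop -/z -refl //.
  have -> : - 1 - l.+1%:Z + 1 = - 1 - l%:Z by clear; lia.
  have -> : - 1 - l.+1%:Z - 1 = - 1 - l.+2%:Z by clear; lia.
  have -> : - 1 - l.+1%:Z = - l.+2%:Z by clear; lia.
  by ring.
- by move=> l l1; apply: esmall; move: l1; clear; lia.
- by move: nq; rewrite Em; clear; lia.
Qed.

(** With the even exponent M = 2m, Bernoulli for r^(-m) gives r^(2m) <= (m d)^(-2), which outweighs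
    the linear prefactor. *)
Lemma small_pow (R : realType) (r eta K : R) (N : nat) :
  0 < r -> r < 1 -> 0 < eta -> 0 <= K ->
  exists2 M, (N <= M)%N & M.+2%:R * r ^+ M * K <= eta.
Proof.
move=> r0 r1 eta0 K0; pose d := r^-1 - 1.
have d0 : 0 < d by rewrite subr_gt0 invf_gt1.
have bern m : 1 + m%:R * d <= (1 + d) ^+ m.
  elim: m => [|m IH]; first by rewrite mul0r addr0 expr0.
  rewrite exprS -natr1; apply: le_trans (_ : (1 + d) * (1 + m%:R * d) <= _); last first.
    by apply: ler_wpM2l => //; lra.
  have : 0 <= m%:R * d ^+ 2 by apply: mulr_ge0 => //; exact: sqr_ge0.
  have -> : (1 + d) * (1 + m%:R * d) = 1 + (m%:R + 1) * d + m%:R * d ^+ 2 by ring.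
  by rewrite lerDl.
have rd : r = (1 + d)^-1 by rewrite /d addrC subrK invrK.
pose m := (Num.bound (4 * K / (d ^+ 2 * eta)) + N).+1.
have m0 : 0 < m%:R :> R by rewrite ltr0n.
exists (m + m)%N; first by rewrite /m; lia.
have md : 0 < m%:R * d by exact: mulr_gt0.
have pw : r ^+ (m + m) <= (m%:R * d) ^- 2.
  rewrite exprD -expr2 rd exprVn exprVn lef_pV2 ?posrE ?exprn_gt0 //; last by lra.
  by apply: lerXn2r; rewrite ?nnegrE ?exprn_ge0 ?(ltW md) //; [lra | have := bern m; lra].
have mm : (m + m).+2%:R <= 4 * m%:R :> R.
  by rewrite -natrM ler_nat /m; lia.
apply: le_trans (_ : 4 * m%:R * (m%:R * d) ^- 2 * K <= _).
  apply: ler_wpM2r => //; apply: ler_pM => //; by rewrite exprn_ge0 // ltW.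
have -> : 4 * m%:R * (m%:R * d) ^- 2 * K = 4 * K / d ^+ 2 / m%:R.
  by field; rewrite !gt_eqF.
rewrite ler_pdivrMr //.
have bm : 4 * K / (d ^+ 2 * eta) <= m%:R.
  apply: le_trans (ltW (archi_boundP _)) _.
    by rewrite divr_ge0 ?mulr_ge0 ?sqr_ge0 // ltW.
  by rewrite ler_nat /m; lia.
move: bm; rewrite ler_pdivrMr ?mulr_gt0 ?exprn_gt0 // => bm.
rewrite ler_pdivrMr ?exprn_gt0 //; apply: le_trans bm _.
by rewrite [leLHS](_ : _ = eta * m%:R * d ^+ 2) //; ring.
Qed.

(** The left side does not involve M, so M may be chosen by [small_pow] to push the truncation term
    of [cgen_site] below any eta. *)
Lemma evo_site (R : realType) (V : int -> R) (lam s k xi A r eps X : R) (n0 j N : nat) (n : int)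
    (Gam : R) (c : R[i]) :
  Gam = 2 / (1 - r) ->
  8 <= lam -> 2 <= s -> s <= 9 / 4 -> 0 <= k -> k <= 1 / 4 -> s ^+ 2 = 4 + k ->
  2 <= xi -> xi <= (lam - 2 - k) - s * (1 + k) - (s * (1 + k) + 1) / xi ->
  V 1 = lam -> V 2 = 0 -> V 3 = lam ->
  (forall n m, (2 < n)%N -> (0 < m <= fib n.-1)%N -> V (fib n + m)%N%:Z = V m%:Z) ->
  (forall m, (0 < m)%N -> V (- m.+1%:Z) = V m%:Z) ->
  (forall m, 0 <= V m <= lam) -> A = 2 * (lam + 4) -> 0 < r -> r < 1 ->
  0 < eps -> eps <= A * (r^-1 - r) / 2 ->
  s ^+ 2 * xi < eps ^+ 2 * xi ^+ n0 -> (2 < (n0 + j).+1)%N -> ((fib (n0 + j).+1).+1 < absz n)%N ->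
  0 <= X ->
  (forall w, normc w = r -> normc (1 + c * (A%:C%C * (w + w^-1))) ^+ N <= X) ->
  normc (evo V c N n) ^+ 2 <=
    4 * X ^+ 2 *
    (((2 * Gam + (4 * A + A / r)) * Gam * 2 / eps + Gam ^+ 2) / (s - 1) ^+ fib j.+1).
Proof.
move=> EG lam8 s2 s3 k0 k1 sk xi2 rate v1 v2 v3 per refl hV EA r0 r1 eps0 epsr big j2 nq X0 hX.
have [K K0 hK] := cgen_site EG lam8 s2 s3 k0 k1 sk xi2 rate v1 v2 v3 per refl hV EA r0 r1
   eps0 epsr big j2 nq.
set L := _ / _ in hK *.
apply/ler_addgt0Pr => eta eta0.
have F0 : 0 < 4 * X ^+ 2 + 1 by rewrite ltr_wpDl // mulr_ge0 // exprn_ge0.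
have [M NM hM] := small_pow N r0 r1 (divr_gt0 eta0 F0) K0.
set et := eta / _ in hM.
have L0 : 0 <= L + et.
  have : normc (r%:C%C : R[i]) = r by rewrite normc_real gtr0_norm.
  move/(hK M) => h; apply: le_trans (sqr_ge0 _) (le_trans h _).
  by rewrite lerD2l.
have hY w : normc w = r -> normc (cgen V A M w n) <= Num.sqrt (L + et).
  move=> wr; rewrite -(@ler_pXn2r _ 2) ?nnegrE ?normc_ge0 ?sqrtr_ge0 // sqr_sqrtr //.
  by apply: le_trans (hK M w wr) _; rewrite lerD2l.
have A0 : A != 0 by rewrite EA gt_eqF //; lra.
have := evo_le r0 (ltW r1) A0 NM hX hY.
move=> h; apply: le_trans (_ : (2 * X * Num.sqrt (L + et)) ^+ 2 <= _).
  by apply: lerXn2r h; rewrite nnegrE ?normc_ge0 // !mulr_ge0 // sqrtr_ge0.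
rewrite !exprMn sqr_sqrtr // mulrDr -natrX; apply: lerD; first by [].
rewrite /et mulrA ler_pdivrMr // mulrC; apply: ler_wpM2l; first exact: ltW.
by rewrite lerDl.
Qed.

(** * The propagator as a limit *)

Lemma sum_exp_coeff_le (R : realType) (x : R) (N : nat) :
  0 <= x -> \sum_(k < N) x ^+ k / k`!%:R <= expR x.
Proof.
move=> x0; have -> : \sum_(k < N) x ^+ k / k`!%:R = series (exp_coeff x) N.
  by rewrite /series /= big_mkord.
apply: nondecreasing_cvgn_le; last exact: is_cvg_series_exp_coeff.
by apply: nondecreasing_series => n _ _; exact: exp_coeff_ge0.
Qed.

(** The quotient is the product of the factors 1 - i/N for i < k, whose losses add up to at most k^2
    / N. *)
Lemma binomial_exp_coeff (R : realFieldType) (N k : nat) :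
  (0 < N)%N -> (k <= N)%N ->
  let f := 'C(N, k)%:R / N%:R ^+ k * k`!%:R : R in
  f <= 1 /\ 1 - k%:R ^+ 2 / N%:R <= f.
Proof.
move=> N0 kN f.
have Nr : 0 < N%:R :> R by rewrite ltr0n.
have -> : f = (N ^_ k)%:R / N%:R ^+ k by rewrite /f -bin_ffact natrM mulrAC.
elim: k kN {f} => [|k IH] kN.
  by rewrite ffactn0 expr0 divr1 expr0n mul0r subr0.
have [h1 h2] := IH (ltnW kN).
have E : (N ^_ k.+1)%:R / N%:R ^+ k.+1 = (N ^_ k)%:R / N%:R ^+ k * (1 - k%:R / N%:R) :> R.
  rewrite ffactnSr natrM natrB ?(ltnW kN) // exprSr; field.
  by rewrite gt_eqF //=; rewrite expf_neq0 // gt_eqF.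
rewrite E; move: h1 h2; set g := _ / _ => h1 h2.
have kN1 : 0 <= (k%:R / N%:R : R) <= 1.
  by rewrite divr_ge0 //= ler_pdivrMr // mul1r ler_nat ltnW.
have g0 : 0 <= g by rewrite divr_ge0 // exprn_ge0.
have [a0 a1] := andP kN1.
split; first by apply: le_trans (_ : g * 1 <= _) => //; [apply: ler_wpM2l => //; lra | lra].
have -> : k.+1%:R ^+ 2 / N%:R = k%:R ^+ 2 / N%:R + k%:R / N%:R + k%:R / N%:R + N%:R^-1 :> R.
  by rewrite -natr1; field; rewrite gt_eqF.
have h3 : g * (k%:R / N%:R) <= 1 * (k%:R / N%:R) by apply: ler_wpM2r.
have h4 : 0 <= N%:R^-1 :> R by rewrite invr_ge0.
by move: h2 h3 h4 a0; clear; lra.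
Qed.

Lemma sqr_le_expn4 k : (k ^ 2 <= 4 ^ k)%N.
Proof.
have h : (k <= 2 ^ k)%N by rewrite ltnW // ltn_expl.
by rewrite (_ : 4 = 2 ^ 2)%N // -expnM mulnC expnM leq_exp2r.
Qed.

(** Termwise the difference is at most k^2 K^k / (k! N). Bounding k^2 by 4^k turns the sum into an
    exponential series, hence an error of at most e^{4K} / N. *)
Lemma cvg_binomial_series (R : realType) (b : nat -> R) (K : R) :
  0 <= K -> (forall k, `|b k| <= K ^+ k) ->
  (fun N => \sum_(k < N.+1) 'C(N, k)%:R / N%:R ^+ k * b k) @ \oo -->
  limn (series (fun k => b k / k`!%:R)).
Proof.
move=> K0 bK.
have cvb : cvgn (series (fun k => b k / k`!%:R)).
  apply: normed_cvg; apply: (@series_le_cvg _ _ (exp_coeff K)) => [n|n|n|].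
  - exact: normr_ge0.
  - exact: exp_coeff_ge0.
  - rewrite /exp_coeff /= normrM normfV (ger0_norm (ler0n _ _)).
    by apply: ler_wpM2r; rewrite ?invr_ge0.
  - exact: is_cvg_series_exp_coeff.
have cv1 : (fun N => series (fun k => b k / k`!%:R) N.+1) @ \oo -->
    limn (series (fun k => b k / k`!%:R)).
  by rewrite (cvg_shiftS (series (fun k => b k / k`!%:R))).
rewrite -[X in _ --> X]addr0.
have -> : (fun N => \sum_(k < N.+1) 'C(N, k)%:R / N%:R ^+ k * b k) =
    (fun N => series (fun k => b k / k`!%:R) N.+1 +
    (\sum_(k < N.+1) 'C(N, k)%:R / N%:R ^+ k * b k - series (fun k => b k / k`!%:R) N.+1)).
  by apply/funext => N; rewrite addrC subrK.
apply: cvgD => //.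
apply/cvgr0Pnorm_le => eps eps0.
near=> N.
have N0 : (0 < N)%N by near: N; exact: nbhs_infty_gt.
have Nr : 0 < N%:R :> R by rewrite ltr0n.
apply: le_trans (_ : expR (4 * K) / N%:R <= _); last first.
  rewrite ler_pdivrMr // -ler_pdivrMl //; near: N; exact: nbhs_infty_ger.
rewrite /series /= big_mkord -sumrB; apply: le_trans (ler_norm_sum _ _ _) _.
apply: le_trans (_ : \sum_(k < N.+1) (4 * K) ^+ k / k`!%:R / N%:R <= _); last first.
  rewrite -mulr_suml; apply: ler_wpM2r; first by rewrite invr_ge0.
  by apply: sum_exp_coeff_le; rewrite mulr_ge0.
apply: ler_sum => k _.
have kN : (k <= N)%N by rewrite -ltnS.
have [f1 f2] := @binomial_exp_coeff R N k N0 kN.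
have fk : 0 < k`!%:R :> R by rewrite ltr0n fact_gt0.
set f := 'C(N, k)%:R / _ in f1 f2 *.
have -> : f * b k - b k / k`!%:R = (f * k`!%:R - 1) * b k / k`!%:R by field; rewrite gt_eqF.
rewrite normrM normfV normrM (ger0_norm (ltW fk)) [leRHS]mulrAC; apply: ler_wpM2r.
  by rewrite invr_ge0 ltW.
have h1 : `|f * k`!%:R - 1| <= 4 ^+ k / N%:R.
  rewrite ler0_norm; last by lra.
  have h2 : k%:R ^+ 2 / N%:R <= 4 ^+ k / N%:R :> R.
    apply: ler_wpM2r; first by rewrite invr_ge0.
    by rewrite -!natrX ler_nat sqr_le_expn4.
  by move: f2 h2; clear; lra.
rewrite exprMn [leRHS]mulrAC; exact: ler_pM.
Unshelve. all: by end_near.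
Qed.

(** [coef_re] and [coef_im] give the real and imaginary parts of (-i)^k. *)
Definition coef_re (R : nzRingType) (k : nat) : R := if odd k then 0 else (-1) ^+ k./2.
Definition coef_im (R : nzRingType) (k : nat) : R := if odd k then (-1) ^+ k.+1./2 else 0.

Lemma pow_minus_i (R : rcfType) (s : R) k :
  (- s)*i%C ^+ k = Complex (s ^+ k * coef_re R k) (s ^+ k * coef_im R k).
Proof.
have step j : coef_re R j.+1 = coef_im R j /\ coef_im R j.+1 = - coef_re R j.
  rewrite /coef_re /coef_im /= uphalfE; case: (odd j) => /=; split; rewrite ?oppr0 //.
  by rewrite exprS mulN1r.
elim: k => [|k IH]; first by rewrite !expr0 /coef_re /coef_im /= mul1r mulr0.
have [-> ->] := step k.
rewrite [LHS]exprS IH; apply/eqP; rewrite eq_complex /= !exprS; apply/andP; split; apply/eqP; ring.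
Qed.

Lemma hpowE (R : realType) (lam : R) k n :
  iter k (Hop (fibV lam)) (delta1 R) n = hpow lam k n.
Proof. by elim: k n => [//|k IH] n; rewrite /= /Hop !IH. Qed.

Lemma fibV_bounds (R : realType) (lam : R) n : 0 <= lam -> 0 <= fibV lam n <= lam.
Proof. by move=> l0; rewrite /fibV; case: ifP; rewrite ?lexx ?l0. Qed.

Lemma hpow_bound (R : realType) (lam : R) k n : 0 <= lam -> `|hpow lam k n| <= (lam + 2) ^+ k.
Proof.
move=> l0; elim: k n => [|k IH] n /=; first by case: eqP => _; rewrite ?normr1 ?normr0.
have [v0 v1] := andP (fibV_bounds n l0).
apply: le_trans (ler_normD _ _) _; rewrite normrM (ger0_norm v0).
have h1 := ler_normD (hpow lam k (n + 1)) (hpow lam k (n - 1)).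
have h2 : fibV lam n * `|hpow lam k n| <= lam * (lam + 2) ^+ k by apply: ler_pM.
have := IH (n + 1); have := IH (n - 1); rewrite exprS.
by move: h1 h2; clear; lra.
Qed.

Lemma evo_coords (R : realType) (lam t : R) (N : nat) n :
  evo (fibV lam) (- (t / N%:R))*i%C N n =
  Complex (\sum_(k < N.+1) 'C(N, k)%:R / N%:R ^+ k * (coef_re R k * t ^+ k * hpow lam k n))
          (\sum_(k < N.+1) 'C(N, k)%:R / N%:R ^+ k * (coef_im R k * t ^+ k * hpow lam k n)).
Proof.
rewrite /evo.
have Esum (m : nat) (F G : 'I_m -> R) :
   \sum_(k < m) Complex (F k) (G k) = Complex (\sum_(k < m) F k) (\sum_(k < m) G k).
  by elim: m F G => [|m IH] F G; rewrite ?big_ord0 // !big_ord_recl IH.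
rewrite -Esum; apply: eq_bigr => k _; rewrite hpowE pow_minus_i -mulr_natl.
rewrite -(rmorph_nat (real_complex R)) exprMn exprVn.
by apply/eqP; rewrite eq_complex /=; apply/andP; split; apply/eqP; ring.
Qed.

Lemma evo_amp2_cvg (R : realType) (lam t : R) n : 0 <= lam ->
  (fun N => normc (evo (fibV lam) (- (t / N%:R))*i%C N n) ^+ 2) @ \oo --> amp2 lam t n.
Proof.
move=> l0.
have bnd (cf : nat -> R) k : `|cf k| <= 1 ->
   `|cf k * t ^+ k * hpow lam k n| <= (`|t| * (lam + 2)) ^+ k.
  move=> c1; rewrite !normrM normrX exprMn; apply: ler_pM => //.
    by rewrite -[leRHS]mul1r; apply: ler_wpM2r => //; rewrite exprn_ge0.
  exact: hpow_bound.
have cre k : `|coef_re R k| <= 1 by rewrite /coef_re; case: odd; rewrite ?normr0 // normrX normrN1 expr1n.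
have cim k : `|coef_im R k| <= 1 by rewrite /coef_im; case: odd; rewrite ?normr0 // normrX normrN1 expr1n.
have K0 : 0 <= `|t| * (lam + 2) by apply: mulr_ge0 => //; lra.
have C1 := cvg_binomial_series K0 (fun k => bnd (coef_re R) k (cre k)).
have C2 := cvg_binomial_series K0 (fun k => bnd (coef_im R) k (cim k)).
have E1 : amp_re lam t n = limn (series (fun k => coef_re R k * t ^+ k * hpow lam k n / k`!%:R)).
  rewrite /amp_re (_ : (fun k => _) = fun k => coef_re R k * t ^+ k * hpow lam k n / k`!%:R) //.
  by apply/funext => k; rewrite /coef_re; case: odd; rewrite ?mul0r // mulrAC.
have E2 : amp_im lam t n = limn (series (fun k => coef_im R k * t ^+ k * hpow lam k n / k`!%:R)).
  rewrite /amp_im (_ : (fun k => _) = fun k => coef_im R k * t ^+ k * hpow lam k n / k`!%:R) //.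
  by apply/funext => k; rewrite /coef_im; case: odd; rewrite ?mul0r // mulrAC.
rewrite /amp2 E1 E2.
rewrite (_ : (fun N => _) = (fun N =>
   (\sum_(k < N.+1) 'C(N, k)%:R / N%:R ^+ k * (coef_re R k * t ^+ k * hpow lam k n)) ^+ 2 +
   (\sum_(k < N.+1) 'C(N, k)%:R / N%:R ^+ k * (coef_im R k * t ^+ k * hpow lam k n)) ^+ 2)).
  by apply: cvgD; rewrite !expr2; apply: cvgM.
by apply/funext => N; rewrite evo_coords sqr_normcE.
Qed.

Ltac pos := repeat first
  [ assumption | exact: ltr0n | exact: expR_gt0
  | apply: mulr_gt0 | apply: addr_gt0 | rewrite invr_gt0 | apply: exprn_gt0 ].

Lemma wsum_mono (K : numDomainType) (L m : nat) (f : int -> K) :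
  (forall n, 0 <= f n) -> wsum L f <= wsum (L + m) f.
Proof.
move=> f0; elim: m => [|m IH]; first by rewrite addn0.
apply: le_trans IH _; rewrite addnS /wsum doubleS [leRHS]big_ltn // [X in _ <= _ + X]big_nat_recr //= [X in _ <= _ + (X + _)]big_add1 /=.
apply: le_trans (_ : \sum_(0 <= i < (L + m).*2.+1) f (i.+1%:Z - (L + m).+1%:Z) <= _).
  by apply: ler_sum => i _; rewrite (_ : i%:Z - (L + m)%N%:Z = i.+1%:Z - (L + m).+1%:Z) //; lia.
by rewrite addrA addrAC lerDr addr_ge0.
Qed.

Lemma amp2_ge0 (R : realType) (lam t : R) n : 0 <= amp2 lam t n.
Proof. by rewrite addr_ge0 // sqr_ge0. Qed.

Lemma near_nat_le (R : realType) (x : R) : \forall N \near \oo, x <= N%:R /\ (0 < N)%N.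
Proof.
by near=> N; split; near: N; [exact: nbhs_infty_ger | exact: nbhs_infty_gt].
Unshelve. all: by end_near.
Qed.

(** Once N >= t^2 K, each of the N factors in [evo_norm] is at most 1 + 1/N; hence the constant e,
    uniform in t and L. *)
Lemma amp2_total (R : realType) (lam t : R) L :
  0 <= lam -> wsum L (amp2 lam t) <= expR 1.
Proof.
move=> l0.
have cv : (fun N => wsum L (fun n => normc (evo (fibV lam) (- (t / N%:R))*i%C N n) ^+ 2)) @ \oo -->
    wsum L (amp2 lam t).
  rewrite /wsum; elim: (L.*2.+1) => [|m IH].
    rewrite big_geq // (_ : (fun N => _) = fun=> 0); first exact: cvg_cst.
    by apply/funext => N; rewrite big_geq.
  rewrite big_nat_recr //= (_ : (fun N => _) = fun N =>
    \sum_(0 <= i < m) normc (evo (fibV lam) (- (t / N%:R))*i%C N (i%:Z - L%:Z)) ^+ 2 +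
    normc (evo (fibV lam) (- (t / N%:R))*i%C N (m%:Z - L%:Z)) ^+ 2).
    by apply: cvgD IH _; exact: evo_amp2_cvg.
  by apply/funext => N; rewrite big_nat_recr.
apply: (cvgr_to_le cv).
set K := 3 * (2 + lam ^+ 2).
have K0 : 0 <= K by rewrite mulr_ge0 // addr_ge0 // sqr_ge0.
near=> N.
have [N1 N0] : t ^+ 2 * K <= N%:R /\ (0 < N)%N by near: N; exact: near_nat_le.
have Nr : 0 < N%:R :> R by rewrite ltr0n.
apply: le_trans (wsum_mono L (N + 3) (fun n => sqr_ge0 _)) _.
apply: le_trans (evo_norm _ (fun n => fibV_bounds n l0) _) _; first by lia.
rewrite -/K; apply: le_trans (_ : expR (N%:R^-1) ^+ N <= _).
  apply: lerXn2r; rewrite ?nnegrE ?expR_ge0 //.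
    by rewrite addr_ge0 // mulr_ge0 // sqr_ge0.
  apply: le_trans (expR_ge1Dx _); rewrite lerD2l.
  have -> : (t / N%:R) ^+ 2 * K = t ^+ 2 * K / N%:R / N%:R by field; rewrite gt_eqF.
  by rewrite ler_pdivrMr // mulVf ?gt_eqF // ler_pdivrMr // mul1r.
by rewrite -expRM_natl mulfV ?gt_eqF.
Unshelve. all: by end_near.
Qed.

(** The radius is chosen by 1/r = 1 + 1/(4AT): the ellipse then has height at most 1/(2T), and its
    points that are not far out have |Im z| >= 1/(8T). The power T^3 is Gam^2 / eps with Gam of
    order T. *)
Lemma amp2_site (R : realType) (lam s k xi : R) :
  8 <= lam -> 2 <= s -> s <= 9 / 4 -> 0 <= k -> k <= 1 / 4 -> s ^+ 2 = 4 + k ->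
  2 <= xi -> xi <= (lam - 2 - k) - s * (1 + k) - (s * (1 + k) + 1) / xi ->
  exists2 C0 : R, 0 < C0 & forall T t n0 j n, 1 <= T -> 0 <= t ->
    s ^+ 2 * xi < (8 * T) ^- 2 * xi ^+ n0 -> (2 < (n0 + j).+1)%N ->
    ((fib (n0 + j).+1).+1 < absz n)%N ->
    amp2 lam t n <= C0 * T ^+ 3 / (s - 1) ^+ fib j.+1 * expR (t / T).
Proof.
move=> lam8 s2 s3 k0 k1 sk xi2 rate.
have l0 : 0 <= lam by lra.
pose A := 2 * (lam + 4); have A1 : 1 <= A by rewrite /A; lra.
have A0 : 0 < A by rewrite /A; lra.
pose C0 := 4 * expR 1 * ((32 * A + 6 * A) * (16 * A) * 16 + (16 * A) ^+ 2).
exists C0.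
  have B0 : 0 < 16 * A by rewrite mulr_gt0.
  have B1 : 0 < 32 * A + 6 * A by move: A0; clear; lra.
  apply: mulr_gt0; first by apply: mulr_gt0; [exact: ltr0n | exact: expR_gt0].
  by apply: addr_gt0; [do 2! apply: mulr_gt0 => // | exact: exprn_gt0].
move=> T t n0 j n T1 t0 big j2 nq.
have T0 : 0 < T by lra.
pose rho := 1 + (4 * A * T)^-1.
have d0 : 0 < (4 * A * T)^-1 by pos.
have d1 : (4 * A * T)^-1 <= 1 / 4.
  have AT1 : 1 <= A * T by rewrite -[leLHS]mulr1 ler_pM.
  have P4 : 0 < 4 * A * T by pos.
  by rewrite -[leLHS]mul1r ler_pdivrMr //; move: AT1; clear; lra.
have rho1 : 1 < rho by rewrite ltrDl.
have rho0 : 0 < rho by lra.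
pose r := rho^-1.
have r0 : 0 < r by rewrite invr_gt0.
have r1 : r < 1 by rewrite invf_lt1.
have rr : rho * r = 1 by rewrite mulfV // gt_eqF.
pose Gam := 2 / (1 - r).
have r1' : (4 * A * T)^-1 / 2 <= 1 - r.
  have -> : 1 - r = (4 * A * T)^-1 * r by rewrite -{1}rr /rho; ring.
  apply: ler_wpM2l; first exact: ltW.
  by rewrite lef_pV2 ?posrE // /rho; lra.
have G16 : Gam <= 16 * A * T.
  rewrite /Gam ler_pdivrMr; last by lra.
  apply: le_trans (_ : 16 * A * T * ((4 * A * T)^-1 / 2) <= _).
    have -> : 16 * A * T * ((4 * A * T)^-1 / 2) = 2 by field; rewrite !gt_eqF.
    by [].
  by apply: ler_wpM2l => //; nonneg.
have G0 : 0 <= Gam by rewrite divr_ge0 // subr_ge0 ltW.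
have epsr : (8 * T)^-1 <= A * (r^-1 - r) / 2.
  have E8 : (8 * T)^-1 = A * (4 * A * T)^-1 / 2 by field; rewrite !gt_eqF.
  rewrite E8; apply: ler_wpM2r => //; apply: ler_wpM2l; first exact: ltW.
  by rewrite invrK /rho; lra.
have eps0 : 0 < (8 * T)^-1 by pos.
have Y0 : A * (r^-1 - r) <= (2 * T)^-1.
  have E2 : (2 * T)^-1 = A * (2 * (4 * A * T)^-1) by field; rewrite !gt_eqF.
  rewrite E2; apply: ler_wpM2l; first exact: ltW.
  have -> : r^-1 - r = (4 * A * T)^-1 * (1 + r).
    by rewrite invrK mulrDr mulr1; have := rr; rewrite {1}/rho mulrDl mul1r => h; rewrite /rho; lra.
  by rewrite mulrC; apply: ler_wpM2r; [exact: ltW | lra].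
pose Z0 := A * (r + r^-1).
have Z00 : 0 <= Z0 by rewrite /Z0; nonneg.
have [v1 v2 v3 _ _] := fibV_small lam.
have big' : s ^+ 2 * xi < (8 * T)^-1 ^+ 2 * xi ^+ n0 by rewrite exprVn.
have cv := @evo_amp2_cvg R lam t n l0.
apply: (cvgr_to_le cv).
near=> N.
have [N1 N0] : t ^+ 2 * Z0 ^+ 2 <= N%:R /\ (0 < N)%N by near: N; exact: near_nat_le.
have Nr : 0 < N%:R :> R by rewrite ltr0n.
(* The extra 1 pays for the second-order term N (t/N)^2 |z|^2, which is at most 1 for large N. *)
pose X := expR ((t / T + 1) / 2).
have hX w : normc w = r -> normc (1 + (- (t / N%:R))*i%C * (A%:C%C * (w + w^-1))) ^+ N <= X.
  move=> wr; have [_ hy hz] := joukowski_cases r0 r1 l0 (erefl A) wr.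
  set z := A%:C%C * (w + w^-1) in hy hz *; pose sg := t / N%:R.
  rewrite -/sg -(@ler_pXn2r _ 2) ?nnegrE ?exprn_ge0 ?normc_ge0 ?expR_ge0 //.
  rewrite exprAC /X -[leRHS]expRM_natl.
  have -> : 2 * ((t / T + 1) / 2) = N%:R * ((t / T + 1) / N%:R) by field; rewrite !gt_eqF.
  rewrite expRM_natl; apply: lerXn2r; rewrite ?nnegrE ?expR_ge0 ?exprn_ge0 ?normc_ge0 //.
  apply: le_trans (expR_ge1Dx _).
  have -> : normc (1 + (- sg)*i%C * z) ^+ 2 = 1 + 2 * (sg * Im z) + sg ^+ 2 * normc z ^+ 2.
    by rewrite !sqr_normcE; case: (z) => x y /=; ring.
  rewrite -addrA lerD2l [leRHS]mulrDl; apply: lerD.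
    have h1 : Im z <= (2 * T)^-1 by apply: le_trans (ler_norm _) (le_trans hy Y0).
    have sg0 : 0 <= sg by rewrite divr_ge0.
    have h2 : sg * Im z <= sg * (2 * T)^-1 by apply: ler_wpM2l.
    have E3 : t / T / N%:R = 2 * (sg * (2 * T)^-1) by rewrite /sg; field; rewrite !gt_eqF.
    by rewrite E3; move: h2; clear; lra.
  rewrite /sg expr_div_n ler_pdivlMr //.
  have -> : t ^+ 2 / N%:R ^+ 2 * normc z ^+ 2 * N%:R = t ^+ 2 * normc z ^+ 2 / N%:R.
    by field; rewrite gt_eqF.
  rewrite ler_pdivrMr // mul1r; apply: le_trans N1; apply: ler_wpM2l; first exact: sqr_ge0.
  by apply: lerXn2r; rewrite ?nnegrE ?normc_ge0.
have X0 : 0 <= X by exact: expR_ge0.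
have S := evo_site (Gam := Gam) erefl lam8 s2 s3 k0 k1 sk xi2 rate v1 v2 v3
  (fun n m a b => @fibV_period R lam n m a b) (fun m a => @fibV_reflect R lam m a)
  (fun m => @fibV_bounds R lam m l0) (erefl A) r0 r1 eps0 epsr big' j2 nq X0 hX.
apply: le_trans S _.
have EX : X ^+ 2 = expR 1 * expR (t / T).
  by rewrite /X -expRM_natl -expRD; congr expR; field; rewrite gt_eqF.
set Th := (s - 1) ^+ fib j.+1.
have Th0 : 0 < Th by rewrite exprn_gt0 //; lra.
have L : (2 * Gam + (4 * A + A / r)) * Gam * 2 / (8 * T)^-1 + Gam ^+ 2 <=
   ((32 * A + 6 * A) * (16 * A) * 16 + (16 * A) ^+ 2) * T ^+ 3.
  have Ar : A / r <= 2 * A.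
    by rewrite invrK mulrC; apply: ler_wpM2r; [exact: ltW | rewrite /rho; lra].
  have AT : A <= A * T by rewrite ler_peMr // ltW.
  have f1 : 2 * Gam + (4 * A + A / r) <= (32 * A + 6 * A) * T.
    have -> : (32 * A + 6 * A) * T = 2 * (16 * A * T) + 6 * (A * T) by ring.
    by move: G16 Ar AT; clear; lra.
  have f0 : 0 <= 2 * Gam + (4 * A + A / r).
    by nonneg.
  have f2 : (2 * Gam + (4 * A + A / r)) * Gam <= (32 * A + 6 * A) * T * (16 * A * T).
    exact: ler_pM.
  have f3 : (2 * Gam + (4 * A + A / r)) * Gam * (16 * T) <= (32 * A + 6 * A) * T * (16 * A * T) * (16 * T).
    by apply: ler_wpM2r => //; nonneg.
  have f4 : Gam ^+ 2 <= (16 * A * T) ^+ 2 by apply: lerXn2r; rewrite ?nnegrE //; nonneg.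
  have T23 : T ^+ 2 <= T ^+ 3 by apply: ler_weXn2l.
  have f5 : (16 * A) ^+ 2 * T ^+ 2 <= (16 * A) ^+ 2 * T ^+ 3.
    by apply: ler_wpM2l => //; exact: sqr_ge0.
  rewrite invrK [leRHS]mulrDl; apply: lerD; last by apply: le_trans f4 _; rewrite exprMn.
  by move: f3; clear; set g := _ * Gam; rewrite !exprS expr0; lra.
rewrite EX /C0 -/Th.
have -> : 4 * (expR 1 * expR (t / T)) * (((2 * Gam + (4 * A + A / r)) * Gam * 2 / (8 * T)^-1 + Gam ^+ 2) / Th)
  = (4 * (expR 1 * expR (t / T)) / Th) * ((2 * Gam + (4 * A + A / r)) * Gam * 2 / (8 * T)^-1 + Gam ^+ 2).
  by move: (_ + Gam ^+ 2) => q; ring.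
apply: le_trans (ler_wpM2l _ L) _.
  by rewrite mulr_ge0 ?mulr_ge0 ?expR_ge0 // invr_ge0 ltW.
by rewrite le_eqVlt; apply/orP; left; apply/eqP; ring.
Unshelve. all: by end_near.
Qed.

(** * Time averages *)

Lemma amp2_measurable (R : realType) (lam : R) n : 0 <= lam ->
  measurable_fun [set: R] (fun t => amp2 lam t n).
Proof.
move=> l0; apply: (measurable_fun_cvg (h := fun (N : nat) (t : R) =>
   (\sum_(k < N.+1) 'C(N, k)%:R / N%:R ^+ k * (coef_re R k * t ^+ k * hpow lam k n)) ^+ 2 +
   (\sum_(k < N.+1) 'C(N, k)%:R / N%:R ^+ k * (coef_im R k * t ^+ k * hpow lam k n)) ^+ 2)).
  move=> N; apply: measurable_funD; apply: measurable_funX; apply: measurable_sum => k;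
  do 2! apply: measurable_funM => //; apply: measurable_funM => //; exact: measurable_funX.
move=> t _ /=; have := @evo_amp2_cvg R lam t n l0.
rewrite (_ : (fun N => normc _ ^+ 2) = (fun N =>
   (\sum_(k < N.+1) 'C(N, k)%:R / N%:R ^+ k * (coef_re R k * t ^+ k * hpow lam k n)) ^+ 2 +
   (\sum_(k < N.+1) 'C(N, k)%:R / N%:R ^+ k * (coef_im R k * t ^+ k * hpow lam k n)) ^+ 2)) //.
by apply/funext => N; rewrite evo_coords sqr_normcE.
Qed.

Lemma integral_expR_neg (R : realType) (c : R) : 0 < c ->
  (\int[@lebesgue_measure R]_(x in `[0%R, +oo[%classic) (expR (- (c * x)))%:E = (c^-1)%:E)%E.
Proof.
move=> c0; have := integral_exponential_pdf c0.
rewrite /exponential_pdf.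
rewrite (_ : (fun x => (((fun x => c * expR (- c * x)) \_ `[0, +oo[%classic) x)%:E) =
   (fun x => (c * expR (- c * x))%:E) \_ `[0%R, +oo[%classic); last first.
  by apply/funext => x; rewrite /patch; case: ifP.
rewrite -integral_mkcond.
under eq_integral do rewrite EFinM mulNr.
rewrite ge0_integralZl_EFin //; last 2 first.
- apply/measurable_EFinP; apply: measurable_funTS; apply: measurableT_comp => //.
  by apply: measurableT_comp => //; exact: measurable_funM.
- exact: ltW.
set I := (\int[_]_(_ in _) _)%E => h.
have cI : ((c^-1)%:E * (c%:E * I) = I)%E by rewrite muleA -EFinM mulVf ?gt_eqF // mul1e.
by rewrite -cI h mule1.
Qed.

(** Against growth e^{t/T} the weight leaves e^{-t/T}, whose integral T cancels against 2/T. A list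
    of sites is allowed so that a single far site and a whole window are both covered. *)
Lemma aT_sum_le (R : realType) (lam T C : R) (s : seq int) :
  0 <= lam -> 0 < T -> 0 <= C ->
  (forall t : R, 0 <= t -> \sum_(n <- s) amp2 lam t n <= C * expR (t / T)) ->
  (\sum_(n <- s) aT lam n T <= (2 * C)%:E)%E.
Proof.
move=> l0 T0 C0 h; rewrite /aT.
have T2 : (0 <= (2 / T)%:E)%E by rewrite lee_fin divr_ge0 // ltW.
have mf (n : int) : measurable_fun (`[0%R, +oo[%classic : set R) (fun t : R => (expR (- (2 * t / T)) * amp2 lam t n)%:E).
  apply/measurable_EFinP; apply: measurable_funTS; apply: measurable_funM.
    apply: measurableT_comp => //; apply: measurableT_comp => //.
    by apply: measurable_funM => //; exact: measurable_funM.
  exact: amp2_measurable.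
have f0 (n : int) (t : R) : (0 <= (expR (- (2 * t / T)) * amp2 lam t n)%:E)%E.
  by rewrite lee_fin mulr_ge0 ?expR_ge0 // amp2_ge0.
rewrite -ge0_sume_distrr; last first.
  by move=> n _; apply: integral_ge0 => t _.
rewrite -ge0_integral_sum //.
apply: le_trans (_ : ((2 / T)%:E * \int[@lebesgue_measure R]_(t in `[0%R, +oo[%classic)
    (C%:E * (expR (- (T^-1 * t)))%:E) <= _)%E).
  apply: lee_wpmul2l => //; apply: ge0_le_integral => //.
  - by move=> t _; apply: sume_ge0.
  - exact: emeasurable_sum.
  - apply: measurable_funeM; apply/measurable_EFinP; apply: measurable_funTS.
    apply: measurableT_comp => //; apply: measurableT_comp => //; exact: measurable_funM.
  move=> t; rewrite /= in_itv /= andbT => t0.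
  rewrite sumEFin -EFinM lee_fin -mulr_sumr.
  apply: le_trans (ler_wpM2l (expR_ge0 _) (h t t0)) _.
  rewrite mulrCA -expRD le_eqVlt; apply/orP; left; apply/eqP; congr (_ * expR _).
  by field; rewrite gt_eqF.
rewrite ge0_integralZl_EFin //; last first.
  apply/measurable_EFinP; apply: measurable_funTS.
  apply: measurableT_comp => //; apply: measurableT_comp => //; exact: measurable_funM.
rewrite integral_expR_neg ?invr_gt0 // invrK -!EFinM lee_fin.
have -> : 2 / T * (C * T) = 2 * C by field; rewrite gt_eqF.
by [].
Qed.

Lemma aT_ge0 (R : realType) (lam : R) n T : 0 < T -> (0 <= aT lam n T)%E.
Proof.
move=> T0; rewrite /aT mule_ge0 ?lee_fin ?divr_ge0 ?(ltW T0) //.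
by apply: integral_ge0 => t _; rewrite lee_fin mulr_ge0 ?expR_ge0 // amp2_ge0.
Qed.

Lemma aT_total (R : realType) (lam T : R) L : 0 <= lam -> 0 < T ->
  (\sum_(0 <= i < L.*2.+1) aT lam (i%:Z - L%:Z) T <= (2 * expR 1)%:E)%E.
Proof.
move=> l0 T0.
have E (V : nmodType) (f : int -> V) : \sum_(0 <= i < L.*2.+1) f (i%:Z - L%:Z) =
   \sum_(n <- [seq i%:Z - L%:Z | i <- index_iota 0 L.*2.+1]) f n by rewrite big_map.
rewrite (E _ (fun n => aT lam n T)); apply: aT_sum_le; rewrite ?expR_ge0 // => t t0.
rewrite -E; apply: le_trans (amp2_total t L l0) _.
by rewrite ler_peMr ?expR_ge0 // -expR0 ler_expR divr_ge0 // ltW.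
Qed.

Lemma aT_site (R : realType) (lam s k xi : R) :
  8 <= lam -> 2 <= s -> s <= 9 / 4 -> 0 <= k -> k <= 1 / 4 -> s ^+ 2 = 4 + k ->
  2 <= xi -> xi <= (lam - 2 - k) - s * (1 + k) - (s * (1 + k) + 1) / xi ->
  exists2 C0 : R, 0 < C0 & forall T n0 j n, 1 <= T ->
    s ^+ 2 * xi < (8 * T) ^- 2 * xi ^+ n0 -> (2 < (n0 + j).+1)%N ->
    ((fib (n0 + j).+1).+1 < absz n)%N ->
    (aT lam n T <= (C0 * T ^+ 3 / (s - 1) ^+ fib j.+1)%:E)%E.
Proof.
move=> lam8 s2 s3 k0 k1 sk xi2 rate.
have [C0 C00 hC] := amp2_site lam8 s2 s3 k0 k1 sk xi2 rate.
exists (2 * C0); first exact: mulr_gt0.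
move=> T n0 j n T1 big j2 nq.
have T0 : 0 < T by apply: lt_le_trans T1.
have h := @aT_sum_le R lam T (C0 * T ^+ 3 / (s - 1) ^+ fib j.+1) [:: n].
rewrite big_seq1 in h.
have -> : 2 * C0 * T ^+ 3 / (s - 1) ^+ fib j.+1 = 2 * (C0 * T ^+ 3 / (s - 1) ^+ fib j.+1).
  by rewrite !mulrA.
have C1 := ltW C00; have T1' := ltW T0; have s1 : 0 <= s - 1 by move: s2; clear; lra.
apply: h => //; first by move: lam8; clear; lra.
- by nonneg.
- by move=> t t0; rewrite big_seq1; exact: (hC T t n0).
Qed.

(** * Decay beyond T^alpha *)

Lemma golden_ratioE (R : realType) : (Num.sqrt 5 + 1) / 2 = 1 + omega R.
Proof. by rewrite /omega; field. Qed.

Lemma golden_sq (R : realType) : (1 + omega R) ^+ 2 = 1 + (1 + omega R).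
Proof. by have h := omega_sq R; rewrite sqrrD h; ring. Qed.

Lemma fib_le_golden (R : realType) k : (fib k.+1)%:R <= (1 + omega R) ^+ k.
Proof.
have [w0 _] := omega_bounds R; have sq := golden_sq R.
suff H : (fib k.+1)%:R <= (1 + omega R) ^+ k /\ (fib k.+2)%:R <= (1 + omega R) ^+ k.+1.
  by case: H.
elim: k => [|k [h0 h1]]; first by rewrite expr0 expr1 /=; split => //; lra.
split => //; rewrite fibS2 natrD.
have -> : (1 + omega R) ^+ k.+2 = (1 + omega R) ^+ k.+1 + (1 + omega R) ^+ k.
  by rewrite -addn2 exprD sq mulrDr mulr1 addrC -exprSr.
exact: lerD.
Qed.

Lemma golden_le_fib (R : realType) m : (0 < m)%N ->
  (1 + omega R) ^+ m <= (fib m)%:R * (1 + omega R) ^+ 2.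
Proof.
have [w0 _] := omega_bounds R; have sq := golden_sq R.
have p0 : 0 <= (1 + omega R) ^+ 2 by exact: sqr_ge0.
case: m => // m _.
suff H : (1 + omega R) ^+ m.+1 <= (fib m.+1)%:R * (1 + omega R) ^+ 2 /\
   (1 + omega R) ^+ m.+2 <= (fib m.+2)%:R * (1 + omega R) ^+ 2 by case: H.
elim: m => [|m [h0 h1]].
  by rewrite expr1 /= mul1r; split => //; rewrite sq; lra.
split => //; rewrite fibS2 natrD mulrDl.
have -> : (1 + omega R) ^+ m.+3 = (1 + omega R) ^+ m.+2 + (1 + omega R) ^+ m.+1.
  by rewrite -[m.+3]addn2 exprD sq mulrDr mulr1 addrC -exprSr.
exact: lerD.
Qed.

Lemma fib_bracket N : (3 < N)%N ->
  exists k, [/\ (2 < k)%N, ((fib k).+1 < N)%N & (N <= (fib k.+1).+1)%N].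
Proof.
move=> N3.
have fge k : (k <= fib k.+1)%N.
  elim/ltn_ind: k => -[|[|[|k]]] // IH; rewrite fibS2.
  by have := IH k.+2 (leqnn _); have := fib_gt0 (isT : (0 < k.+2)%N); lia.
have ex : exists k, (N <= (fib k.+1).+1)%N by exists N; rewrite leqW.
case: (ex_minnP ex) => m hm mmin; exists m; split => //.
- by rewrite ltnNge; apply/negP => m2; move: hm; have := fib_mono (m2 : (m.+1 <= 3)%N) => /=; lia.
case: m hm mmin => [|m] hm mmin; first by move: hm => /=; lia.
by rewrite ltnNge; apply/negP => h; have := mmin m h; rewrite ltnn.
Qed.

Lemma expR_beats_linear (R : realType) (c mu K Q K2 : R) : 0 < c -> 0 < mu ->
  exists y0, forall y, y0 <= y -> K + Q * y <= c * expR (mu * y - K2).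
Proof.
move=> c0 mu0; pose d := c * expR (- K2) * (mu ^+ 2 / 2).
have d0 : 0 < d by rewrite !mulr_gt0 ?expR_gt0 ?exprn_gt0 // invr_gt0.
exists (1 + (`|K| + `|Q|) / d) => y hy.
have y1 : 1 <= y by apply: le_trans hy; rewrite lerDl divr_ge0 ?addr_ge0 // ltW.
have yd : `|K| + `|Q| <= d * y.
  rewrite -ler_pdivrMl // mulrC; apply: le_trans hy; rewrite lerDr; exact: ler01.
have my : 0 <= mu * y by rewrite mulr_ge0 ?(ltW mu0) //; lra.
have E : d * y ^+ 2 <= c * expR (mu * y - K2).
  have := expR_ge1Dxn 1 my; rewrite exprMn (_ : 2`! = 2)%N // => h.
  rewrite expRD [expR _ * _]mulrC [leRHS]mulrA.
  have -> : d * y ^+ 2 = c * expR (- K2) * (mu ^+ 2 * y ^+ 2 / 2) by rewrite /d; ring.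
  apply: ler_wpM2l; first by rewrite mulr_ge0 ?expR_ge0 // ltW.
  by apply: le_trans h; rewrite lerDr ler01.
apply: le_trans E; apply: le_trans (_ : (`|K| + `|Q|) * y <= _); last first.
  by rewrite expr2 mulrA; apply: ler_wpM2r => //; lra.
rewrite mulrDl; apply: lerD.
  by apply: le_trans (ler_norm K) _; rewrite ler_peMr.
by apply: ler_wpM2r; [lra | exact: ler_norm].
Qed.

Lemma xi_props (R : realType) (lam : R) : 8 <= lam ->
  3 <= xi lam /\ xi lam ^+ 2 = (lam - 4) * xi lam - 3.
Proof.
move=> lam8.
have d0 : 4 <= (lam - 4) ^+ 2 - 12 by nra.
have sq : Num.sqrt ((lam - 4) ^+ 2 - 12) ^+ 2 = (lam - 4) ^+ 2 - 12.
  by rewrite sqr_sqrtr //; lra.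
have s2 : 2 <= Num.sqrt ((lam - 4) ^+ 2 - 12).
  by rewrite -(@ler_pXn2r _ 2) ?nnegrE ?sqrtr_ge0 // sq; lra.
rewrite /xi; move: sq s2; set q := Num.sqrt _ => sq s2; split.
  by rewrite ler_pdivlMr //; lra.
have -> : ((lam - 4 + q) / 2) ^+ 2 = ((lam - 4) ^+ 2 + 2 * (lam - 4) * q + q ^+ 2) / 4 by field.
by rewrite sq; field.
Qed.

(** At s = 2, k = 0 the rate condition for x holds with slack g, positive because X g x = (X - x)(X
    x - 3) with X = [xi lam]. Any x between exp (2 ln phi / a) and X meets the demand on a, and a
    small s - 2 fits into the slack. *)
Lemma rate_parameters (R : realType) (lam a : R) : 8 <= lam -> alpha_lam lam < a ->
  exists p : R * R * R, let: (x, s, k) := p in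
  [/\ 0 < a, 2 <= x, 2 * ln (1 + omega R) < a * ln x, 2 < s &
   [/\ s <= 9 / 4, 0 <= k, k <= 1 / 4, s ^+ 2 = 4 + k &
   x <= (lam - 2 - k) - s * (1 + k) - (s * (1 + k) + 1) / x]].
Proof.
move=> lam8; rewrite /alpha_lam golden_ratioE => ha.
have [w0 _] := omega_bounds R.
have [X3 Xeq] := xi_props lam8; set X := xi lam in ha X3 Xeq.
have f0 : 0 < ln (1 + omega R) by rewrite ln_gt0 // ltrDl; lra.
have lX : 0 < ln X by rewrite ln_gt0 //; lra.
have a0 : 0 < a by apply: lt_trans ha; rewrite divr_gt0 // mulr_gt0.
pose B := expR (2 * ln (1 + omega R) / a).
have X0 : 0 < X by lra.
have BX : B < X.
  rewrite /B -[ltRHS]lnK ?posrE // ltr_expR ltr_pdivrMr //.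
  by move: ha; rewrite ltr_pdivrMr // [a * _]mulrC.
pose x := Num.max (5 / 2) ((B + X) / 2).
have x5 : 5 / 2 <= x by rewrite le_max lexx.
have xX : x < X by rewrite gt_max; apply/andP; split; lra.
have Bx : B < x by rewrite lt_max; apply/orP; right; lra.
have x0 : 0 < x by lra.
pose g := lam - 4 - 3 / x - x.
have g0 : 0 < g.
  have -> : g = ((lam - 4) * x - 3 - x ^+ 2) / x by rewrite /g; field; rewrite gt_eqF.
  apply: divr_gt0 => //.
  have h : 0 < (X - x) * (X * x - 3).
    have Xx : 3 * (5 / 2) <= X * x by apply: ler_pM => //; lra.
    by apply: mulr_gt0; [move: xX | move: Xx]; clear; lra.
  rewrite -(pmulr_rgt0 _ X0).
  have -> : X * ((lam - 4) * x - 3 - x ^+ 2) = (X - x) * (X * x - 3) -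
     x * (X ^+ 2 - ((lam - 4) * X - 3)) by ring.
  by rewrite Xeq subrr mulr0 subr0.
(* With s = 2 + d the losses are k = 4d + d^2, then 12d in s (1 + k) and 6d in the quotient,
   together at most 23d. *)
pose d := Num.min (1 / 50) (g / 23).
have d0 : 0 < d by rewrite lt_min divr_gt0 //= divr_gt0.
have d1 : d <= 1 / 50 by rewrite ge_min lexx.
have d2 : 23 * d <= g.
  have : d <= g / 23 by rewrite ge_min lexx orbT.
  by clear; lra.
have dd : 0 <= d ^+ 2 <= d / 50 by rewrite sqr_ge0 expr2 /=; nra.
exists (x, 2 + d, 4 * d + d ^+ 2); split => //.
- by lra.
- have := Bx; rewrite /B -[ltRHS]lnK ?posrE // ltr_expR ltr_pdivrMr //.
  by rewrite [ln x * a]mulrC.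
- by lra.
move: dd => /andP[dd0 dd1]; split; try (by move: d0 d1 dd0 dd1; clear; lra).
have dk : d * (4 * d + d ^+ 2) <= d by rewrite ler_piMr //; [exact: ltW | lra].
have S : (2 + d) * (1 + (4 * d + d ^+ 2)) <= 2 + 12 * d.
  have -> : (2 + d) * (1 + (4 * d + d ^+ 2)) = 2 + d + 2 * (4 * d + d ^+ 2) + d * (4 * d + d ^+ 2) by ring.
  by move: dk dd1 d0; clear; lra.
set S' := (2 + d) * _ in S *.
have Q : (S' + 1) / x <= 3 / x + 6 * d.
  rewrite ler_pdivrMr // mulrDl -mulrA mulVf ?gt_eqF // mulr1.
  have : 2 * d <= d * x by rewrite mulrC; apply: ler_wpM2l; [exact: ltW | lra].
  by move: S; clear; lra.
by move: S Q d2 dd1 d0; rewrite /g; clear; lra.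
Qed.

(** With y = ln |n| and T^a <= |n|, the level n0 is at most about 2y / (a ln x), while site n sits
    at level kk, about y / ln phi. The gap is about mu y / ln phi, with mu > 0 exactly because a ln
    x > 2 ln phi. Hence fib j.+1 is at least a constant times |n|^mu, and (s - 1)^(fib j.+1)
    outgrows every power of |n|. *)
Lemma aT_decay (R : realType) (lam a : R) (q : nat) : 8 <= lam -> alpha_lam lam < a ->
  exists2 T0, 1 <= T0 & forall T n, T0 <= T -> T `^ a <= (absz n)%:R ->
    (aT lam n T <= ((absz n)%:R ^- q)%:E)%E.
Proof.
move=> lam8 ha.
have [[[x s] k] [a0 x2 fx s2 [s3 k0 k1 sk rate]]] := rate_parameters lam8 ha.
have [C0 C00 hC] := aT_site lam8 (ltW s2) s3 k0 k1 sk x2 rate.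
have [w0 _] := omega_bounds R.
have phi1 : 1 < 1 + omega R by rewrite ltrDl; lra.
have phi0 : 0 < 1 + omega R by lra.
set f := ln (1 + omega R) in fx.
have f0 : 0 < f by rewrite ln_gt0.
have x0 : 0 < x by lra.
set lx := ln x in fx.
have lx0 : 0 < lx by rewrite ln_gt0 //; lra.
pose mu := 1 - 2 * f / (lx * a).
have mu0 : 0 < mu.
  by rewrite subr_gt0 ltr_pdivrMr ?mulr_gt0 // mul1r mulrC [lx * a]mulrC mulrC.
pose LB := ln (64 * (s ^+ 2 * x)).
have s0 : 0 < s by lra.
have B0 : 0 < 64 * (s ^+ 2 * x) by pos.
have LB0 : 0 <= LB.
  rewrite ln_ge0 //; have : 1 <= s ^+ 2 * x; last by lra.
  by rewrite -[leLHS]mulr1 ler_pM // ?exprn_ege1 //; lra.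
(* The terms come from |n| <= 2 phi^kk, from the constant 64 s^2 x in the condition on n0, and from
   rounding n0 up. *)
pose K1 := ln 2 + f * LB / lx + f.
pose c := ln (s - 1).
have c0 : 0 < c by rewrite ln_gt0 //; lra.
have [y1 hy1] := expR_beats_linear (ln C0) (3 / a + q%:R) (K1 + 2 * f) c0 mu0.
(* The three thresholds ensure the final domination, n0 < kk, and |n| > 3 as [fib_bracket]
   requires. *)
pose y0 := Num.max (Num.max y1 ((K1 + f) / mu)) (ln 4).
exists (Num.max 1 (expR (y0 / a))); first by rewrite le_max lexx.
move=> T n; rewrite ge_max => /andP[T1 TE] Tn.
have T0 : 0 < T by lra.
pose l := ln T; pose N := absz n; pose y := ln (N%:R : R).
have l0 : 0 <= l by rewrite ln_ge0.
have l1 : y0 / a <= l by rewrite -ler_expR lnK.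
have Tpos : 0 < T `^ a by rewrite powR_gt0.
have N0 : 0 < N%:R :> R by apply: lt_le_trans Tn.
have yl : a * l <= y.
  have : ln (T `^ a) <= ln (N%:R : R) by rewrite ler_ln ?posrE.
  by rewrite ln_powR.
have yy0 : y0 <= y.
  by apply: le_trans yl; rewrite mulrC -ler_pdivrMr.
have [ya yb yc] : [/\ y1 <= y, (K1 + f) / mu <= y & ln 4 <= y].
  by move: yy0; rewrite !ge_max => /andP[/andP[-> ->] ->].
have N4 : (3 < N)%N by rewrite -(ltr_nat R); apply: lt_le_trans (_ : 4 <= _);
   [rewrite ltr_nat | rewrite -ler_ln ?posrE].
have [kk [k2 kN Nk]] := fib_bracket N4.
pose u := (LB + 2 * l) / lx.
have u0 : 0 <= u by rewrite divr_ge0 ?addr_ge0 ?mulr_ge0 // ltW.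
pose n0 := (Num.truncn u).+1.
have /andP[n0a n0b] := truncn_itv u0.
have big : s ^+ 2 * x < (8 * T) ^- 2 * x ^+ n0.
  rewrite -ltr_pdivrMl ?invr_gt0 ?exprn_gt0 ?mulr_gt0 // invrK.
  have -> : (8 * T) ^+ 2 * (s ^+ 2 * x) = 64 * (s ^+ 2 * x) * T ^+ 2 by ring.
  have T2 : 0 < T ^+ 2 by exact: exprn_gt0.
  rewrite -ltr_ln; [| by rewrite posrE mulr_gt0 | by rewrite posrE exprn_gt0].
  rewrite lnM ?posrE // !lnXn // -/LB -/l -/lx -[l *+ 2]mulr_natl -[lx *+ n0]mulr_natl.
  by rewrite -ltr_pdivrMr.
have yk : y <= ln 2 + kk%:R * f.
  have h : N%:R <= 2 * (1 + omega R) ^+ kk.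
    apply: le_trans (_ : (fib kk.+1)%:R + 1 <= _); first by rewrite natr1 ler_nat.
    have := fib_le_golden R kk; have : 1 <= (1 + omega R) ^+ kk by rewrite exprn_ege1 // ltW.
    by clear; lra.
  have P0 : 0 < (1 + omega R) ^+ kk by exact: exprn_gt0.
  have Q0 : 0 < 2 * (1 + omega R) ^+ kk by exact: mulr_gt0.
  have : ln (N%:R : R) <= ln (2 * (1 + omega R) ^+ kk) by rewrite ler_ln ?posrE.
  rewrite lnM ?posrE // lnXn //.
  by rewrite -/f -[f *+ kk]mulr_natl.
have muE : mu * y - K1 <= (kk%:R - n0%:R) * f.
  have n0u : n0%:R <= u + 1 by rewrite /n0 -natr1 lerD2r.
  have h1 : n0%:R * f <= (u + 1) * f by apply: ler_wpM2r => //; exact: ltW.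
  have h2 : u * f = f * LB / lx + 2 * f / (lx * a) * (a * l).
    by rewrite /u; field; rewrite !gt_eqF.
  have h3 : 2 * f / (lx * a) * (a * l) <= 2 * f / (lx * a) * y.
    by apply: ler_wpM2l => //; rewrite divr_ge0 ?mulr_ge0 // ltW.
  rewrite mulrBl /mu /K1 mulrBl mul1r.
  rewrite mulrDl mul1r h2 in h1; move: h1 h3 yk; clear; lra.
have kn0 : (n0 < kk)%N.
  rewrite -(ltr_nat R) -subr_gt0 -(pmulr_lgt0 _ f0); apply: lt_le_trans muE.
  by move: yb; rewrite ler_pdivrMr // => yb; move: yb f0; clear; lra.
pose j := (kk - n0).-1.
have Ek : (n0 + j).+1 = kk by rewrite /j; move: kn0; clear; lia.
have Ej : j.+1 = (kk - n0)%N by rewrite /j; move: kn0; clear; lia.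
have := hC T n0 j n T1 big; rewrite Ek => /(_ k2 kN) h.
apply: le_trans h _; rewrite lee_fin.
have F : expR (mu * y - (K1 + 2 * f)) <= (fib j.+1)%:R.
  have := @golden_le_fib R j.+1 isT; rewrite -ler_pdivrMr ?exprn_gt0 // => hf.
  apply: le_trans hf.
  rewrite -[leRHS]lnK ?posrE ?divr_gt0 ?exprn_gt0 // ler_expR ln_div ?posrE ?exprn_gt0 //.
  rewrite !lnXn // -/f -[f *+ j.+1]mulr_natl -[f *+ 2]mulr_natl Ej natrB; last exact: ltnW.
  by move: muE; clear; lra.
have s10 : 0 < s - 1 by move: s2; clear; lra.
have Th0 : 0 < (s - 1) ^+ fib j.+1 by exact: exprn_gt0.
have T30 : 0 < T ^+ 3 by exact: exprn_gt0.
have Nq0 : 0 < N%:R ^+ q :> R by exact: exprn_gt0.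
rewrite ler_pdivrMr // -ler_pdivrMl ?invr_gt0 // invrK.
have CT0 : 0 < C0 * T ^+ 3 by exact: mulr_gt0.
rewrite -ler_ln; [| by rewrite posrE mulr_gt0 | by rewrite posrE].
rewrite (lnM Nq0 CT0) (lnM C00 T30).
rewrite !lnXn // -/c -/l -/y -[c *+ _]mulr_natl -[l *+ _]mulr_natl -[y *+ _]mulr_natl.
have h1 := hy1 y ya.
have h2 : c * expR (mu * y - (K1 + 2 * f)) <= c * (fib j.+1)%:R by apply: ler_wpM2l => //; exact: ltW.
have h3 : 3 * l <= 3 / a * y.
  have -> : 3 * l = 3 / a * (a * l) by field; rewrite gt_eqF.
  by apply: ler_wpM2l => //; rewrite divr_ge0 // ltW.
rewrite mulrDl in h1; rewrite [X in _ <= X]mulrC.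
by move: h1 h2 h3; clear; lra.
Qed.
(** * Transport exponents *)

(** Every finite set of integers lies in a symmetric window, and the terms are nonnegative. *)
Lemma esum_window (R : realType) (S : set int) (f : int -> \bar R) (M : \bar R) :
  (forall n, (0 <= f n)%E) ->
  (forall L : nat, (\sum_(0 <= i < L.*2.+1) f (i%:Z - L%:Z)%R <= M)%E) ->
  (\esum_(n in S) f n <= M)%E.
Proof.
move=> f0 fM; apply: ge_ereal_sup => _ [_ [/finite_seqP[F ->] _] <-].
pose L := \max_(n <- F) absz n.
pose W := [seq i%:Z - L%:Z | i <- index_iota 0 L.*2.+1].
have uW : uniq W.
  by rewrite map_inj_uniq ?iota_uniq // => i j /addIr [].
apply: le_trans (fM L); rewrite -(big_map (fun i : nat => i%:Z - L%:Z) xpredT f).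
rewrite -/W [leRHS](fsbig_seq _ _ uW).
apply: lee_fsum_nneg_subset => //.
move=> n; rewrite !inE /= => nF.
have nL : (absz n <= L)%N by rewrite /L; apply: leq_bigmax_seq.
apply/mapP; exists (absz (n + L%:Z)); first by rewrite mem_index_iota; move: nL; clear; lia.
by move: nL; clear; lia.
Qed.

(** A telescoping substitute for n^(-2); 6 is the least factor for which it dominates n^(-2) at all
    |n| >= 1, with equality at 1. *)
Definition summable_weight (R : realType) (n : int) : R :=
  6 / (((absz n)%:R + 1) * ((absz n)%:R + 2)).

Lemma summable_weight_ge0 (R : realType) n : 0 <= summable_weight R n.
Proof. by rewrite divr_ge0 ?mulr_ge0 ?addr_ge0. Qed.

Lemma summable_weight_window (R : realType) L :
  \sum_(0 <= i < L.*2.+1) summable_weight R (i%:Z - L%:Z) <= 12.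
Proof.
suff H : \sum_(0 <= i < L.*2.+1) summable_weight R (i%:Z - L%:Z) <= 12 - 12 / (L%:R + 2).
  by apply: le_trans H _; rewrite gerBl divr_ge0 ?addr_ge0.
elim: L => [|L IH].
  by rewrite double0 big_nat1 /summable_weight /= !add0r; lra.
have pL : 0 <= L%:R :> R by [].
rewrite doubleS big_ltn // big_nat_recr //= big_add1 /=.
rewrite (eq_bigr (fun i : nat => summable_weight R (i%:Z - L%:Z))); last first.
  by move=> i _; congr summable_weight; lia.
have E (n : int) : absz n = L.+1 -> summable_weight R n = 6 / (L%:R + 2) - 6 / (L%:R + 3).
  by move=> nE; rewrite /summable_weight nE -natr1; field; lra.
rewrite !E; [|lia|lia].
have -> : L.+1%:R + 2 = L%:R + 3 :> R by rewrite -[L.+1%:R]natr1; ring.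
by move: IH; clear; lra.
Qed.

Lemma inv_sqr_le_weight (R : realType) (n : int) : (0 < absz n)%N ->
  (absz n)%:R ^- 2 <= summable_weight R n.
Proof.
move=> n0; have n1 : 1 <= (absz n)%:R :> R by rewrite ler1n.
rewrite /summable_weight; move: n1; set N := _%:R => N1.
rewrite ler_pdivlMr; last by rewrite mulr_gt0 ?addr_gt0 //; lra.
rewrite ler_pdivrMl; last by rewrite exprn_gt0 //; lra.
by move: N1; clear; nra.
Qed.

Lemma limsup_oo_le (R : realType) (f : R -> \bar R) (M : R) (b : \bar R) :
  (forall T, M < T -> (f T <= b)%E) -> (limsup_oo f <= b)%E.
Proof.
move=> fb; pose V := [set T : R | M < T].
apply: le_trans (_ : ereal_sup (f @` V) <= b)%E.
  apply: ereal_inf_lbound; exists V => //.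
  by exists M; split => //; exact: num_real.
by apply: ge_ereal_sup => _ [T MT <-]; exact: fb.
Qed.

Lemma eln_mul_le (R : realType) (P : \bar R) (x c : R) (b : R) : 0 < x -> 0 < c ->
  (P <= x%:E)%E -> ln x * c <= b -> (eln P * c%:E <= b%:E)%E.
Proof.
move=> x0 c0 Px xb; apply: le_trans (_ : (ln x)%:E * c%:E <= _)%E; last by rewrite -EFinM lee_fin.
apply: lee_wpmul2r; first by rewrite lee_fin ltW.
case: P Px => [r| |] //=; rewrite ?leNye // lee_fin => rx.
by case: ifP => [r0|_]; rewrite ?leNye // lee_fin ler_ln ?posrE.
Qed.

Lemma alpha_lam_gt0 (R : realType) (lam : R) : 8 <= lam -> 0 < alpha_lam lam.
Proof.
move=> lam8; have [w0 _] := omega_bounds R; have [X3 _] := xi_props lam8.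
rewrite /alpha_lam golden_ratioE divr_gt0 // ?mulr_gt0 // ln_gt0 //; first by rewrite ltrDl; lra.
by move: X3; clear; lra.
Qed.

(** An exponent b strictly between [alpha_lam lam] and a absorbs the shift by 2, as T^a - 2 >= T^b
    eventually. Of the decay in |n|, q + 1 powers yield T^(-Q) and two make the sum converge. *)
Lemma Ptail_decay (R : realType) (lam a : R) (Q : nat) : 8 <= lam -> alpha_lam lam < a ->
  exists2 T0, 1 <= T0 & forall T, T0 <= T ->
    (Ptail lam (epow T a%:E - 2%:E) T <= (T ^- Q * 12)%R%:E)%E.
Proof.
move=> lam8 ha; pose b := (alpha_lam lam + a) / 2.
have al0 := alpha_lam_gt0 lam8.
have hb : alpha_lam lam < b by rewrite /b; lra.
have ba : b < a by rewrite /b; lra.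
have b0 : 0 < b by lra.
pose q := Num.truncn (Q%:R / b).
have Qq : Q%:R <= b * q.+1%:R.
  rewrite mulrC -ler_pdivrMr //; apply/ltW.
  by have /andP[_ h] := truncn_itv (divr_ge0 (ler0n R Q) (ltW b0)).
have [T0 T01 dec] := aT_decay (q.+1 + 2) lam8 hb.
exists (Num.max T0 (expR (ln 3 / (a - b)))); first by rewrite le_max T01.
move=> T; rewrite ge_max => /andP[TT0 TE].
have T1 : 1 <= T by apply: le_trans TT0.
have Tp : 0 < T by exact: lt_le_trans T1.
have Tb1 : 1 <= T `^ b by rewrite -(powRr0 T) ler_powR // ltW.
have Ta : T `^ b + 2 <= T `^ a.
  have -> : T `^ a = T `^ b * T `^ (a - b).
    by rewrite -powRD; [rewrite addrC subrK | rewrite (gt_eqF Tp) implybT].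
  have : 3 <= T `^ (a - b).
    rewrite /powR gt_eqF // -[leLHS]lnK ?posrE // ler_expR mulrC -ler_pdivrMr ?subr_gt0 //.
    by rewrite -ler_expR [leRHS]lnK.
  by move: Tb1; clear; nra.
have w0 n : 0 <= T ^- Q * summable_weight R n.
  by rewrite mulr_ge0 ?summable_weight_ge0 // invr_ge0 exprn_ge0 // ltW.
apply: le_trans (_ : \esum_(n in [set n : int | (epow T a%:E - 2%:E < ((`|n|%:~R : R))%:E)%E])
    (T ^- Q * summable_weight R n)%R%:E <= _)%E.
  apply: le_esum => n /=; rewrite -EFinB lte_fin => hn.
  have {}hn : T `^ b <= (absz n)%:R.
    have -> : (absz n)%:R = `|n|%:~R :> R by rewrite -abszE.
    by move: hn Ta; clear; lra.
  apply: le_trans (dec T n TT0 hn) _; rewrite lee_fin.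
  have n1 : 1 <= (absz n)%:R :> R by exact: le_trans hn.
  have n0 : (0 < absz n)%N by rewrite -(ler1n R).
  rewrite exprD invfM; apply: ler_pM => //; rewrite ?invr_ge0 ?exprn_ge0 //; last first.
    exact: inv_sqr_le_weight.
  rewrite lef_pV2 ?posrE ?exprn_gt0 //; last exact: lt_le_trans n1.
  apply: le_trans (_ : (T `^ b) ^+ q.+1 <= _); last first.
    by rewrite ler_pXn2r // nnegrE // powR_ge0.
  rewrite -!powR_mulrn ?powR_ge0 ?(ltW Tp) // -powRrM ler_powR //.
apply: esum_window => [n|L]; first by rewrite lee_fin.
rewrite sumEFin lee_fin -mulr_sumr; apply: ler_wpM2l; last exact: summable_weight_window.
by rewrite invr_ge0 exprn_ge0 // ltW.
Qed.

(** Decay faster than T^(-Q) bounds the limsup by 1 - Q for every Q, which forces -oo. For a = +oo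
    the tail is an empty sum. *)
Lemma Splus_gt_alpha (R : realType) (lam : R) (a : \bar R) : 8 <= lam ->
  ((alpha_lam lam)%:E < a)%E -> Splus lam a = +oo%E.
Proof.
move=> lam8 ha.
have dec Q : exists2 T0, 1 <= T0 & forall T, T0 <= T ->
    (Ptail lam (epow T a - 2%:E) T <= (T ^- Q * 12)%R%:E)%E.
  case: a ha => [a||] // ha; first exact: Ptail_decay.
  exists 1 => // T T1; rewrite /Ptail /= [X in esum X _](_ : _ = set0); last first.
    by apply/seteqP; split => // n; rewrite /= addye.
  by rewrite esum_set0 lee_fin mulr_ge0 // invr_ge0 exprn_ge0 // (le_trans _ T1).
rewrite /Splus; set L := limsup_oo _.
have LQ (Q : nat) : (L <= (1 - Q%:R)%R%:E)%E.
  have [T0 T01 hT] := dec Q.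
  (* Beyond 12 the constant 12 costs at most one factor T, the 1 in 1 - Q. *)
  apply: (limsup_oo_le (M := Num.max T0 12)) => T; rewrite gt_max => /andP[T0T T12].
  have T1 : 1 < T by exact: le_lt_trans T0T.
  have Tp : 0 < T by exact: lt_trans T1.
  have l0 : 0 < ln T by rewrite ln_gt0.
  have TQ : 0 < T ^+ Q by exact: exprn_gt0.
  apply: eln_mul_le (hT T (ltW T0T)) _; rewrite ?invr_gt0 ?mulr_gt0 ?invr_gt0 //.
  rewrite ler_pdivrMr // lnM ?posrE ?invr_gt0 // lnV ?posrE // lnXn // -[ln T *+ Q]mulr_natl.
  have : ln 12 <= ln T by rewrite ler_ln ?posrE // ltW.
  by rewrite mulrBl mul1r; move: l0; clear; lra.
clearbody L; case: L LQ => [r| |] LQ //; last by have := LQ 0%N.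
pose m := (Num.truncn (1 + `|r|)).+1.
have h2 : 1 + `|r| < m%:R by have /andP[] := truncn_itv (addr_ge0 ler01 (normr_ge0 r)).
have h3 : - r <= `|r| by rewrite -normrN; exact: ler_norm.
have := LQ m; rewrite lee_fin; move: h2 h3; clear=> h2 h3 h4; exfalso; lra.
Qed.

(** Sites up to T^a contribute at most T^(a p) times the total mass; beyond, decay of an order at
    least p + 2 leaves a summable remainder. *)
Lemma momentX_bound (R : realType) (lam a p : R) : 8 <= lam -> alpha_lam lam < a -> 0 < p ->
  exists2 T0, 1 <= T0 & forall T, T0 <= T ->
    (momentX lam p T <= (T `^ (a * p) * (2 * expR 1) + 12)%R%:E)%E.
Proof.
move=> lam8 ha p0.
pose q := (Num.truncn p).+1.
have pq : p <= q%:R by have /andP[_ /ltW] := truncn_itv (ltW p0).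
have [T0 T01 dec] := aT_decay (q + 2) lam8 ha.
exists T0 => // T TT0.
have T1 : 1 <= T by apply: le_trans TT0.
have Tp : 0 < T by exact: lt_le_trans T1.
have a0 : 0 < a by apply: lt_trans ha; exact: alpha_lam_gt0.
have Tap : 0 <= T `^ (a * p) by exact: powR_ge0.
apply: le_trans (_ : \esum_(n in [set: int])
    ((T `^ (a * p))%R%:E * aT lam n T + (summable_weight R n)%:E) <= _)%E.
  apply: le_esum => n _.
  have -> : `|n|%:~R = (absz n)%:R :> R by rewrite -abszE.
  have A0 := aT_ge0 lam n Tp.
  have [hn|/ltW hn] := leP (T `^ a) (absz n)%:R; last first.
    apply: le_trans (_ : (T `^ (a * p))%R%:E * aT lam n T <= _)%E.
      apply: lee_wpmul2r => //; rewrite lee_fin powRrM.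
      by apply: ge0_ler_powR; rewrite ?nnegrE ?powR_ge0 // ltW.
    by rewrite leeDl // lee_fin summable_weight_ge0.
  have n1 : 1 <= (absz n)%:R :> R.
    by apply: le_trans hn; rewrite -(powRr0 T) ler_powR // ltW.
  have n0 : (0 < absz n)%N by rewrite -(ler1n R).
  have np : 0 < (absz n)%:R :> R by rewrite ltr0n.
  apply: le_trans (_ : ((absz n)%:R ^- 2)%R%:E <= _)%E; last first.
    apply: le_trans (_ : (summable_weight R n)%:E <= _)%E.
      by rewrite lee_fin inv_sqr_le_weight.
    by rewrite leeDr // mule_ge0.
  apply: le_trans (_ : ((absz n)%:R `^ p)%R%:E * ((absz n)%:R ^- (q + 2))%R%:E <= _)%E.
    by apply: lee_wpmul2l; [rewrite lee_fin powR_ge0 | exact: dec].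
  rewrite -EFinM lee_fin exprD invfM mulrA ler_piMl ?invr_ge0 ?exprn_ge0 //.
  rewrite ler_pdivrMr ?exprn_gt0 // mul1r -powR_mulrn // ler_powR //.
apply: esum_window => [n|L].
  by rewrite adde_ge0 ?lee_fin ?summable_weight_ge0 // mule_ge0 // aT_ge0.
rewrite big_split /= sumEFin EFinD; apply: leeD; last by rewrite lee_fin summable_weight_window.
rewrite -ge0_sume_distrr; last by move=> i _; exact: aT_ge0.
by rewrite EFinM; apply: lee_wpmul2l => //; apply: aT_total => //; move: lam8; clear; lra.
Qed.

(** The gap between a and an intermediate exponent b absorbs the multiplicative constant of the
    moment bound. *)
Lemma beta_plus_le (R : realType) (lam a p : R) : 8 <= lam -> alpha_lam lam < a -> 0 < p ->
  (beta_plus lam p <= a%:E)%E.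
Proof.
move=> lam8 ha p0; pose b := (alpha_lam lam + a) / 2.
have al0 := alpha_lam_gt0 lam8.
have hb : alpha_lam lam < b by rewrite /b; lra.
have ba : 0 < a - b by rewrite /b; lra.
have b0 : 0 < b by lra.
have [T0 T01 hT] := momentX_bound lam8 hb p0.
pose K := 2 * expR 1 + 12 : R.
have K0 : 0 < K by rewrite addr_gt0 // mulr_gt0 // expR_gt0.
apply: (limsup_oo_le (M := Num.max T0 (expR (ln K / ((a - b) * p))))) => T.
rewrite gt_max => /andP[T0T TE].
have T1 : 1 < T by apply: le_lt_trans T0T.
have Tp : 0 < T by exact: lt_trans T1.
have l0 : 0 < ln T by rewrite ln_gt0.
have Tb : 1 <= T `^ (b * p) by rewrite -(powRr0 T) ler_powR ?ltW // mulr_gt0.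
have T'0 : 0 < T `^ (b * p) by exact: lt_le_trans Tb.
have hK : (momentX lam p T <= (T `^ (b * p) * K)%R%:E)%E.
  apply: le_trans (hT T (ltW T0T)) _; rewrite lee_fin /K mulrDr lerD2l.
  by rewrite ler_peMl.
apply: eln_mul_le hK _; rewrite ?invr_gt0 ?mulr_gt0 //.
rewrite ler_pdivrMr ?mulr_gt0 // lnM ?posrE // ln_powR.
have : ln K / ((a - b) * p) <= ln T by rewrite -ler_expR lnK ?posrE // ltW.
rewrite ler_pdivrMr ?mulr_gt0 // => h.
have -> : a * (p * ln T) = b * p * ln T + ln T * ((a - b) * p) by ring.
by rewrite lerD2l.
Qed.

Theorem theorem2 (R : realType) (lam : R) (hlam : 8 <= lam) :
  (alpha_u_plus lam <= (alpha_lam lam)%:E)%E /\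
  (forall p : R, 0 < p -> (beta_plus lam p <= (alpha_lam lam)%:E)%E).
Proof.
split=> [|p p0].
  apply: ge_ereal_sup => a [_ Sa]; rewrite leNgt; apply/negP => ha.
  by move: Sa; rewrite Splus_gt_alpha // ltxx.
apply/lee_addgt0Pr => e e0; rewrite -EFinD.
by apply: beta_plus_le => //; rewrite ltrDl.
Qed.
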